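(* Let $v$ be a viscosity solution of $H(x,c+v_x(x))=h(c)$ on $\mathbb{T}^n$. Then: (i) $v$ is differentiable at every point of $\mathcal{M}_\alpha(v;c)$. (ii) If $\gamma^\ast$ is a minimizing curve of $v$ and $(x^\ast,\xi^\ast)$ is an $\alpha$-limit point of $s\mapsto(\gamma^\ast(s),\gamma^{\ast\prime}(s))$, i.e. there exist $\tau_j\to-\infty$ with $(\gamma^\ast(\tau_j),\gamma^{\ast\prime}(\tau_j))\to(x^\ast,\xi^\ast)$, then $\xi^\ast=H_p(x^\ast,c+v_x(x^\ast))$. (iii) If $x^\ast\in\mathcal{M}_\alpha(v;c)$ and $x(s)$ is the solution of the Euler–Lagrange equation $\frac{d}{ds}L_\xi(x,x')=L_x(x,x')$ with $x(0)=x^\ast$, $x'(0)=H_p(x^\ast,c+v_x(x^\ast))$, then for all $s\in\mathbb{R}$ we have $x(s)\in\mathcal{M}_\alpha(v;c)$, $v$ is differentiable at $x(s)$ and $v_x(x(s))=L_\xi(x(s),x'(s))-c$. (iv) If $v$ and $\tilde v$ are two viscosity solutions of $H(x,c+v_x)=h(c)$ with $v=\tilde v$ on $\mathcal{M}_\alpha(c)$, then $v=\tilde v$ on $\mathbb{T}^n$.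
   Context: $H:\mathbb{T}^n\times\mathbb{R}^n\to\mathbb{R}$ is $C^2$, $H_{pp}$ is positive definite, and $H(x,p)/|p|\to+\infty$ as $|p|\to\infty$ uniformly in $x$. $L(x,\xi)=\sup_{p}\{\xi\cdot p-H(x,p)\}$ is its Legendre transform. $c\in\mathbb{R}^n$ is fixed and $h(c)$ is the unique constant for which $H(x,c+v_x)=h(c)$ has a viscosity solution on $\mathbb{T}^n$. Every viscosity solution $v$ is Lipschitz and satisfies, for all $x\in\mathbb{T}^n$ and $T>0$, $v(x)=\inf\{\int_{-T}^0(L(\gamma,\gamma')-c\cdot\gamma'+h(c))\,ds+v(\gamma(-T))\}$, the infimum being over absolutely continuous $\gamma:[-T,0]\to\mathbb{T}^n$ with $\gamma(0)=x$. A minimizing curve for $v(x)$ (one-sided global minimizing curve) is a curve $\gamma^\ast:(-\infty,0]\to\mathbb{T}^n$ with $\gamma^\ast(0)=x$ whose restriction to $[-T,0]$ attains this infimum for every $T>0$; a minimizing curve of $v$ is a minimizing curve for $v(x)$ for some $x$. A point $x^\ast$ is an $\alpha$-limit point of $\gamma^\ast$ if $\gamma^\ast(\tau_j)\to x^\ast$ for some sequence $\tau_j\to-\infty$. $\mathcal{M}_\alpha(v;c)$ is the closure of the set of all $\alpha$-limit points of all minimizing curves for $v(x)$, $x\in\mathbb{T}^n$; $\mathcal{M}_\alpha(c)$ is the closure of the union of $\mathcal{M}_\alpha(v;c)$ over all viscosity solutions $v$ (with this fixed $c$). *)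

(* Defs.v *)
From HB Require Import structures.
From mathcomp Require Import all_boot all_order all_algebra.
From mathcomp Require Import all_classical all_reals all_analysis.
Set Implicit Arguments. Unset Strict Implicit. Unset Printing Implicit Defensive.
Import Order.TTheory GRing.Theory Num.Theory.
Import numFieldNormedType.Exports.
Local Open Scope classical_set_scope.
Local Open Scope ring_scope.

Definition evec {R : realType} {m : nat} (i : 'I_m) : 'rV[R]_m := delta_mx 0 i.

Definition pder {R : realType} {m : nat} (f : 'rV[R]_m -> R) (i : 'I_m)
  (x : 'rV[R]_m) : R := derive f x (evec i).

Definition grad {R : realType} {m : nat} (f : 'rV[R]_m -> R) (x : 'rV[R]_m)
  : 'rV[R]_m := \row_i pder f i x.

Definition C1 {R : realType} {m : nat} (f : 'rV[R]_m -> R) : Prop :=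
  continuous f /\ (forall i x, derivable f x (evec i)) /\
  (forall i, continuous (pder f i)).

Definition C2 {R : realType} {m : nat} (f : 'rV[R]_m -> R) : Prop :=
  C1 f /\ forall i, C1 (pder f i).

Definition dotv {R : realType} {m : nat} (u w : 'rV[R]_m) : R :=
  \sum_(i < m) u 0 i * w 0 i.

(* ---------- the torus T^n = R^n / Z^n, via Z^n-periodic lifts ---------- *)

Definition intv {R : realType} {m : nat} (k : 'rV[int]_m) : 'rV[R]_m :=
  map_mx (fun z : int => z%:~R) k.

Definition Zn_periodic {R : realType} {m : nat} {T : Type}
  (f : 'rV[R]_m -> T) : Prop :=
  forall (x : 'rV[R]_m) (k : 'rV[int]_m), f (x + intv k) = f x.

Definition Hjoint {R : realType} {n : nat} (H : 'rV[R]_n -> 'rV[R]_n -> R)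
  : 'rV[R]_(n + n) -> R := fun z => H (lsubmx z) (rsubmx z).

Definition Hp {R : realType} {n : nat} (H : 'rV[R]_n -> 'rV[R]_n -> R)
  (x p : 'rV[R]_n) : 'rV[R]_n := grad (H x) p.

Definition Hpp {R : realType} {n : nat} (H : 'rV[R]_n -> 'rV[R]_n -> R)
  (x p : 'rV[R]_n) : 'M[R]_n := \matrix_(i, j) pder (pder (H x) i) j p.

Definition posdef {R : realType} {n : nat} (M : 'M[R]_n) : Prop :=
  forall xi : 'rV[R]_n, xi != 0 -> 0 < (xi *m M *m xi^T) 0 0.

Definition superlinear {R : realType} {n : nat}
  (H : 'rV[R]_n -> 'rV[R]_n -> R) : Prop :=
  forall M : R, exists K : R, forall x p : 'rV[R]_n,
    K < `|p| -> M <= H x p / `|p|.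

Definition Tonelli_Hamiltonian {R : realType} {n : nat}
  (H : 'rV[R]_n -> 'rV[R]_n -> R) : Prop :=
  [/\ C2 (Hjoint H),
      (forall p, Zn_periodic (fun x => H x p)),
      (forall x p, posdef (Hpp H x p)) &
      superlinear H].

Definition Lag {R : realType} {n : nat} (H : 'rV[R]_n -> 'rV[R]_n -> R)
  (x xi : 'rV[R]_n) : R :=
  sup [set dotv xi p - H x p | p in [set: 'rV[R]_n]].

Definition Lxi {R : realType} {n : nat} (H : 'rV[R]_n -> 'rV[R]_n -> R)
  (x xi : 'rV[R]_n) : 'rV[R]_n := grad (Lag H x) xi.

Definition Lx {R : realType} {n : nat} (H : 'rV[R]_n -> 'rV[R]_n -> R)
  (x xi : 'rV[R]_n) : 'rV[R]_n := grad (fun y => Lag H y xi) x.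

Definition visc_subsol {R : realType} {n : nat} (H : 'rV[R]_n -> 'rV[R]_n -> R)
  (c : 'rV[R]_n) (h : R) (v : 'rV[R]_n -> R) : Prop :=
  forall (phi : 'rV[R]_n -> R) (x0 : 'rV[R]_n), C1 phi ->
    (\forall y \near x0, v y - phi y <= v x0 - phi x0) ->
    H x0 (c + grad phi x0) <= h.

Definition visc_supersol {R : realType} {n : nat} (H : 'rV[R]_n -> 'rV[R]_n -> R)
  (c : 'rV[R]_n) (h : R) (v : 'rV[R]_n -> R) : Prop :=
  forall (phi : 'rV[R]_n -> R) (x0 : 'rV[R]_n), C1 phi ->
    (\forall y \near x0, v x0 - phi x0 <= v y - phi y) ->
    h <= H x0 (c + grad phi x0).

(* a viscosity solution on T^n, seen as a Z^n-periodic function on R^n *)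
Definition viscosity_solution {R : realType} {n : nat}
  (H : 'rV[R]_n -> 'rV[R]_n -> R) (c : 'rV[R]_n) (h : R)
  (v : 'rV[R]_n -> R) : Prop :=
  [/\ Zn_periodic v, continuous v, visc_subsol H c h v & visc_supersol H c h v].

Definition lipschitz_fun {R : realType} {n : nat} (v : 'rV[R]_n -> R) : Prop :=
  exists K : R, forall x y, `|v x - v y| <= K * `|x - y|.

Definition abs_cont_on {R : realType} {n : nat} (g : R -> 'rV[R]_n)
  (lo hi : R) : Prop :=
  forall e : R, 0 < e -> exists d : R, 0 < d /\
    forall (k : nat) (a b : 'I_k -> R),
      (forall i, lo <= a i /\ a i <= b i /\ b i <= hi) ->
      (forall i j, i != j -> b i <= a j \/ b j <= a i) ->
      \sum_(i < k) (b i - a i) < d ->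
      \sum_(i < k) `|g (b i) - g (a i)| < e.

Definition action {R : realType} {n : nat} (H : 'rV[R]_n -> 'rV[R]_n -> R)
  (c : 'rV[R]_n) (h : R) (T : R) (g : R -> 'rV[R]_n) : \bar R :=
  (\int[lebesgue_measure]_(s in `[(- T)%R, 0%R]%classic)
     (Lag H (g s) ((derive1 g) s) - dotv c ((derive1 g) s) + h)%:E)%E.

Definition admissible {R : realType} {n : nat} (T : R) (x : 'rV[R]_n)
  (g : R -> 'rV[R]_n) : Prop :=
  abs_cont_on g (- T) 0 /\ g 0 = x.

Definition representation_formula {R : realType} {n : nat}
  (H : 'rV[R]_n -> 'rV[R]_n -> R) (c : 'rV[R]_n) (h : R)
  (v : 'rV[R]_n -> R) : Prop :=
  forall (x : 'rV[R]_n) (T : R), 0 < T ->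
    (v x)%:E = ereal_inf [set (action H c h T g + (v (g (- T)))%:E)%E
                         | g in admissible T x].

Definition minimizing_curve_for {R : realType} {n : nat}
  (H : 'rV[R]_n -> 'rV[R]_n -> R) (c : 'rV[R]_n) (h : R)
  (v : 'rV[R]_n -> R) (x : 'rV[R]_n) (g : R -> 'rV[R]_n) : Prop :=
  g 0 = x /\ forall T : R, 0 < T ->
    admissible T x g /\
    (v x)%:E = (action H c h T g + (v (g (- T)))%:E)%E.

Definition minimizing_curve {R : realType} {n : nat}
  (H : 'rV[R]_n -> 'rV[R]_n -> R) (c : 'rV[R]_n) (h : R)
  (v : 'rV[R]_n -> R) (g : R -> 'rV[R]_n) : Prop :=
  exists x, minimizing_curve_for H c h v x g.

(* y (mod Z^n) is an alpha-limit point of g in T^n *)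
Definition alpha_limit {R : realType} {n : nat} (g : R -> 'rV[R]_n)
  (y : 'rV[R]_n) : Prop :=
  exists (tau : nat -> R) (k : nat -> 'rV[int]_n),
    tau @ \oo --> -oo /\ (fun j => g (tau j) - intv (k j)) @ \oo --> y.

(* M_alpha(v;c), as a (Z^n-periodic) subset of R^n *)
Definition Malpha_v {R : realType} {n : nat}
  (H : 'rV[R]_n -> 'rV[R]_n -> R) (c : 'rV[R]_n) (h : R)
  (v : 'rV[R]_n -> R) : set 'rV[R]_n :=
  closure [set y | exists g, minimizing_curve H c h v g /\ alpha_limit g y].

Definition Malpha {R : realType} {n : nat}
  (H : 'rV[R]_n -> 'rV[R]_n -> R) (c : 'rV[R]_n) (h : R) : set 'rV[R]_n :=
  closure [set y | exists w, viscosity_solution H c h w /\ Malpha_v H c h w y].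

Definition EL_solution {R : realType} {n : nat}
  (H : 'rV[R]_n -> 'rV[R]_n -> R) (x : R -> 'rV[R]_n) : Prop :=
  forall s : R,
    derivable x s 1 /\
    derivable (fun t => Lxi H (x t) ((derive1 x) t)) s 1 /\
    derive1 (fun t => Lxi H (x t) ((derive1 x) t)) s = Lx H (x s) ((derive1 x) s).

(* Main.v *)
Require Import Defs.
From HB Require Import structures.
From mathcomp Require Import all_boot all_order all_algebra.
From mathcomp Require Import all_classical all_reals all_analysis.
From mathcomp Require Import measurable_realfun ring lra.
Set Implicit Arguments. Unset Strict Implicit. Unset Printing Implicit Defensive.
Import Order.TTheory GRing.Theory Num.Theory.
Import numFieldNormedType.Exports.
Local Open Scope classical_set_scope.
Local Open Scope ring_scope.

(** Let u = v + c.x, so that u_x = c + v_x. Comparison with straight lines gives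
    u(y + d xi) - u(y) <= d (L(y, xi) + h) + O(d^2), and the inequality
    L >= p.xi - H, integrated along a minimizing curve g, gives conversely
    p.(g b - g a) - (b - a) (H(g a, p) - h) - O((b - a)^2) <= u(g b) - u(g a)
    for bounded p. Used on both sides of g s at time scale t^2, they enclose
    u(g s + z) - u(g s), for |z| <= t^3, between affine functions of z up to
    O(t^4). Hence u has a gradient P at g s with
    |u(g s + z) - u(g s) - P.z| = O(t^4), with constants uniform over all
    minimizing curves and s <= -1. This is a closed condition, which gives (i),
    and it makes P Hoelder continuous, which gives (ii). The same inequalities
    show that (g, u_x(g)) solves Hamilton's equations; by Gronwall the
    Euler-Lagrange solution of (iii) is shadowed by translates of remote pieces
    of minimizing curves, and (iii) passes to the limit. For (iv), a minimizing
    curve for v(x) exists (a limit of chains of near-minimizing short steps), and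
    w(x) - v(x) <= (w - v)(g(-T)) for any other solution w; let T go to infinity
    along a sequence for which g(-T) converges modulo Z^n. *)

(** The exponents come from a balance. A displacement [z] of an endpoint is absorbed over a time
    [t ^+ 2] by changing the velocity by [z / t ^+ 2]. To second order this costs
    [t ^+ 2 * |z / t ^+ 2| ^+ 2], while freezing the base point of the Lagrangian costs
    [(t ^+ 2) ^+ 2]; both are of order [t ^+ 4] when [|z|] is of order [t ^+ 3]. The gap between the
    backward and the forward momentum is then at most of order [t ^+ 4 / t ^+ 3 = t], so both
    converge to the same vector as [t] tends to 0. Two obstacles shape the rest. Admissible curves
    are merely absolutely continuous and no measurability of the integrand is at hand, so the action
    is handled by comparison and additivity alone, together with a fundamental theorem of calculus
    for absolutely continuous functions. Moreover, pointwise limits of curves do not control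
    derivatives; hence minimality is first weakened to inequalities between endpoints, [calibrated],
    which pass to such limits, and it is recovered afterwards from the regularity that these
    inequalities imply. *)

Section row_vectors.
Context {R : realType} {m : nat}.
Implicit Types (x y z : 'rV[R]_m) (r : R).

Lemma ler_coord_norm x i : `|x 0 i| <= `|x|.
Proof.
rewrite [leRHS]/Num.Def.normr/= mx_normrE.
exact: (@le_bigmax _ R _ 0 (fun ij => `|x ij.1 ij.2|) (0, i)).
Qed.

Lemma rV_norm_le x r : 0 <= r -> (forall i, `|x 0 i| <= r) -> `|x| <= r.
Proof.
move=> r0 H; rewrite /Num.Def.normr/= mx_normrE.
by apply: bigmax_le => //= -[i j] _ /=; rewrite ord1.
Qed.

Lemma dotvC x y : dotv x y = dotv y x.
Proof. by apply: eq_bigr => i _; rewrite mulrC. Qed.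

Lemma dotvDl x y z : dotv (x + y) z = dotv x z + dotv y z.
Proof. by rewrite -big_split/=; apply: eq_bigr => i _; rewrite mxE mulrDl. Qed.

Lemma dotvDr x y z : dotv x (y + z) = dotv x y + dotv x z.
Proof. by rewrite dotvC dotvDl !(dotvC x). Qed.

Lemma dotvZl r x y : dotv (r *: x) y = r * dotv x y.
Proof. by rewrite /dotv mulr_sumr; apply: eq_bigr => i _; rewrite mxE mulrA. Qed.

Lemma dotvZr r x y : dotv x (r *: y) = r * dotv x y.
Proof. by rewrite dotvC dotvZl dotvC. Qed.

Lemma dotvNl x y : dotv (- x) y = - dotv x y.
Proof. by rewrite -scaleN1r dotvZl mulN1r. Qed.

Lemma dotvNr x y : dotv x (- y) = - dotv x y.
Proof. by rewrite dotvC dotvNl dotvC. Qed.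

Lemma dotvBl x y z : dotv (x - y) z = dotv x z - dotv y z.
Proof. by rewrite dotvDl dotvNl. Qed.

Lemma dotvBr x y z : dotv x (y - z) = dotv x y - dotv x z.
Proof. by rewrite dotvDr dotvNr. Qed.

Lemma dotv0l x : dotv 0 x = 0.
Proof. by rewrite -(scale0r x) dotvZl mul0r. Qed.

Lemma dotv0r x : dotv x 0 = 0.
Proof. by rewrite dotvC dotv0l. Qed.

Lemma dotv_evec x i : dotv x (evec i) = x 0 i.
Proof.
rewrite /dotv (bigD1 i)//= big1 ?addr0; first by rewrite mxE !eqxx mulr1.
by move=> j ji; rewrite mxE (negbTE ji) mulr0.
Qed.

Lemma normr_dotv x y : `|dotv x y| <= m%:R * `|x| * `|y|.
Proof.
apply: le_trans (ler_norm_sum _ _ _) _.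
apply: (@le_trans _ _ (\sum_(i < m) `|x| * `|y|)).
  apply: ler_sum => i _; rewrite normrM ler_pM//; exact: ler_coord_norm.
by rewrite sumr_const card_ord -mulrA mulr_natl.
Qed.

Lemma dotv_le x y : dotv x y <= m%:R * `|x| * `|y|.
Proof. exact: le_trans (ler_norm _) (normr_dotv x y). Qed.

Lemma norm_evec i : `|evec i : 'rV[R]_m| = 1.
Proof.
apply/eqP; rewrite eq_le; apply/andP; split.
  by apply: rV_norm_le => // j; rewrite mxE; case: (_ && _); rewrite ?normr1 ?normr0.
by have := ler_coord_norm (evec i) i; rewrite mxE !eqxx normr1.
Qed.

Lemma dotvv_ge0 x : 0 <= dotv x x.
Proof. by apply: sumr_ge0 => i _; rewrite -expr2 sqr_ge0. Qed.

Lemma norm_dotvv x : `|x| ^+ 2 <= dotv x x.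
Proof.
have [->|x0] := eqVneq x 0; first by rewrite normr0 expr0n dotv0l.
have [i ->] : exists i, `|x| = `|x 0 i|.
  have /mx_norm_neq0[[j i] E] : mx_norm x != 0 by rewrite -[mx_norm x]/(`|x|) normr_eq0.
  by exists i; rewrite -[`|x|]/(mx_norm x) E ord1.
rewrite real_normK ?num_real// /dotv (bigD1 i)//= expr2 lerDl.
by apply: sumr_ge0 => j _; rewrite -expr2 sqr_ge0.
Qed.

(* duality between the sup norm and [dotv]: it suffices to test on the basis vectors *)
Lemma rV_norm_le_dotv x r d : 0 < d -> (forall z, `|z| <= d -> dotv x z <= r * d) -> `|x| <= r.
Proof.
move=> d0 H; have r0 : 0 <= r.
  by have := H 0; rewrite normr0 dotv0r (ltW d0) pmulr_lge0// => /(_ isT).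
apply: rV_norm_le => // i.
have := H (d *: evec i); have := H (- (d *: evec i)).
rewrite normrN normrZ norm_evec mulr1 gtr0_norm// lexx dotvNr dotvZr dotv_evec.
move=> /(_ isT) h1 /(_ isT) h2.
rewrite ler_norml -(ler_pM2r d0) -[X in _ && X](ler_pM2r d0); apply/andP; split; lra.
Qed.

Lemma nbhs_normP (x : 'rV[R]_m) (A : set 'rV[R]_m) :
  nbhs x A <-> exists2 d, 0 < d & forall y, `|x - y| < d -> A y.
Proof.
split=> [/nbhs_ballP[d /= d0 dA]|[d d0 dA]].
  by exists d => // y xy; apply: dA; rewrite -ball_normE.
by apply/nbhs_ballP; exists d => // y; rewrite -ball_normE; exact: dA.
Qed.

Lemma near_norm (x : 'rV[R]_m) r : 0 < r -> \forall y \near x, `|x - y| < r.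
Proof. by move=> r0; apply/nbhs_normP; exists r. Qed.

Lemma continuous_atP (V : normedModType R) (f : 'rV[R]_m -> V) x :
  {for x, continuous f} <->
  forall e, 0 < e -> exists2 d, 0 < d & forall y, `|x - y| < d -> `|f x - f y| < e.
Proof.
split=> [cf e e0|H A].
  have /cf := nbhsx_ballx (f x) e e0; rewrite -ball_normE.
  by move=> /nbhs_normP[d d0 dP]; exists d.
move=> /nbhs_ballP[e /= e0 eA]; have [d d0 dP] := H e e0.
apply/nbhs_normP; exists d => // y /dP fxy.
by apply: eA; rewrite -ball_normE.
Qed.

End row_vectors.

(** * Integrals of possibly nonmeasurable functions *)

Section lower_integral.
Context d (T : measurableType d) (R : realType).
Variable mu : {measure set T -> \bar R}.
Local Open Scope ereal_scope.
Import HBNNSimple.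
Implicit Types (f g : T -> \bar R) (A B D : set T).

Lemma ge0_le_integral_nomeas D f g : (forall x, D x -> 0 <= f x) ->
  (forall x, D x -> f x <= g x) ->
  \int[mu]_(x in D) f x <= \int[mu]_(x in D) g x.
Proof.
move=> f0 fg.
have g0 x : D x -> 0 <= g x by move=> Dx; exact: le_trans (f0 _ Dx) (fg _ Dx).
rewrite !ge0_integralE//; apply: ge_ereal_sup => _ [s sf <-].
apply: ereal_sup_ubound; exists s => //= x; apply: (le_trans (sf x)).
by rewrite /patch; case: ifP => // /[!inE]; exact: fg.
Qed.

(* The integral of a nonnegative function is a lower integral, so neither this
   comparison nor the additivity below requires measurability of the integrand. *)
Lemma le_integral_nomeas D f g : (forall x, D x -> f x <= g x) ->
  \int[mu]_(x in D) f x <= \int[mu]_(x in D) g x.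
Proof.
move=> fg; rewrite integralE [leRHS]integralE; apply: leeB.
- apply: ge0_le_integral_nomeas => // x Dx.
  by rewrite !funeposE; apply: le_max2 => //; exact: fg.
- apply: ge0_le_integral_nomeas => // x Dx.
  by rewrite !funenegE; apply: le_max2 => //; rewrite leeN2; exact: fg.
Qed.

(** A simple function below [f] on the union is the sum of its restrictions to [A] and [B], and
    conversely simple functions below the two restrictions of [f] add up to one below [f]; hence the
    suprema of simple integrals add up. *)
Lemma ge0_integral_setU_nomeas A B f : measurable A -> measurable B ->
  [disjoint A & B] -> (forall x, (A `|` B) x -> 0 <= f x) ->
  \int[mu]_(x in A `|` B) f x = \int[mu]_(x in A) f x + \int[mu]_(x in B) f x.
Proof.
move=> mA mB /disj_setPS AB f0.
have fA0 x : A x -> 0 <= f x by move=> Ax; apply: f0; left.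
have fB0 x : B x -> 0 <= f x by move=> Bx; apply: f0; right.
have nAB x : A x -> B x -> False by move=> ? ?; apply: (AB x).
rewrite !ge0_integralE//; apply/eqP; rewrite eq_le; apply/andP; split.
  apply: ge_ereal_sup => _ [s sf <-].
  pose sA : {nnsfun T >-> R} := proj_nnsfun s mA.
  pose sB : {nnsfun T >-> R} := proj_nnsfun s mB.
  have EA x : sA x = if x \in A then s x else 0%R by rewrite /sA -mrestrict.
  have EB x : sB x = if x \in B then s x else 0%R by rewrite /sB -mrestrict.
  have sAB : s =1 (sA \+ sB)%R.
    move=> x; have := sf x; change ((sA \+ sB)%R x) with (sA x + sB x)%R; rewrite EA EB /patch.
    have := @fun_ge0 _ _ s x => s0.
    case: ifPn => xAB.
      move: xAB; rewrite inE => -[Ax|Bx] _.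
        rewrite mem_set// memNset ?addr0//.
        by move=> Bx; exact: (nAB x).
      rewrite [x \in B]mem_set// memNset ?add0r//.
      by move=> Ax; exact: (nAB x).
    move: xAB; rewrite notin_setE => nx; rewrite lee_fin => s0'.
    rewrite !memNset ?addr0.
      by apply/eqP; rewrite eq_le s0 s0'.
    + by move=> Bx; apply: nx; right.
    + by move=> Ax; apply: nx; left.
  rewrite (eq_sintegral _ _ sAB) sintegralD.
  apply: leeD; apply: ereal_sup_ubound.
  - exists sA; last by [].
    move=> x; rewrite EA /patch; case: ifPn => [xA|//].
      apply: (le_trans (sf x)); rewrite /patch mem_set//.
      by left; rewrite inE in xA.
  - exists sB; last by [].
    move=> x; rewrite EB /patch; case: ifPn => [xA|//].
      apply: (le_trans (sf x)); rewrite /patch mem_set//.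
      by right; rewrite inE in xA.
set C := (X in _ <= X).
have H (s1 s2 : {nnsfun T >-> R}) : (forall x, (s1 x)%:E <= (f \_ A) x) ->
   (forall x, (s2 x)%:E <= (f \_ B) x) -> sintegral mu s1 + sintegral mu s2 <= C.
  move=> h1 h2; rewrite -sintegralD; apply: ereal_sup_ubound.
  exists (add_nnsfun s1 s2) => //= x.
  have := h1 x; have := h2 x.
  have s10 := @fun_ge0 _ _ s1 x; have s20 := @fun_ge0 _ _ s2 x.
  rewrite /patch EFinD; have [xA|xA] := boolP (x \in A).
    rewrite memNset; last by move=> Bx; apply: (nAB x); rewrite inE in xA.
    rewrite mem_set; last by left; rewrite inE in xA.
    move=> a b; rewrite -[leRHS]adde0; exact: leeD.
  have [xB|xB] := boolP (x \in B).
    rewrite mem_set; last by right; rewrite inE in xB.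
    move=> a b; rewrite -[leRHS]add0e; exact: leeD.
  rewrite memNset; last by case; rewrite -inE; [apply/negP|apply/negP].
  by move=> a b; rewrite -[leRHS]adde0; exact: leeD.
have C0 : 0 <= C.
  apply: ereal_sup_ubound; exists nnsfun0; last exact: sintegral0.
  move=> x /=; rewrite /patch; case: ifP => // /[!inE]; exact: f0.
have := C0; rewrite le_eqVlt.
(* An infinite integral over the union leaves nothing to prove; a finite one makes both suprema
   finite, so that they can be moved across the inequality one at a time. *)
case: C H C0 => [c| |//] H C0 _; last by rewrite leey.
have fin s : (forall x, ((s : {nnsfun T >-> R}) x)%:E <= (f \_ A) x) ->
    sintegral mu s \is a fin_num.
  move=> h1; rewrite ge0_fin_numE; last exact: sintegral_ge0.
  apply: (@le_lt_trans _ _ c%:E); last exact: ltry.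
  apply: le_trans (H s nnsfun0 h1 _); last first.
    move=> x /=; rewrite /patch; case: ifP => // /[!inE]; exact: fB0.
  by rewrite leeDl// sintegral_ge0.
set b := ereal_sup [set _ | _ in [set h | forall x, _ <= (f \_ B) x]].
have b0 : 0 <= b.
  apply: ereal_sup_ubound; exists nnsfun0; last exact: sintegral0.
  move=> x /=; rewrite /patch; case: ifP => // /[!inE]; exact: fB0.
have Hb s : (forall x, ((s : {nnsfun T >-> R}) x)%:E <= (f \_ A) x) ->
    sintegral mu s + b <= c%:E.
  move=> h1; rewrite -leeBrDl ?fin//; apply: ge_ereal_sup => _ [s2 h2 <-].
  by rewrite leeBrDl ?fin//; exact: H.
have bfin : b \is a fin_num.
  rewrite ge0_fin_numE//; apply: (@le_lt_trans _ _ c%:E); last exact: ltry.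
  apply: le_trans (Hb nnsfun0 _); first by rewrite leeDr// sintegral_ge0.
  move=> x /=; rewrite /patch; case: ifP => // /[!inE]; exact: fA0.
rewrite -leeBrDr//; apply: ge_ereal_sup => _ [s1 h1 <-].
by rewrite leeBrDr//; exact: Hb.
Qed.

(** The lower bound and the finite measures keep the integrals of the negative part finite, which
    rules out [oo - oo] when positive and negative parts are recombined. *)
Lemma integral_setU_nomeas A B (f : T -> R) (C : R) : measurable A -> measurable B ->
  mu A < +oo -> mu B < +oo ->
  [disjoint A & B] -> (forall x, (A `|` B) x -> (- C <= f x)%R) ->
  \int[mu]_(x in A `|` B) (f x)%:E =
    \int[mu]_(x in A) (f x)%:E + \int[mu]_(x in B) (f x)%:E.
Proof.
move=> mA mB muA muB AB fC.
have fin D : measurable D -> mu D < +oo -> D `<=` A `|` B ->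
    \int[mu]_(x in D) ((EFin \o f)^\- x) \is a fin_num.
  move=> mD muD DAB; rewrite ge0_fin_numE; last by apply: integral_ge0 => x _; exact: funeneg_ge0.
  apply: (@le_lt_trans _ _ (\int[mu]_(x in D) (`|C|)%:E)).
    apply: ge0_le_integral_nomeas => // x Dx.
    rewrite funenegE ge_max; apply/andP; split; last by rewrite lee_fin.
    rewrite -EFinN lee_fin lerNl; apply: le_trans (fC _ (DAB _ Dx)).
    by rewrite lerN2 ler_norm.
  rewrite integral_cst//; exact: lte_mul_pinfty.
rewrite integralE [X in _ = X + _]integralE [X in _ = _ + X]integralE.
rewrite !ge0_integral_setU_nomeas//.
have fA := fin A mA muA (@subsetUl _ _ _); have fB := fin B mB muB (@subsetUr _ _ _).
rewrite fin_num_oppeD//.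
by rewrite addeACA.
Qed.

End lower_integral.

(** * Absolutely continuous functions *)

Section absolute_continuity.
Context {R : realType}.
Implicit Types (f F : R -> R) (a b : R) (s t : seq (R * R)).

Definition subitv a b : pred (R * R) := fun p => [&& a <= p.1, p.1 <= p.2 & p.2 <= b].
Definition nonoverlap : rel (R * R) := fun p q => (p.2 <= q.1) || (q.2 <= p.1).
Definition total_length s := \sum_(p <- s) (p.2 - p.1).
(** Families of intervals are lists here, unlike in [abs_cont_on]: estimating a variation replaces
    an interval by the pieces of a partition, which is an operation on lists. *)
Definition disjoint_subitvs a b s := all (subitv a b) s && pairwise nonoverlap s.
Definition abs_continuous f a b := forall e, 0 < e -> exists2 d, 0 < d &
  forall s, disjoint_subitvs a b s -> total_length s < d ->
    \sum_(p <- s) `|f p.2 - f p.1| < e.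

Lemma nonoverlap_sym : symmetric nonoverlap.
Proof. by move=> p q; rewrite /nonoverlap orbC. Qed.

(** The intervals of the partition [l] move one by one to the front of [t]. This creates no overlap
    and preserves the total length, so the hypothesis applies once [l] is exhausted. [C] stands for
    the contribution of [s], estimated beforehand. *)
Lemma variation_le_abs_continuous f a b (e d C : R) s t x y l :
  (forall t', disjoint_subitvs a b (s ++ t') -> total_length (s ++ t') < d ->
    (C + \sum_(p <- t') `|f p.2 - f p.1| <= e)) ->
  itv_partition x y l -> x <= y ->
  disjoint_subitvs a b ((x, y) :: s ++ t) -> total_length ((x, y) :: s ++ t) < d ->
  C + variation x y f l + \sum_(p <- t) `|f p.2 - f p.1| <= e.
Proof.
move=> H; elim: l x t => [|z l IH] x t xyl xy.
  rewrite /disjoint_subitvs /total_length/= big_cons /=.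
  move=> /andP[/andP[_ st] /andP[_ st']] len.
  rewrite /variation/= big_nil addr0; apply: H; first by rewrite /disjoint_subitvs st.
  rewrite /total_length; move: len; apply: le_lt_trans.
  by rewrite lerDr subr_ge0.
have zy : z <= y by exact: itv_partition_le (itv_partition_cons xyl).
have xz : x <= z by case: xyl => /= /andP[/ltW].
have -> : variation x y f (z :: l) = `|f z - f x| + variation z y f l.
  by rewrite /variation/= big_nat_recl.
rewrite /disjoint_subitvs/= => /andP[/andP[sxy sst] /andP[nst pst]] len.
have := IH z ((x, z) :: t) (itv_partition_cons xyl) zy.
rewrite big_cons/= addrA -(addrA C (variation _ _ _ _)) (addrC (variation _ _ _ _)).
apply.
  rewrite /disjoint_subitvs/= all_cat/=.
  move: sxy sst; rewrite /subitv/= all_cat => /and3P[ax _ yb] /andP[-> ->].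
  rewrite (le_trans ax xz) zy yb ax xz (le_trans zy yb)/=.
  move: nst pst; rewrite !all_cat !pairwise_cat/= => /andP[ns nt] /and3P[st ps pt].
  rewrite allrel_consr ps pt st !andbT/=.
  have Q q : nonoverlap (x, y) q -> nonoverlap (z, y) q && nonoverlap (x, z) q.
    rewrite /nonoverlap/= => /orP[h|h]; first by rewrite h (le_trans zy h).
    by rewrite h (le_trans h xz) !orbT.
  apply/and3P; split; [apply/and3P; split| |].
  - by apply: sub_all ns => q /Q/andP[].
  - by rewrite /nonoverlap/= lexx orbT.
  - by apply: sub_all nt => q /Q/andP[].
  - by apply: sub_all ns => q /Q/andP[_]; rewrite nonoverlap_sym.
  - by apply: sub_all nt => q /Q/andP[].
move: len; rewrite /total_length !big_cons !big_cat/= big_cons/=; apply: le_lt_trans.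
by rewrite le_eqVlt; apply/orP; left; apply/eqP; ring.
Qed.

Local Notation TV := total_variation.

(** Intervals pass from the list [t], where they count by their increment, to the list [s], where
    they count by their total variation. One budget [d] shared by both lists makes the induction on
    [s] work; for empty [t] the result says that the variation function is absolutely continuous. *)
Lemma abs_continuous_total_variation f a b : abs_continuous f a b ->
  forall e, 0 < e -> exists2 d, 0 < d & forall s t, disjoint_subitvs a b (s ++ t) ->
    total_length (s ++ t) < d ->
    (\sum_(p <- s) TV p.1 p.2 f + (\sum_(p <- t) `|f p.2 - f p.1|)%:E <= e%:E)%E.
Proof.
move=> acf e e0; have [d d0 H] := acf _ e0; exists d => // s.
elim: s => [t dt lt|[x y] s IH t dt lt].
  by rewrite big_nil add0e lee_fin ltW// H.
have sum0 u : 0 <= \sum_(p <- u) `|f p.2 - f p.1| :> R by exact: sumr_ge0.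
have lest u : disjoint_subitvs a b (s ++ u) -> (0 <= \sum_(p <- s) TV p.1 p.2 f)%E.
  rewrite /disjoint_subitvs all_cat => /andP[/andP[sS _] _].
  rewrite big_seq; apply: sume_ge0 => p ps; apply: total_variation_ge0.
  by have /and3P[] := allP sS _ ps.
have xy : x <= y by move: dt => /andP[/= /andP[/and3P[]]].
have dst : disjoint_subitvs a b (s ++ t).
  by move: dt => /andP[/= /andP[_ h1] /andP[_ h2]]; rewrite /disjoint_subitvs h1 h2.
have lst : total_length (s ++ t) < d.
  move: lt; rewrite /total_length/= big_cons; apply: le_lt_trans.
  by rewrite lerDr subr_ge0.
have fin : (\sum_(p <- s) TV p.1 p.2 f)%E \is a fin_num.
  rewrite ge0_fin_numE; last exact: lest dst.
  apply: (@le_lt_trans _ _ e%:E); last exact: ltry.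
  by apply: le_trans (IH _ dst lst); rewrite leeDl// lee_fin.
rewrite big_cons/= -(fineK fin) -addeA -EFinD -leeBrDr//.
apply: ge_ereal_sup => _ [_ [l xyl <-] <-].
rewrite -EFinB lee_fin lerBrDr addrA (addrC (variation _ _ _ _)).
apply: (@variation_le_abs_continuous f a b e d _ s) => // t' dt' lt'.
by rewrite -lee_fin EFinD fineK//; exact: IH.
Qed.

(** The variation is at most 1 on intervals shorter than [d], and finitely many steps of length
    [d / 2] reach [x]. *)
Lemma abs_continuous_fin_TV f a b x : abs_continuous f a b -> a <= x -> x <= b ->
  TV a x f \is a fin_num.
Proof.
move=> acf; have [d d0 H] := abs_continuous_total_variation acf ltr01.
have small y z : a <= y -> y <= z -> z <= b -> z - y < d -> TV y z f \is a fin_num.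
  move=> ay yz zb zyd; rewrite ge0_fin_numE; last exact: total_variation_ge0.
  have := H [:: (y, z)] [::].
  rewrite /disjoint_subitvs/= /subitv/= ay yz zb /total_length !big_seq1 big_nil/= adde0.
  by move=> /(_ isT zyd) /le_lt_trans; apply; exact: ltry.
have K k : forall z, a <= z -> z <= b -> z <= a + k%:R * (d / 2) -> TV a z f \is a fin_num.
  elim: k => [|k IH] z az zb.
    rewrite mul0r addr0 => za; suff -> : z = a by rewrite total_variationxx.
    by apply/eqP; rewrite eq_le za az.
  rewrite -natr1 mulrDl mul1r => zk.
  have [zk'|zk'] := leP z (a + k%:R * (d / 2)); first exact: IH.
  have ak : a <= a + k%:R * (d / 2) by rewrite lerDl mulr_ge0// divr_ge0// ltW.
  rewrite (total_variationD f ak (ltW zk')) fin_numD.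
  rewrite (IH _ ak (le_trans (ltW zk') zb) (lexx _))/=.
  by apply: small => //; [exact: ltW|lra].
move=> ax xb; have [k /ltW xk] : exists k : nat, (x - a) / (d / 2) < k%:R.
  by exists (Num.bound ((x - a) / (d / 2))); apply: le_lt_trans (archi_boundP _); rewrite ?divr_ge0 ?subr_ge0// ltW.
by apply: (K k) => //; rewrite -lerBlDl -ler_pdivrMr// divr_gt0.
Qed.

(** Extends a function from the interval to the whole line by constants, as a Stieltjes measure
    requires; monotonicity and continuity survive because clamping is monotone and 1-Lipschitz. *)
Definition clamp a b x : R := Num.max a (Num.min x b).

Lemma clamp_itv a b x : a <= b -> a <= clamp a b x <= b.
Proof. by move=> ab; rewrite /clamp le_max lexx/= ge_max ab ge_min lexx orbT. Qed.

Lemma clamp_id a b x : a <= x -> x <= b -> clamp a b x = x.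
Proof. by move=> ax xb; rewrite /clamp min_l// max_r. Qed.

Lemma clamp_le a b x y : x <= y -> clamp a b x <= clamp a b y.
Proof. by move=> xy; rewrite /clamp le_max2// le_min2. Qed.

Lemma clamp_dist a b x y : x <= y -> clamp a b y - clamp a b x <= y - x.
Proof. by move=> xy; rewrite /clamp /Num.max /Num.min; do 4 case: ifPn; lra. Qed.

Lemma abs_continuous_clamp F a b : a <= b -> abs_continuous F a b ->
  continuous (F \o clamp a b).
Proof.
move=> ab acF x; apply/cvgrPdist_lt => e e0; have [d d0 H] := acF _ e0.
have K y z : y <= z -> z - y < d -> `|F (clamp a b z) - F (clamp a b y)| < e.
  move=> yz zyd; have := H [:: (clamp a b y, clamp a b z)].
  rewrite /disjoint_subitvs/= /subitv/= clamp_le//.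
  have /andP[-> _] := clamp_itv y ab; have /andP[_ ->] := clamp_itv z ab.
  rewrite /total_length !big_seq1/=; apply => //.
  by apply: le_lt_trans zyd; exact: clamp_dist.
near=> y => /=.
have xyd : `|x - y| < d by near: y; exact: cvgr_dist_lt.
have [xy|/ltW yx] := leP x y.
  by rewrite distrC K//; apply: le_lt_trans xyd; rewrite distrC ler_norm.
by rewrite K//; apply: le_lt_trans xyd; rewrite ler_norm.
Unshelve. all: by end_near. Qed.

End absolute_continuity.

(** * Exhaustion of open sets by dyadic cells *)

Section dyadic.
Context {R : realType}.
Variables (a b : R) (U : set R).
Local Notation mu := (@lebesgue_measure R).

Definition grid k j : R := a + (b - a) * (j%:R / 2 ^+ k).
(** Half-open cells are pairwise disjoint within a level, and each is exactly the union of two cells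
    of the next level. *)
Definition cell k j : set R := `]grid k j, grid k j.+1]%classic.
Definition inner_cells k : set R :=
  \big[setU/set0]_(j < 2 ^ k | `[< cell k j `<=` U >]) cell k j.

Hypothesis ab : a < b.

Lemma grid_le k i j : (i <= j)%N -> grid k i <= grid k j.
Proof.
move=> ij; rewrite lerD2l ler_wpM2l ?subr_ge0 ?(ltW ab)// ler_wpM2r ?ler_nat//.
Qed.

Lemma trivIset_cell k : trivIset [set: nat] (cell k).
Proof.
apply/trivIsetP => i j _ _; wlog ij : i j / (i < j)%N.
  move=> H ij; have [h|h|h] := ltngtP i j; first exact: H.
    by rewrite setIC; apply: H => //; rewrite eq_sym.
  by rewrite h eqxx in ij.
move=> _; rewrite -subset0 => x []; rewrite /cell/= !in_itv/= => /andP[_ h1] /andP[h2 _].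
by have := lt_le_trans h2 h1; rewrite ltNge grid_le.
Qed.

Lemma measurable_inner_cells k : measurable (inner_cells k).
Proof. by apply: bigsetU_measurable => j _; exact: measurable_itv. Qed.

Lemma inner_cells_sub k : inner_cells k `<=` U.
Proof.
move=> x; rewrite /inner_cells -bigcup_seq_cond => -[j /=].
by move=> /andP[_ /asboolP]; apply.
Qed.


Lemma cell_split k j x : cell k j x -> exists2 i, cell k.+1 i x &
  cell k.+1 i `<=` cell k j /\ (i < 2 * j.+1)%N.
Proof.
have E i : grid k i = grid k.+1 (2 * i).
  rewrite /grid exprS natrM -mulf_div divff ?mul1r// pnatr_eq0//.
rewrite /cell/= in_itv/= => /andP[x1 x2].
have [x3|x3] := leP x (grid k.+1 (2 * j).+1).
  exists (2 * j)%N; first by rewrite /= in_itv/= x3 andbT -E.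
  split; last by rewrite ltn_mul2l/= ltnS.
  rewrite !E; apply: subset_itvl; rewrite bnd_simp; apply: grid_le.
  by rewrite mulnS add2n.
exists (2 * j).+1; first by rewrite /= in_itv/= x3/= -add2n -mulnS -E.
split; last by rewrite mulnS add2n.
rewrite !E mulnS add2n; apply: subset_itvr; rewrite bnd_simp; exact: grid_le.
Qed.

Lemma nondecreasing_inner_cells : nondecreasing_seq inner_cells.
Proof.
apply/nondecreasing_seqP => k; apply/subsetPset => x.
rewrite /inner_cells -!bigcup_seq_cond => -[j /= /andP[_ /asboolP jU] jx].
have [i ix [ij i2]] := cell_split jx.
have i2' : (i < 2 ^ k.+1)%N.
  by apply: leq_trans i2 _; rewrite expnS leq_mul2l/= ltn_ord.
exists (Ordinal i2') => //=; rewrite mem_index_enum/=.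
by apply/asboolP; apply: subset_trans ij jU.
Qed.

Lemma bigcup_inner_cells : open U -> U `&` `]a, b]%classic `<=` \bigcup_k inner_cells k.
Proof.
move=> oU x [Ux]; rewrite /= in_itv/= => /andP[ax xb].
have ba0 : 0 < b - a by rewrite subr_gt0.
have /nbhs_ballP[e /= e0 eU] : nbhs x U by exact: open_nbhs_nbhs.
have [k kx] : exists k, (b - a) / 2 ^+ k < e.
  exists (Num.bound ((b - a) / e)).
  rewrite ltr_pdivrMr ?exprn_gt0// mulrC -ltr_pdivrMr//.
  apply: lt_le_trans (archi_boundP _) _; first by rewrite divr_ge0// ltW.
  by rewrite -natrX ler_nat ltnW// ltn_expl.
(* The cell containing [x] ends at the least grid point that is not below [x]. *)
pose P j := x <= grid k j.
have exP : exists j, P j.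
  by exists (2 ^ k)%N; rewrite /P /grid natrX divff ?expf_neq0// mulr1 addrC subrK.
have [[|j] jP jmin] := ex_minnP exP.
  by move: jP; rewrite /P /grid mul0r mulr0 addr0 leNgt ax.
have jx : grid k j < x.
  by rewrite ltNge; apply/negP => /jmin; rewrite ltnn.
have jk : (j < 2 ^ k)%N.
  apply: jmin; rewrite /P /grid natrX divff ?expf_neq0// mulr1.
  by rewrite addrC subrK.
exists k => //; rewrite /inner_cells -bigcup_seq_cond; exists (Ordinal jk) => /=.
  rewrite mem_index_enum/=; apply/asboolP => y; rewrite /cell/= in_itv/= => /andP[y1 y2].
  apply: eU; rewrite /ball/=.
  have : grid k j.+1 - grid k j < e.
    rewrite (_ : _ - _ = (b - a) / 2 ^+ k)//.
    by rewrite /grid -natr1; ring.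
  by move: jP; rewrite /P => jP kjj; rewrite ltr_norml; apply/andP; split; lra.
by rewrite /cell/= in_itv/= jx.
Qed.

End dyadic.

(** * Density of a monotone absolutely continuous function *)

Section abs_continuous_density.
Context {R : realType}.
Implicit Types (f F : R -> R) (a b : R).
Local Notation mu := (@lebesgue_measure R).

(** The Stieltjes measure of [F] is dominated by Lebesgue measure: a null set lies in an open set of
    measure below [d], this set is exhausted by finite families of dyadic cells, and absolute
    continuity bounds the total increment of [F] over each family by [e]. The density is the
    Radon-Nikodym derivative. *)
Lemma nondecreasing_abs_continuous_density F a b : a < b ->
  {in `[a, b] &, nondecreasing_fun F} -> abs_continuous F a b ->
  exists r : R -> R, mu.-integrable [set: R] (EFin \o r) /\
    forall t, a <= t -> t <= b ->
      (F t - F a)%:E = (\int[mu]_(s in `]a, t]) (r s)%:E)%E.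
Proof.
move=> ab ndF acF; pose G := F \o clamp a b.
have ndG : nondecreasing G.
  by move=> x y xy; apply: ndF; rewrite ?in_itv/= ?clamp_itv ?(ltW ab)//; exact: clamp_le.
have cG : continuous G by apply: abs_continuous_clamp => //; exact: ltW.
pose Gc : cumulative R R := HB.pack G (isCumulative.Build _ _ _ G ndG (right_continuousW cG)).
pose nu : {measure set (measurableTypeR R) -> \bar R} := lebesgue_stieltjes_measure Gc.
have nuE x y : x <= y -> nu `]x, y]%classic = (G y - G x)%:E.
  move=> xy; change (lebesgue_stieltjes_measure Gc `]x, y]%classic = (G y - G x)%:E).
  rewrite /lebesgue_stieltjes_measure /measure_extension.
  by rewrite measurable_mu_extE/=; [rewrite wlength_itv_bnd|exact: is_ocitv].
have mI : measurable (`]a, b]%classic : set (measurableTypeR R)) by exact: measurable_itv.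
have nuoo : (nu `]a, b]%classic < +oo)%E by rewrite nuE ?ltW// ltry.
pose nu' : {finite_measure set (measurableTypeR R) -> \bar R} := mfrestr mI nuoo.
have dom : nu' `<< mu.
  apply/null_content_dominatesP => N mN muN0.
  rewrite /nu' /= /mfrestr /mrestr.
  set N' := N `&` _.
  have mN' : measurable (N' : set (measurableTypeR R)) by exact: measurableI.
  apply/eqP; rewrite eq_le measure_ge0 andbT; apply/lee_addgt0Pr => e e0; rewrite add0e.
  have [d d0 H] := acF _ e0.
  have muN'0 : mu N' = 0%E.
    apply/eqP; rewrite eq_le measure_ge0 andbT -muN0; apply: le_measure; rewrite ?inE//.
    exact: subIsetl.
  have [U [oU NU Ud]] : exists U : set R, [/\ open U , N' `<=` U & (mu (U `\` N') < d%:E)%E].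
    apply: lebesgue_regularity_outer => //.
    by rewrite [X in (X < _)%E]muN'0 ltry.
  have mU : measurable (U : set (measurableTypeR R)) by exact: open_measurable.
  have {}Ud : (mu U < d%:E)%E.
    have h : (mu N' + mu (U `\` N') < d%:E)%E by rewrite [X in (X + _)%E]muN'0 add0e.
    rewrite -(setDUK NU); apply: le_lt_trans h; apply: measureU2 => //.
    exact: measurableD.
  have mC k : measurable (inner_cells a b U k : set (measurableTypeR R)).
    exact: measurable_inner_cells.
  apply: (@le_trans _ _ (nu (\bigcup_k inner_cells a b U k))).
    apply: le_measure; [by rewrite inE|by rewrite inE; exact: bigcupT_measurable|].
    apply: subset_trans (bigcup_inner_cells ab oU) => x N'x; split; first exact: NU.
    by case: N'x.
  have cv := nondecreasing_cvg_mu (mu := nu) mC (bigcupT_measurable _ mC)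
    (nondecreasing_inner_cells U ab).
  rewrite -(cvg_lim _ cv)//; apply: lime_le; first by apply/cvg_ex; eexists; exact: cv.
  apply: nearW => k /=; rewrite /inner_cells.
  have tI : trivIset setT (fun j : 'I_(2 ^ k) => cell a b k j).
    apply/trivIsetP => i j _ _ ij; have /trivIsetP := @trivIset_cell _ a b ab k.
    by apply.
  have mc j : measurable (cell a b k j : set (measurableTypeR R)) by exact: measurable_itv.
  have gle j : grid a b k j <= grid a b k j.+1 by exact: grid_le.
  rewrite measure_bigsetU_ord//.
  have nuc j : nu (cell a b k j) = (G (grid a b k j.+1) - G (grid a b k j))%:E.
    exact: nuE.
  rewrite (eq_bigr (fun j : 'I_(2 ^ k) => (G (grid a b k j.+1) - G (grid a b k j))%:E)); last by move=> j _; exact: nuc.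
  rewrite sumEFin lee_fin; apply/ltW.
  (* Listed by increasing index, the cells inside [U] form a family in the sense of
     [disjoint_subitvs], and its total length is at most the measure of [U]. *)
  pose s := [seq (grid a b k j, grid a b k j.+1) | j : 'I_(2 ^ k) <-
     [seq j : 'I_(2 ^ k) <- index_enum 'I_(2 ^ k) | `[< cell a b k j `<=` U >]]].
  have gab j : (j <= 2 ^ k)%N -> a <= grid a b k j /\ grid a b k j <= b.
    have g0 : grid a b k 0 = a by rewrite /grid mul0r mulr0 addr0.
    have g1 : grid a b k (2 ^ k) = b.
      by rewrite /grid natrX divff ?expf_neq0// mulr1 addrC subrK.
    by move=> jk; split; [rewrite -{1}g0|rewrite -{2}g1]; exact: grid_le.
  have sE (f : R -> R) : \sum_(j < 2 ^ k | `[< cell a b k j `<=` U >])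
      (f (grid a b k j.+1) - f (grid a b k j)) = \sum_(p <- s) (f p.2 - f p.1).
    by rewrite /s big_map big_filter.
  have ds : disjoint_subitvs a b s.
    apply/andP; split.
      apply/allP => p /mapP[j _ ->]; rewrite /subitv/= gle/=.
      by rewrite (gab _ (ltnW (ltn_ord j))).1 (gab _ (ltn_ord j)).2.
    rewrite /s pairwise_map; apply: pairwise_filter.
    have : pairwise (fun i j : 'I_(2 ^ k) => (i < j)%N) (index_enum 'I_(2 ^ k)).
      rewrite [index_enum _]unlock -enumT -(pairwise_map val ltn) val_enum_ord.
      by rewrite -sorted_pairwise; [exact: iota_ltn_sorted|exact: ltn_trans].
    apply: sub_pairwise => i j ij; rewrite /nonoverlap/=.
    by rewrite grid_le.
  rewrite (_ : \sum_(i < _ | _) _ = \sum_(p <- s) `|F p.2 - F p.1|).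
    apply: H => //; rewrite -lte_fin; apply: le_lt_trans Ud.
    rewrite /total_length -(sE id) -sumEFin.
    rewrite [leLHS](_ : _ = \sum_(j < 2 ^ k | `[< cell a b k j `<=` U >]) mu (cell a b k j))%E.
      rewrite -measure_bigsetU_ord//; apply: le_measure; rewrite ?inE//.
        exact: measurable_inner_cells.
      exact: inner_cells_sub.
    apply: eq_bigr => j _; rewrite lebesgue_measure_itv/= lte_fin.
    case: ltP => // h; rewrite (_ : grid a b k j.+1 - grid a b k j = 0)//.
    by apply/eqP; rewrite subr_eq0 eq_le h gle.
  rewrite sE; apply: eq_big_seq => p /mapP[j _ ->] /=.
  have [h1 h2] := gab _ (ltnW (ltn_ord j)); have [h3 h4] := gab _ (ltn_ord j).
  rewrite /G/= !clamp_id// ger0_norm// subr_ge0.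
  by apply: ndF => //; rewrite in_itv/= ?h1 ?h3.
have [r [r0 rfin rint rE]] := radon_nikodym_sigma_finite dom.
exists (fine \o r); split.
  by apply: eq_integrable rint => // x _ /=; rewrite fineK.
move=> t at_ tb; transitivity (nu' `]a, t]%classic).
  rewrite /nu' /= /mfrestr /mrestr setIidl.
    rewrite nuE//.
    by rewrite /G/= !clamp_id// ltW.
  by apply: subset_itvl; rewrite bnd_simp.
rewrite rE//; apply: eq_integral => x _; by rewrite /= fineK.
Qed.

End abs_continuous_density.

(** * The fundamental theorem of calculus for absolutely continuous functions *)

Section abs_continuous_ftc.
Context {R : realType}.
Implicit Types (f F : R -> R) (a b : R).
Local Notation mu := (@lebesgue_measure R).
Local Notation TV := total_variation.

(** Jordan decomposition: [f] is the difference of its variation function [V] and of [W = V - f],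
    both nondecreasing and absolutely continuous, hence with densities. That [f] is differentiable
    almost everywhere, with the density as derivative, is Lebesgue's differentiation theorem. *)
Lemma abs_continuous_ftc f a b : a < b -> abs_continuous f a b ->
  exists r : R -> R, [/\ mu.-integrable [set: R] (EFin \o r),
    forall t, a <= t -> t <= b ->
      (f t - f a)%:E = (\int[mu]_(s in `]a, t]) (r s)%:E)%E &
    {ae mu, forall s, a < s < b -> derivable f s 1 /\ derive1 f s = r s}].
Proof.
move=> ab acf.
pose V t := fine (TV a t f); pose W t := V t - f t.
have Vfin t : a <= t -> t <= b -> TV a t f \is a fin_num by exact: abs_continuous_fin_TV.
have VD s t : a <= s -> s <= t -> t <= b -> (V t - V s)%:E = TV s t f.
  move=> as_ st tb; have sb := le_trans st tb; have at_ := le_trans as_ st.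
  rewrite /V EFinB !fineK ?Vfin// (total_variationD f as_ st) [X in (X - _)%E]addeC addeK//.
  exact: Vfin.
have Vf s t : a <= s -> s <= t -> t <= b -> `|f t - f s| <= V t - V s.
  by move=> as_ st tb; rewrite -lee_fin VD//; exact: total_variation_ge.
have ndV : {in `[a, b] &, nondecreasing_fun V}.
  move=> s t; rewrite !in_itv/= => /andP[as_ sb] /andP[at_ tb] st.
  by rewrite -subr_ge0 (le_trans (normr_ge0 (f t - f s)))// Vf.
have ndW : {in `[a, b] &, nondecreasing_fun W}.
  move=> s t; rewrite !in_itv/= => /andP[as_ sb] /andP[at_ tb] st.
  have := Vf _ _ as_ st tb; rewrite ler_norml /W => /andP[_]; lra.
have acV : abs_continuous V a b.
  move=> e e0; have [d d0 H] := abs_continuous_total_variation acf (divr_gt0 e0 (@ltr0n R 2)).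
  exists d => // s ds ls; rewrite -lte_fin -sumEFin.
  have := H s [::]; rewrite !cats0 => /(_ ds ls); rewrite big_nil adde0.
  rewrite (_ : (\sum_(p <- s) TV p.1 p.2 f)%E = (\sum_(p <- s) (`|V p.2 - V p.1|)%:E)%E).
    by move=> /le_lt_trans; apply; rewrite lte_fin; lra.
  move: ds => /andP[/allP sS _]; apply: eq_big_seq => p /sS /and3P[h1 h2 h3].
  rewrite -VD// ger0_norm// subr_ge0; apply: ndV => //; rewrite in_itv/= ?h1 ?h3 ?andbT/=.
    exact: le_trans h2 h3.
  exact: le_trans h1 h2.
have acW : abs_continuous W a b.
  move=> e e0; have e20 : 0 < e / 2 by lra.
  have [d1 d10 H1] := acV _ e20; have [d2 d20 H2] := acf _ e20.
  exists (Num.min d1 d2); first by rewrite lt_min d10.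
  move=> s ds; rewrite lt_min => /andP[l1 l2].
  have {}H1 := H1 s ds l1; have {}H2 := H2 s ds l2.
  apply: (@le_lt_trans _ _ (\sum_(p <- s) `|V p.2 - V p.1| + \sum_(p <- s) `|f p.2 - f p.1|)); last by lra.
  rewrite -big_split/=; apply: ler_sum => p _.
  by rewrite /W (_ : _ - _ = (V p.2 - V p.1) - (f p.2 - f p.1)) ?ler_normB//; ring.
have [rV [iV EV]] := nondecreasing_abs_continuous_density ab ndV acV.
have [rW [iW EW]] := nondecreasing_abs_continuous_density ab ndW acW.
pose r := rV \- rW.
have ir : mu.-integrable [set: R] (EFin \o r) by exact: (integrableB measurableT iV iW).
have Er t : a <= t -> t <= b -> (f t - f a)%:E = (\int[mu]_(s in `]a, t]) (r s)%:E)%E.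
  move=> at_ tb.
  have -> : (f t - f a)%:E = ((V t - V a)%:E - (W t - W a)%:E)%E.
    by rewrite -EFinB /W; congr EFin; ring.
  rewrite EV// EW// -integralB//; first exact: integrableS iV.
  exact: integrableS iW.
exists r; split => //.
have lr : locally_integrable [set: R] r by apply: open_integrable_locally => //; exact: openT.
have iy y : mu.-integrable [set` Interval (BRight a) (BRight y)] (EFin \o r).
  by apply: integrableS ir.
have := @FTC1 R r (BRight a) iy lr.
apply: filterS; first exact: (ae_filter_ringOfSetsType mu).
move=> s /= H /andP[as_ sb].
have [] := H; first by rewrite /Order.lt/= as_.
set Fr := (X in derivable X s 1) => dF dFE.
have nE : {near s, Fr =1 (fun t => f t - f a)}.
  have : \forall t \near s, a < t < b by apply: (@near_in_itvoo R a b); rewrite in_itv/= as_.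
  apply: filterS => t /andP[at_ tb].
  by rewrite /Fr /Rintegral -Er// ltW.
have nE' : {near s, Fr + cst (f a) =1 f}.
  by apply: filterS nE => t Et; rewrite -[LHS]/(Fr t + f a) Et subrK.
have dca := derivable_cst (f a) s (1 : R).
split; first exact: (near_eq_derivable nE' (derivableD dF dca)).
by rewrite derive1E -(near_eq_derive _ nE') (deriveD dF dca) derive_cst addr0 -derive1E.
Qed.

End abs_continuous_ftc.

(** * Integrals along a curve bounded below by its displacement *)

Section action_lower_bound.
Context {R : realType} {n : nat}.
Local Notation mu := (@lebesgue_measure R).
Implicit Types (g : R -> 'rV[R]_n).

Lemma abs_continuous_coord g a b i : abs_cont_on g a b ->
  abs_continuous (fun s => g s 0 i) a b.
Proof.
move=> acg e e0; have [d [d0 H]] := acg _ e0; exists d => // s /andP[sS sp] sd.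
pose p k := nth (0, 0) s k.
have := H (size s) (fun k => (p k).1) (fun k => (p k).2).
rewrite /total_length (big_nth (0, 0)) big_mkord in sd.
move=> /(_ _ _ sd) K; rewrite (big_nth (0, 0)) big_mkord; apply: le_lt_trans (K _ _).
- apply: ler_sum => k _; have := ler_coord_norm (g (p k).2 - g (p k).1) i.
  by rewrite !mxE.
- by move=> k; have /and3P[] := allP sS _ (mem_nth (0, 0) (ltn_ord k)).
- have W (k l : 'I_(size s)) : (k < l)%N -> nonoverlap (p k) (p l).
    by move=> kl; apply: (pairwiseP (0, 0) sp) => //; exact: ltn_ord.
  move=> k l; rewrite -(inj_eq val_inj) neq_ltn => /orP[/W/orP//|/W/orP[]]; by [right|left].
Qed.

(** [derive1 g] agrees with an integrable density only outside a null set, and [F] need not be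
    measurable, so [F] cannot simply be altered on that set. The null set is split off by additivity
    instead, and the bound [- C] makes its contribution nonnegative. *)
Lemma action_lower_bound g a b (F : R -> R) (q : 'rV[R]_n) (C M : R) : a < b ->
  abs_cont_on g a b -> (forall s, a <= s <= b -> - C <= F s) ->
  (forall s, a <= s <= b -> dotv q (derive1 g s) - M <= F s) ->
  ((dotv q (g b - g a) - M * (b - a))%:E <= \int[mu]_(s in `[a, b]) (F s)%:E)%E.
Proof.
move=> ab acg FC FM.
have /choice[r rP] i := abs_continuous_ftc ab (@abs_continuous_coord g a b i acg).
pose r0 s := \sum_i q 0 i * r i s - M.
have ri : mu.-integrable [set: R] (fun s => \sum_i (q 0 i)%:E * (r i s)%:E)%E.
  by apply: integrable_sum => // i _; apply: integrableZl => //; case: (rP i).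
have rab : mu.-integrable `]a, b] (fun s => \sum_i (q 0 i)%:E * (r i s)%:E)%E.
  exact: integrableS ri.
have iM : mu.-integrable `]a, b] (fun=> M%:E).
  apply/integrableP; split => //; rewrite integral_cst//= lebesgue_measure_itv/= lte_fin ab.
  by rewrite -EFinB -EFinM ltry.
have r0E s : (r0 s)%:E = (\sum_i (q 0 i)%:E * (r i s)%:E - M%:E)%E.
  by rewrite /r0 EFinB sumEFin.
have ir0 : mu.-integrable `]a, b] (EFin \o r0).
  apply: eq_integrable (integrableB _ rab iM) => // s _ /=.
  by rewrite -r0E.
have Ir0 : (\int[mu]_(s in `]a, b]) (r0 s)%:E)%E = (dotv q (g b - g a) - M * (b - a))%:E.
  under eq_integral => s _ do rewrite r0E.
  rewrite integralB// integral_cst//= lebesgue_measure_itv/= lte_fin ab -EFinB -EFinM EFinB.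
  congr (_ - _)%E; rewrite integral_sum//; last first.
    move=> i; apply: integrableZl => //.
    by case: (rP i) => + _ _; exact: integrableS.
  rewrite -sumEFin; apply: eq_bigr => i _; rewrite integralZl//; last first.
    by case: (rP i) => + _ _; exact: integrableS.
  by rewrite EFinM !mxE; case: (rP i) => _ <- //; exact: ltW.
have : {ae mu, forall s, a < s < b -> dotv q (derive1 g s) = \sum_i q 0 i * r i s}.
  have : {ae mu, forall s, forall i, a < s < b ->
      derivable (fun t => g t 0 i) s 1 /\ derive1 (fun t => g t 0 i) s = r i s}.
    have FF : Filter (almost_everywhere mu) by exact: (ae_filter_ringOfSetsType mu).
    by apply: filter_forall => i; case: (rP i).
  apply: filterS; first exact: (ae_filter_ringOfSetsType mu).
  move=> s H sab; apply: eq_bigr => i _; congr (_ * _).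
  have dg : derivable g s 1.
    by apply/derivable_mxP => k l; rewrite ord1; case: (H l sab).
  by rewrite derive1E (derive_mx dg) mxE -derive1E; case: (H i sab).
move=> [N [mN N0 NS]].
(* The endpoints join the null set because differentiability is known on the open interval only. *)
pose N' := N `|` [set a] `|` [set b].
have mN' : measurable N' by apply: measurableU => //; exact: measurableU.
have muN' : mu N' = 0%E.
  apply/eqP; rewrite eq_le measure_ge0 andbT.
  apply: le_trans (measureU2 _ _ _) _ => //; first exact: measurableU.
  rewrite [X in (_ + X)%E]lebesgue_measure_set1 adde0.
  apply: le_trans (measureU2 _ _ _) _ => //.
  by rewrite [X in (_ + X)%E]lebesgue_measure_set1 adde0; move/eqP: N0; rewrite eq_le => /andP[].
pose I : set R := `]a, b]%classic.
have -> : `[a, b]%classic = (I `\` N') `|` (`[a, b]%classic `&` N').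
  apply/seteqP; split => s; rewrite /I/= !in_itv/=.
    move=> /andP[as_ sb]; have [N's|N's] := pselect (N' s); first by right; rewrite as_ sb.
    left; split => //; rewrite sb andbT lt_neqAle as_ andbT; apply/eqP => sa; apply: N's.
    by left; right.
  by move=> [[/andP[/ltW-> ->]]|[->]].
have mI : measurable I by exact: measurable_itv.
have mIN : measurable (I `\` N') by exact: measurableD.
have mJN : measurable (`[a, b]%classic `&` N') by apply: measurableI => //; exact: measurable_itv.
have sub s : (I `\` N' `|` `[a, b]%classic `&` N') s -> a <= s <= b.
  by move=> [[]|[]]; rewrite /I/= in_itv/= => /andP[h1 h2] _; rewrite ?h1 ?(ltW h1).
have muJN : mu (`[a, b]%classic `&` N') = 0%E.
  apply/eqP; rewrite eq_le measure_ge0 andbT -muN'; apply: le_measure; [by rewrite inE|by rewrite inE|exact: subIsetr].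
rewrite (@integral_setU_nomeas _ _ _ mu _ _ F C)//.
- rewrite -Ir0 (negligible_integral mN' mI ir0 muN') -[leLHS]adde0; apply: leeD.
    apply: le_integral_nomeas => s [Is N's].
    move: Is; rewrite /I/= in_itv/= => /andP[as_ sb].
    rewrite lee_fin; apply: le_trans (FM s _); last by rewrite (ltW as_).
    rewrite /r0 lerB//; have sNb : s < b.
      by rewrite lt_neqAle sb andbT; apply/eqP => sb'; apply: N's; right.
    have nN : ~ N s by move=> Ns; apply: N's; left; left.
    have : ~ (~` [set s | a < s < b -> dotv q (derive1 g s) = \sum_(i < n) q 0 i * r i s]) s.
      by move=> /NS.
    by move=> /contrapT /= ->//; rewrite as_ sNb.
  apply: (@le_trans _ _ (\int[mu]_(s in `[a, b]%classic `&` N') (- C)%:E)%E).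
    by rewrite integral_cst// [X in (_ * X)%E]muJN mule0.
  by apply: le_integral_nomeas => s Hs; rewrite lee_fin; apply: FC; apply: sub; right.
- apply: (@le_lt_trans _ _ (mu I)); first by apply: le_measure; [by rewrite inE|by rewrite inE|exact: subDsetl].
  by rewrite /I lebesgue_measure_itv/= lte_fin ab -EFinB ltry.
- by rewrite [X in (X < _)%E]muJN ltry.
- by apply/disj_setPS => s [[_ ?] [_ ?]].
- by move=> s Hs; apply: FC; apply: sub.
Qed.

End action_lower_bound.

(** * Differentiability *)

Section frechet.
Context {R : realType} {m : nat}.
Implicit Types (f : 'rV[R]_m -> R) (x z w p : 'rV[R]_m).

Lemma dotv_is_linear p : linear (dotv p).
Proof. by move=> a x y; rewrite dotvDr dotvZr. Qed.
HB.instance Definition _ p := @GRing.isLinear.Build R 'rV[R]_m R *%R (dotv p) (dotv_is_linear p).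

Lemma dotv_continuous p : continuous (dotv p).
Proof.
move=> x; apply/continuous_atP => e e0.
have C0 : 0 < m%:R * `|p| + 1 by rewrite ltr_wpDl// mulr_ge0.
exists (e / (m%:R * `|p| + 1)) => [|y]; first by rewrite divr_gt0.
rewrite ltr_pdivlMr// => xy; rewrite -dotvBr; apply: le_lt_trans (normr_dotv _ _) _.
apply: le_lt_trans xy; rewrite mulrC ler_wpM2l// lerDl//.
Qed.

(** Differentiability with the gradient as a vector, in a form that quadratic remainders satisfy at
    once ([frechet_of_quadratic]). *)
Definition frechet f x p := forall e, 0 < e -> exists2 d, 0 < d &
  forall z, `|z| <= d -> `|f (x + z) - f x - dotv p z| <= e * `|z|.

Lemma frechet_diff f x p : frechet f x p ->
  differentiable f x /\ 'd f x = dotv p :> ('rV[R]_m -> R).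
Proof.
move=> fp; pose f' : 'rV[R]_m -> R^o := f.
pose P : {linear 'rV[R]_m -> R^o} := dotv p.
have E e : 0 < e -> \forall z \near (0 : 'rV[R]_m), `|f' (z + x) - (f' x + dotv p z)| <= e * `|z|.
  move=> e0; have [d d0 H] := fp e e0.
  apply/nbhs_normP; exists d => // z; rewrite /ball_/= sub0r normrN => /ltW/H.
  by rewrite /f' [z + x]addrC opprD addrA.
have cP : continuous P by exact: dotv_continuous.
have D : 'd f' x = P :> ('rV[R]_m -> R^o).
  by apply: diff_unique => //; apply/eqaddoP => e /E.
by split=> //; apply/diff_locallyP; rewrite D; split => //; apply/eqaddoP => e /E.
Qed.

Lemma frechet_derive f x p z : frechet f x p -> derivable f x z /\ 'D_z f x = dotv p z.
Proof.
move=> /frechet_diff[df E]; split; first exact: diff_derivable.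
by rewrite deriveE// E.
Qed.

Lemma frechet_grad f x p : frechet f x p -> grad f x = p.
Proof.
move=> fp; apply/rowP => i; rewrite mxE /pder.
by have [_ ->] := frechet_derive (evec i) fp; rewrite dotv_evec.
Qed.

Lemma frechet_comp f (g : R -> 'rV[R]_m) s p : frechet f (g s) p -> derivable g s 1 ->
  is_derive s 1 (f \o g) (dotv p (derive1 g s)).
Proof.
move=> /frechet_diff[df E] dg.
have dgs : differentiable g s by exact/derivable1_diffP.
have dfg : differentiable (f \o g) s by exact: differentiable_comp.
apply: DeriveDef; first exact: diff_derivable.
by rewrite (deriveE _ dfg) (diff_comp dgs df) /= E -(deriveE _ dgs) derive1E.
Qed.

Lemma derive_line f w v s : derivable f (w + s *: v) v ->
  is_derive s 1 (fun t => f (w + t *: v)) ('D_v f (w + s *: v)).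
Proof.
move=> df.
have E : (fun h => h^-1 *: (f (w + (h *: 1 + s) *: v) - f (w + s *: v))) =
         (fun h => h^-1 *: (f (h *: v + (w + s *: v)) - f (w + s *: v))).
  apply/funext => h; congr (_ *: (f _ - _)).
  by rewrite [_ *: 1]mulr1 scalerDl addrCA.
by apply: DeriveDef; rewrite /derivable /derive E.
Qed.

Lemma coord_mvt f w i t : (forall x, derivable f x (evec i)) ->
  exists2 r, `|r| <= `|t| & f (w + t *: evec i) - f w = t * pder f i (w + r *: evec i).
Proof.
move=> df.
have pos w' t' : 0 < t' -> exists2 r, 0 <= r <= t' &
    f (w' + t' *: evec i) - f w' = t' * pder f i (w' + r *: evec i).
  move=> t0; have D s := derive_line (df (w' + s *: evec i)).
  have [|c] := @MVT R (fun s => f (w' + s *: evec i))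
      (fun s => 'D_(evec i) f (w' + s *: evec i)) 0 t' t0 (fun s _ => D s).
    apply: derivable_within_continuous => s _; exact: ex_derive.
  rewrite in_itv/= => /andP[/ltW c0 /ltW ct]; rewrite scale0r addr0 subr0 mulrC => ->.
  by exists c => //; rewrite c0.
have [t0|t0|<-] := ltgtP 0 t.
- have [r /andP[r0 rt] ->] := pos w t t0.
  by exists r => //; rewrite !ger0_norm// ltW.
- have nt0 : 0 < - t by rewrite oppr_gt0.
  have [r /andP[r0 rt] E] := pos (w + t *: evec i) (- t) nt0.
  exists (t + r); first by rewrite (ler0_norm (ltW t0)) ler0_norm; lra.
  rewrite scalerDl addrA; move: E; rewrite scaleNr addrK => E.
  by apply: oppr_inj; rewrite opprB E mulNr.
- by exists 0 => //; rewrite scale0r addr0 subrr mul0r.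
Qed.

(** The corners of the path from 0 to [z] that changes one coordinate at a time. *)
Definition prefix_rV z k : 'rV[R]_m := \row_i (if (i < k)%N then z 0 i else 0).

Lemma prefix_rVS z (k : 'I_m) : prefix_rV z k.+1 = prefix_rV z k + z 0 k *: evec k.
Proof.
apply/rowP => j; rewrite !mxE ltnS leq_eqVlt.
have [->|jk] := eqVneq j k; first by rewrite eqxx ltnn/= mulr1 add0r.
by rewrite (_ : (j == k :> nat) = false) ?(negbTE jk)//= ?mulr0 ?addr0//; exact: negbTE jk.
Qed.

(** The increment of [f] telescopes along the coordinate path. The mean value theorem on each edge
    and continuity of the partial derivatives at [x] leave [m] errors, each at most [e / (m + 1)]
    times [|z|]. *)
Lemma C1_frechet f x : C1 f -> frechet f x (grad f x).
Proof.
move=> [_ [df cdf]] e e0.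
have e'0 : 0 < e / (m%:R + 1) by rewrite divr_gt0// ltr_wpDl.
have : \forall y \near x, forall i, `|pder f i x - pder f i y| < e / (m%:R + 1).
  apply: (filter_forall (f := fun i y => `|pder f i x - pder f i y| < e / (m%:R + 1)) (nbhs_filter x)) => i.
  have /continuous_atP/(_ _ e'0)[d d0 H] := cdf i x.
  by apply: filterS (near_norm x d0) => y /H.
move=> /nbhs_normP[d d0 H]; exists (d / 2); first by rewrite divr_gt0.
move=> z zd.
have pz k : prefix_rV z k = \row_i (if (i < k)%N then z 0 i else 0) by [].
have E : f (x + z) - f x = \sum_(k < m) (f (x + prefix_rV z k.+1) - f (x + prefix_rV z k)).
  rewrite -(big_mkord xpredT (fun k => f (x + prefix_rV z k.+1) - f (x + prefix_rV z k))).
  rewrite telescope_sumr//; congr (f _ - f _).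
    by congr (_ + _); apply/rowP => i; rewrite mxE ltn_ord.
  by rewrite -[LHS]addr0; congr (_ + _); apply/rowP => i; rewrite !mxE.
rewrite E /dotv -sumrB.
apply: le_trans (ler_norm_sum _ _ _) _.
apply: (@le_trans _ _ (\sum_(k < m) e / (m%:R + 1) * `|z|)).
  apply: ler_sum => k _; rewrite prefix_rVS addrA.
  have [r rz ->] := coord_mvt (x + prefix_rV z k) (z 0 k) (df k).
  rewrite mxE mulrC -mulrBl normrM ler_pM//; last exact: ler_coord_norm.
  rewrite distrC ltW//; apply: H.
  rewrite /ball_/= -addrA opprD addrA subrr add0r normrN.
  apply: (@le_lt_trans _ _ (d / 2)); last by rewrite ltr_pdivrMr// ltr_pMr// ltr1n.
  apply: rV_norm_le => [|i]; first by rewrite divr_ge0// ltW.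
  apply: le_trans zd.
  rewrite !mxE; have [ik|ik] := ltnP i k.
    rewrite (_ : (i == k) = false) ?mulr0 ?addr0 ?ler_coord_norm//.
    by apply/negbTE; rewrite -(inj_eq val_inj) neq_ltn ik.
  rewrite add0r normrM; apply: le_trans (le_trans rz (ler_coord_norm _ _)).
  by rewrite ler_piMr//; case: (_ && _); rewrite ?normr1 ?normr0.
rewrite sumr_const card_ord -mulrnAl ler_wpM2r// -mulr_natr -mulrA ger_pMr//.
by rewrite mulrC ler_pdivrMr ?ltr_wpDl// mul1r lerDl.
Qed.

Lemma frechet_mvt f (p : 'rV[R]_m -> 'rV[R]_m) x y : (forall z, frechet f z (p z)) ->
  exists2 t, 0 <= t <= 1 & f y - f x = dotv (p (x + t *: (y - x))) (y - x).
Proof.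
move=> fp; have D s := (@derive_line f x (y - x) s (frechet_derive (y - x) (fp (x + s *: (y - x)))).1).
have [|c] := @MVT R (fun s => f (x + s *: (y - x))) _ 0 1 ltr01 (fun s _ => D s).
  apply: derivable_within_continuous => s _; exact: ex_derive.
rewrite in_itv/= => /andP[/ltW c0 /ltW c1].
rewrite scale0r scale1r addr0 subr0 mulr1 [x + (y - x)]addrC subrK => ->.
exists c; first by rewrite c0.
by have [_ ->] := frechet_derive (y - x) (fp (x + c *: (y - x))).
Qed.

Lemma C1_mvt f x y : C1 f -> exists2 t, 0 <= t <= 1 &
  f y - f x = dotv (grad f (x + t *: (y - x))) (y - x).
Proof. by move=> cf; apply: frechet_mvt => z; exact: C1_frechet. Qed.

Lemma frechetD f g x p q : frechet f x p -> frechet g x q ->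
  frechet (fun y => f y + g y) x (p + q).
Proof.
move=> fp gq e e0; have e2 : 0 < e / 2 by rewrite divr_gt0.
have [d d0 P] := fp _ e2; have [d' d'0 Q] := gq _ e2.
exists (Num.min d d'); first by rewrite lt_min d0.
move=> z; rewrite le_min => /andP[/P h1 /Q h2].
rewrite (_ : _ - _ = (f (x + z) - f x - dotv p z) + (g (x + z) - g x - dotv q z)).
  apply: le_trans (ler_normD _ _) _; apply: le_trans (lerD h1 h2) _.
  by rewrite -mulrDl -splitr.
by rewrite dotvDl; ring.
Qed.

Lemma frechetZ f x p a : frechet f x p -> frechet (fun y => a * f y) x (a *: p).
Proof.
move=> fp e e0; have a0 : 0 < `|a| + 1 by rewrite ltr_wpDl.
have [d d0 P] := fp _ (divr_gt0 e0 a0); exists d => // z /P h.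
rewrite dotvZl -!mulrBr normrM; apply: le_trans (ler_wpM2l (normr_ge0 a) h) _.
rewrite mulrA; apply: ler_wpM2r => //; rewrite mulrCA ger_pMr//.
by rewrite ler_pdivrMr// mul1r lerDl.
Qed.

Lemma frechet_sum (I : Type) (s : seq I) (f : I -> 'rV[R]_m -> R) x (p : I -> 'rV[R]_m) :
  (forall i, frechet (f i) x (p i)) ->
  frechet (fun y => \sum_(i <- s) f i y) x (\sum_(i <- s) p i).
Proof.
move=> fp; elim: s => [|i s IH].
  move=> e e0; exists 1 => // z _.
  by rewrite !big_nil dotv0l !subr0 normr0 mulr_ge0// ltW.
rewrite big_cons (_ : (fun y => _) = (fun y => f i y + \sum_(j <- s) f j y)).
  exact: frechetD.
by apply/funext => y; rewrite big_cons.
Qed.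

Lemma continuous_sum (I : Type) (s : seq I) (f : I -> 'rV[R]_m -> R) :
  (forall i, continuous (f i)) -> continuous (fun y => \sum_(i <- s) f i y).
Proof.
move=> cf; elim: s => [|i s IH].
  rewrite (_ : (fun y => _) = cst 0); first by move=> x; exact: cst_continuous.
  by apply/funext => y; rewrite big_nil.
rewrite (_ : (fun y => _) = (fun y => f i y + \sum_(j <- s) f j y)).
  by move=> x; apply: continuousD; [exact: cf|exact: IH].
by apply/funext => y; rewrite big_cons.
Qed.

End frechet.

(** * Compactness modulo integer translations *)

Section periodic_strip.
Context {R : realType} {n : nat}.
Implicit Types (G : 'rV[R]_(n + n) -> R) (z w : 'rV[R]_(n + n)) (x p : 'rV[R]_n).

Lemma norm_lsubmx z : `|lsubmx z| <= `|z|.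
Proof. by apply: rV_norm_le => // i; rewrite mxE ler_coord_norm. Qed.

Lemma norm_rsubmx z : `|rsubmx z| <= `|z|.
Proof. by apply: rV_norm_le => // i; rewrite mxE ler_coord_norm. Qed.

Lemma norm_row_mx k l (x : 'rV[R]_l) (y : 'rV[R]_k) r : `|x| <= r -> `|y| <= r -> `|row_mx x y| <= r.
Proof.
move=> xr yr; apply: rV_norm_le => [|i]; first exact: le_trans xr.
rewrite mxE; case: splitP => j _; first exact: le_trans (ler_coord_norm _ _) xr.
exact: le_trans (ler_coord_norm _ _) yr.
Qed.

Lemma norm_row_mxD x p : `|row_mx x p| <= `|x| + `|p|.
Proof. by apply: norm_row_mx; rewrite ?lerDl ?lerDr. Qed.

Definition x_periodic G := forall z (k : 'rV[int]_n), G (z + row_mx (intv k) 0) = G z.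

Lemma x_periodic_pder G i : x_periodic G -> x_periodic (pder G i).
Proof.
move=> pG z k; rewrite /pder /derive.
suff -> : (fun t => t^-1 *: ((G \o shift (z + row_mx (intv k) 0)) (t *: evec i) -
    G (z + row_mx (intv k) 0))) =
  (fun t => t^-1 *: ((G \o shift z) (t *: evec i) - G z)) by [].
by apply/funext => t /=; rewrite addrA !pG.
Qed.

Lemma rV_mod_Zn x : exists k : 'rV[int]_n, `|x + intv k| <= 1.
Proof.
exists (\row_i - Num.floor (x 0 i)); apply: (@rV_norm_le R n) => // i; rewrite !mxE mulrNz.
have /andP[h1 h2] := floor_itv (x 0 i).
rewrite intrD in h2; rewrite ger0_norm; lra.
Qed.

Lemma rV_compact_ball k r : compact [set z : 'rV[R]_k | `|z| <= r].
Proof.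
apply: bounded_closed_compact.
  exists r; split; first exact: num_real.
  by move=> s rs z /= zr; apply: le_trans zr (ltW rs).
apply: (@preimage_closed _ _ (fun z : 'rV[R]_k => `|z|) [set t | t <= r]).
  by move=> z _; exact: norm_continuous.
exact: closed_le.
Qed.

Lemma rV_bounded_on_ball k (G : 'rV[R]_k -> R) r : continuous G ->
  exists2 B, 0 <= B & forall z : 'rV[R]_k, `|z| <= r -> `|G z| <= B.
Proof.
move=> cG; have [r0|r0] := ltP r 0.
  by exists 0 => // z zr; have := le_lt_trans zr r0; rewrite ltNge normr_ge0.
have [||c _ cP] := @EVT_max_rV R k (fun z : 'rV[R]_k => `|G z|) [set z : 'rV[R]_k | `|z| <= r] _ (@rV_compact_ball k r).
- by exists 0; rewrite /= normr0.
- apply: continuous_subspaceT => z; apply: continuous_comp; first exact: cG.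
  exact: norm_continuous.
by exists `|G c| => // z zr; apply: cP; rewrite inE.
Qed.

(** The strip is not compact, but an integer translation in the first variable brings each of its
    points into a fixed ball. *)
Lemma strip_bounded G r : continuous G -> x_periodic G ->
  exists2 B, 0 <= B & forall z, `|rsubmx z| <= r -> `|G z| <= B.
Proof.
move=> cG pG; have [B B0 BP] := rV_bounded_on_ball (Num.max 1 r) cG.
exists B => // z zr; have [k xk] := rV_mod_Zn (lsubmx z).
rewrite -(pG z k); apply: BP; rewrite -{1}[z]hsubmxK add_row_mx addr0.
by apply: norm_row_mx; rewrite le_max ?xk ?zr ?orbT.
Qed.

Lemma finite_strip_bounded (I : finType) (G : I -> 'rV[R]_(n + n) -> R) r :
  (forall i, continuous (G i)) -> (forall i, x_periodic (G i)) ->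
  exists2 B, 0 <= B & forall i z, `|rsubmx z| <= r -> `|G i z| <= B.
Proof.
move=> cG pG.
have /choice[B BP] i : exists B, 0 <= B /\ forall z, `|rsubmx z| <= r -> `|G i z| <= B.
  by have [B ? ?] := strip_bounded r (cG i) (pG i); exists B.
exists (\sum_i B i); first by apply: sumr_ge0 => i _; case: (BP i).
move=> i z zr; apply: le_trans ((BP i).2 z zr) _.
rewrite (bigD1 i)//= lerDl; apply: sumr_ge0 => j _; by case: (BP j).
Qed.

Lemma strip_lipschitz G r : C1 G -> x_periodic G ->
  exists2 C, 0 <= C & forall z w, `|rsubmx z| <= r -> `|rsubmx w| <= r ->
    `|G z - G w| <= C * `|z - w|.
Proof.
move=> cG pG; have [_ [_ cdG]] := cG.
have [B B0 BP] := finite_strip_bounded r cdG (fun i => @x_periodic_pder G i pG).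
exists ((n + n)%:R * B); first by rewrite mulr_ge0.
move=> z w zr wr; have [t /andP[t0 t1] ->] := C1_mvt w z cG.
apply: le_trans (normr_dotv _ _) _; rewrite ler_wpM2r// ler_wpM2l//.
apply: rV_norm_le => // i; rewrite mxE; apply: BP.
have -> : w + t *: (z - w) = t *: z + (1 - t) *: w.
  by rewrite scalerBr scalerBl scale1r addrCA addrA.
rewrite linearD linearZ linearZ/=; apply: le_trans (ler_normD _ _) _.
rewrite !normrZ (ger0_norm t0) ger0_norm ?subr_ge0//.
have h1 := ler_wpM2l t0 zr; have h2 : (1 - t) * `|rsubmx w| <= (1 - t) * r by rewrite ler_wpM2l// subr_ge0.
by apply: le_trans (lerD h1 h2) _; rewrite -mulrDl addrC subrK mul1r.
Qed.

End periodic_strip.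

(** * The Hamiltonian and its Legendre transform *)

Section hamiltonian.
Context {R : realType} {n : nat}.
Variable H : 'rV[R]_n -> 'rV[R]_n -> R.
Hypothesis HT : Tonelli_Hamiltonian H.
Implicit Types (x y p q xi d : 'rV[R]_n) (z : 'rV[R]_(n + n)).

Local Notation F := (Hjoint H).

Definition Hx x p : 'rV[R]_n := grad (fun y => H y p) x.

Let C2F : C2 F. Proof. by case: HT. Qed.
Let C1F : C1 F. Proof. by case: C2F. Qed.

Lemma HjointE x p : F (row_mx x p) = H x p.
Proof. by rewrite /Hjoint row_mxKl row_mxKr. Qed.

Lemma x_periodic_Hjoint : x_periodic F.
Proof.
move=> z k; have [_ pH _ _] := HT.
rewrite /Hjoint linearD/= row_mxKl [rsubmx (_ + _)]linearD/= row_mxKr addr0.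
exact: pH.
Qed.

Lemma dotv_row_mx x p y q : dotv (row_mx x p) (row_mx y q) = dotv x y + dotv p q.
Proof.
rewrite /dotv big_split_ord/=; congr (_ + _); apply: eq_bigr => i _.
  by rewrite !row_mxEl.
by rewrite !row_mxEr.
Qed.

Lemma norm_row_mx0 p : `|row_mx (0 : 'rV[R]_n) p| = `|p|.
Proof.
apply/eqP; rewrite eq_le norm_row_mx ?normr0//=.
by have := norm_rsubmx (row_mx 0 p); rewrite row_mxKr.
Qed.

Lemma norm_row_mxx0 x : `|row_mx x (0 : 'rV[R]_n)| = `|x|.
Proof.
apply/eqP; rewrite eq_le norm_row_mx ?normr0//=.
by have := norm_lsubmx (row_mx x 0); rewrite row_mxKl.
Qed.

Lemma frechet_H_p x p : frechet (H x) p (rsubmx (grad F (row_mx x p))).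
Proof.
move=> e e0; have [d d0 P] := C1_frechet (row_mx x p) C1F e0.
exists d => // z zd; have := P (row_mx 0 z).
rewrite norm_row_mx0 => /(_ zd); rewrite add_row_mx addr0 !HjointE.
by rewrite -{1}[grad F _]hsubmxK dotv_row_mx dotv0r add0r.
Qed.

Lemma frechet_H_x x p : frechet (fun y => H y p) x (lsubmx (grad F (row_mx x p))).
Proof.
move=> e e0; have [d d0 P] := C1_frechet (row_mx x p) C1F e0.
exists d => // z zd; have := P (row_mx z 0).
rewrite norm_row_mxx0 => /(_ zd); rewrite add_row_mx addr0 !HjointE.
by rewrite -{1}[grad F _]hsubmxK dotv_row_mx dotv0r addr0.
Qed.

Lemma HpE x p : Hp H x p = rsubmx (grad F (row_mx x p)).
Proof. exact: frechet_grad (frechet_H_p x p). Qed.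

Lemma HxE x p : Hx x p = lsubmx (grad F (row_mx x p)).
Proof. exact: frechet_grad (frechet_H_x x p). Qed.

(** Modulo periodicity the strip [|p| <= r] is compact, so a single constant bounds [H], [Hp], [Hx]
    and their Lipschitz constants. The Lipschitz bounds for [Hp] and [Hx] are where second
    derivatives of [H] enter. *)
Lemma H_bounds r : exists2 C, 0 <= C & forall x y p q, `|p| <= r -> `|q| <= r ->
  [/\ `|H x p - H y q| <= C * (`|x - y| + `|p - q|),
      `|Hp H x p - Hp H y q| <= C * (`|x - y| + `|p - q|),
      `|Hx x p - Hx y q| <= C * (`|x - y| + `|p - q|) &
      [/\ `|H x p| <= C, `|Hp H x p| <= C & `|Hx x p| <= C]].
Proof.
have [cF [_ cdF]] := C1F; have pF := x_periodic_Hjoint.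
have pdF i : x_periodic (pder F i) by exact: x_periodic_pder.
have [C0 C00 B0] := strip_lipschitz r C1F pF.
have /choice[C1' B1] i : exists C, 0 <= C /\ forall z w, `|rsubmx z| <= r -> `|rsubmx w| <= r ->
    `|pder F i z - pder F i w| <= C * `|z - w|.
  by have [C ? ?] := strip_lipschitz r (C2F.2 i) (pdF i); exists C.
have [D0 D00 E0] := strip_bounded r cF pF.
have [D1 D10 E1] := finite_strip_bounded r cdF pdF.
have S0 : 0 <= \sum_i C1' i by apply: sumr_ge0 => i _; case: (B1 i).
pose C := C0 + \sum_i C1' i + D0 + D1.
have C_0 : 0 <= C by rewrite !addr_ge0.
have hC0 : C0 <= C by rewrite /C -!addrA lerDl !addr_ge0.
have hC1 i : C1' i <= C.
  apply: (@le_trans _ _ (\sum_i C1' i)).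
    by rewrite (bigD1 i)//= lerDl; apply: sumr_ge0 => j _; case: (B1 j).
  by rewrite /C -!addrA addrCA lerDl !addr_ge0.
have hD0 : D0 <= C by rewrite /C addrAC lerDr !addr_ge0.
have hD1 : D1 <= C by rewrite /C lerDr !addr_ge0.
exists C => // x y p q pr qr.
have dxy : `|row_mx x p - row_mx y q| <= `|x - y| + `|p - q|.
  by rewrite opp_row_mx add_row_mx norm_row_mxD.
have dC K : K <= C -> 0 <= K -> K * `|row_mx x p - row_mx y q| <= C * (`|x - y| + `|p - q|).
  by move=> KC K0; apply: ler_pM.
have zr : `|rsubmx (row_mx x p)| <= r by rewrite row_mxKr.
have wr : `|rsubmx (row_mx y q)| <= r by rewrite row_mxKr.
have G : `|grad F (row_mx x p) - grad F (row_mx y q)| <= C * (`|x - y| + `|p - q|).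
  apply: rV_norm_le => [|i]; first by rewrite mulr_ge0// addr_ge0.
  rewrite !mxE; apply: le_trans ((B1 i).2 _ _ zr wr) _; apply: dC => //.
  by case: (B1 i).
have G1 : `|grad F (row_mx x p)| <= C.
  by apply: rV_norm_le => // i; rewrite mxE; apply: le_trans (E1 i _ zr) hD1.
split.
- by rewrite -!HjointE; apply: le_trans (B0 _ _ zr wr) _; exact: dC.
- by rewrite !HpE -linearB/=; apply: le_trans (norm_rsubmx _) G.
- by rewrite !HxE -linearB/=; apply: le_trans (norm_lsubmx _) G.
- split.
  + by rewrite -HjointE; apply: le_trans (E0 _ zr) hD0.
  + by rewrite HpE; apply: le_trans (norm_rsubmx _) G1.
  + by rewrite HxE; apply: le_trans (norm_lsubmx _) G1.
Qed.

Lemma H_mvt_x x y p : exists2 t, 0 <= t <= 1 &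
  H y p - H x p = dotv (Hx (x + t *: (y - x)) p) (y - x).
Proof.
have [t t01] := C1_mvt (row_mx x p) (row_mx y p) C1F.
rewrite !HjointE opp_row_mx add_row_mx subrr scale_row_mx scaler0 add_row_mx addr0 => E.
by exists t => //; rewrite HxE E -{1}[grad F _]hsubmxK dotv_row_mx dotv0r addr0.
Qed.

Lemma H_mvt_p x p q : exists2 t, 0 <= t <= 1 &
  H x q - H x p = dotv (Hp H x (p + t *: (q - p))) (q - p).
Proof.
have [t t01] := C1_mvt (row_mx x p) (row_mx x q) C1F.
rewrite !HjointE opp_row_mx add_row_mx subrr scale_row_mx scaler0 add_row_mx addr0 => E.
by exists t => //; rewrite HpE E -{1}[grad F _]hsubmxK dotv_row_mx dotv0r add0r.
Qed.

(** The quadratic form of [Hpp], expressed through the joint function so that it is visibly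
    continuous in base point, momentum and direction together. *)
Definition Hpp_form z d : R :=
  \sum_i \sum_j d 0 i * d 0 j * pder (pder F (rshift n i)) (rshift n j) z.

Lemma derive_rshift (G : 'rV[R]_(n + n) -> R) x p j :
  pder (fun q => G (row_mx x q)) j p = pder G (rshift n j) (row_mx x p).
Proof.
rewrite /pder /derive.
suff -> : (fun t => t^-1 *: (((fun q => G (row_mx x q)) \o shift p) (t *: evec j) - G (row_mx x p))) =
  (fun t => t^-1 *: ((G \o shift (row_mx x p)) (t *: evec (rshift n j)) - G (row_mx x p))) by [].
apply/funext => t /=; congr (_ *: (G _ - _)).
have -> : evec (rshift n j) = row_mx 0 (evec j) :> 'rV[R]_(n + n).
  exact: delta_mx_rshift.
by rewrite scale_row_mx scaler0 add_row_mx add0r.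
Qed.

Lemma HppE x p i j :
  Hpp H x p i j = pder (pder F (rshift n i)) (rshift n j) (row_mx x p).
Proof.
rewrite mxE -derive_rshift.
suff -> : pder (H x) i = (fun q => pder F (rshift n i) (row_mx x q)) by [].
apply/funext => q; rewrite -derive_rshift.
suff -> : H x = (fun q => F (row_mx x q)) by [].
by apply/funext => q'; rewrite HjointE.
Qed.

Lemma Hpp_formE x p d : Hpp_form (row_mx x p) d = (d *m Hpp H x p *m d^T) 0 0.
Proof.
rewrite /Hpp_form mxE exchange_big/=; apply: eq_bigr => j _; rewrite mxE mulr_suml.
by apply: eq_bigr => i _; rewrite -HppE [X in _ = _ * X]mxE mulrAC.
Qed.

Lemma Hpp_formZ z d r : Hpp_form z (r *: d) = r ^+ 2 * Hpp_form z d.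
Proof.
rewrite /Hpp_form mulr_sumr; apply: eq_bigr => i _; rewrite mulr_sumr.
by apply: eq_bigr => j _; rewrite !mxE; ring.
Qed.

Lemma Hpp_form_x_periodic d : x_periodic (fun z => Hpp_form z d).
Proof.
move=> z k; apply: eq_bigr => i _; apply: eq_bigr => j _.
have P := @x_periodic_pder _ _ _ (rshift n j) (@x_periodic_pder _ _ _ (rshift n i) x_periodic_Hjoint).
by rewrite P.
Qed.

Lemma continuous_Hpp_form :
  continuous (fun y : 'rV[R]_(n + n + n) => Hpp_form (lsubmx y) (rsubmx y)).
Proof.
have cl : continuous (fun y : 'rV[R]_(n + n + n) => lsubmx y).
  move=> y; apply/continuous_atP => e e0; exists e => // y' yy'.
  rewrite -linearB/=; apply: le_lt_trans yy'.
  by apply: rV_norm_le => // i; rewrite mxE ler_coord_norm.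
have cr i : continuous (fun y : 'rV[R]_(n + n + n) => rsubmx y 0 i).
  move=> y; apply/continuous_atP => e e0; exists e => // y' yy'.
  apply: le_lt_trans yy'; have := ler_coord_norm (y - y') (rshift _ i).
  by rewrite !mxE.
apply: continuous_sum => i; apply: continuous_sum => j y.
apply: (@continuousM R _ (fun y : 'rV[R]_(n + n + n) => rsubmx y 0 i * rsubmx y 0 j)).
  by apply: (@continuousM R _ (fun y : 'rV[R]_(n + n + n) => rsubmx y 0 i)); exact: cr.
apply: (@continuous_comp _ _ _ (fun y : 'rV[R]_(n + n + n) => lsubmx y)); first exact: cl.
exact: ((C2F.2 (rshift n i)).2.2 (rshift n j)).
Qed.

(** The form is positive on the compact set of unit directions over base points reduced by
    periodicity; its minimum there is [k], and homogeneity in [d] extends the bound to all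
    directions. *)
Lemma Hpp_form_lower r : exists2 k, 0 < k & forall z d, `|rsubmx z| <= r ->
  k * `|d| ^+ 2 <= Hpp_form z d.
Proof.
pose A := [set y : 'rV[R]_(n + n + n) |
  [/\ `|y| <= Num.max 1 r, `|rsubmx (lsubmx y)| <= r & `|rsubmx y| = 1]].
have norm1 d : d != 0 -> `| `|d|^-1 *: d | = 1.
  by move=> d0; rewrite normrZ normfV normr_id mulVf// normr_eq0.
have inA z d : `|rsubmx z| <= r -> d != 0 -> exists z', A (row_mx z' (`|d|^-1 *: d)) /\
    forall e, Hpp_form z' e = Hpp_form z e.
  move=> zr d0; have [k xk] := rV_mod_Zn (lsubmx z).
  exists (z + row_mx (intv k) 0); split; last by move=> e; rewrite Hpp_form_x_periodic.
  have E : z + row_mx (intv k) 0 = row_mx (lsubmx z + intv k) (rsubmx z).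
    by rewrite -{1}[z]hsubmxK add_row_mx addr0.
  rewrite /A/= E !row_mxKl !row_mxKr; split => //; last exact: norm1.
  apply: norm_row_mx; last by rewrite norm1// le_max lexx.
  by apply: norm_row_mx; rewrite le_max ?xk ?zr ?orbT.
have cA : compact A.
  apply: bounded_closed_compact.
    exists (Num.max 1 r); split; first exact: num_real.
    by move=> s rs y [yr _ _]; apply: le_trans yr (ltW rs).
  have cN k (f : 'rV[R]_(n + n + n) -> 'rV[R]_k) : (forall y y' : 'rV[R]_(n + n + n), f (y - y') = f y - f y') ->
      (forall y : 'rV[R]_(n + n + n), `|f y| <= `|y|) -> continuous (fun y : 'rV[R]_(n + n + n) => `|f y|).
    move=> fB fN y; apply/continuous_atP => e e0; exists e => // y' yy'.
    apply: le_lt_trans (le_lt_trans (fN (y - y')) yy').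
    by rewrite fB; exact: ler_dist_dist.
  rewrite (_ : A = (fun y : 'rV[R]_(n + n + n) => `|y|) @^-1` [set t | t <= Num.max 1 r] `&`
     (fun y : 'rV[R]_(n + n + n) => `|rsubmx (lsubmx y)|) @^-1` [set t | t <= r] `&`
     (fun y : 'rV[R]_(n + n + n) => `|rsubmx y|) @^-1` [set 1]); last first.
    by apply/seteqP; split => y; rewrite /A/=; [move=> [? ? ?]|move=> [[? ?] ?]].
  have nr (y : 'rV[R]_(n + n + n)) : `|rsubmx y| <= `|y|.
    by apply: rV_norm_le => // i; rewrite mxE ler_coord_norm.
  have nl (y : 'rV[R]_(n + n + n)) : `|lsubmx y| <= `|y|.
    by apply: rV_norm_le => // i; rewrite mxE ler_coord_norm.
  apply: closedI; first apply: closedI.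
  - apply: preimage_closed; last exact: closed_le.
    by move=> y _; apply: (@cN _ id).
  - apply: preimage_closed; last exact: closed_le.
    move=> y _; apply: (@cN _ (fun y : 'rV[R]_(n + n + n) => rsubmx (lsubmx y))) => [y1 y2|y1].
      by rewrite !linearB.
    exact: le_trans (norm_rsubmx _) (nl _).
  - apply: preimage_closed; last exact: closed_eq.
    by move=> y _; apply: (@cN _ (fun y : 'rV[R]_(n + n + n) => rsubmx y)) => [y1 y2|y1]; rewrite ?linearB.
(* If [A] is empty, [inA] leaves only the direction 0 over the strip, and any constant will do. *)
have [A0|A0] := pselect (A !=set0); last first.
  exists 1 => // z d zr; have [->|d0] := eqVneq d 0.
    by rewrite normr0 expr0n mulr0 -(scale0r (0 : 'rV[R]_n)) Hpp_formZ expr0n mul0r.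
  by have [z' [Az _]] := inA z d zr d0; exfalso; apply: A0; exists (row_mx z' (`|d|^-1 *: d)).
have [y0 Ay0 Hy0] := EVT_min_rV A0 cA (continuous_subspaceT continuous_Hpp_form).
exists (Hpp_form (lsubmx y0) (rsubmx y0)).
  move: Ay0; rewrite inE => -[_ _ n1]; rewrite -[lsubmx y0]hsubmxK Hpp_formE.
  have [_ _ pd _] := HT; apply: pd; apply/eqP => E.
  by move: n1; rewrite E normr0 => /eqP; rewrite eq_sym oner_eq0.
move=> z d zr; have [->|d0] := eqVneq d 0.
  by rewrite normr0 expr0n mulr0 -(scale0r (0 : 'rV[R]_n)) Hpp_formZ expr0n mul0r.
have [z' [Az' Ez']] := inA z d zr d0.
have := Hy0 (row_mx z' (`|d|^-1 *: d)); rewrite inE => /(_ Az').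
rewrite row_mxKl row_mxKr Ez' Hpp_formZ exprVn ler_pdivlMl ?exprn_gt0 ?normr_gt0//.
by rewrite mulrC.
Qed.

(** The mean value theorem for the component of [Hp] along [q - p], between [(x, p)] and [(x, q)],
    produces [Hpp_form] at an intermediate momentum. *)
Lemma Hp_monotone r : exists2 k, 0 < k & forall x p q, `|p| <= r -> `|q| <= r ->
  k * `|q - p| ^+ 2 <= dotv (Hp H x q - Hp H x p) (q - p).
Proof.
have [k k0 kP] := Hpp_form_lower r; exists k => // x p q pr qr.
pose d := q - p.
pose G (z : 'rV[R]_(n + n)) := \sum_i d 0 i * pder F (rshift n i) z.
have fG z : frechet G z (\sum_i d 0 i *: grad (pder F (rshift n i)) z).
  by apply: frechet_sum => i; apply: frechetZ; apply: C1_frechet; exact: (C2F.2 _).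
have [t /andP[t0 t1]] := frechet_mvt (row_mx x p) (row_mx x q) fG.
have Ed : row_mx x q - row_mx x p = row_mx 0 d by rewrite opp_row_mx add_row_mx subrr.
rewrite Ed => E.
have GE p' : G (row_mx x p') = dotv (Hp H x p') d.
  by rewrite dotvC HpE; apply: eq_bigr => i _; rewrite !mxE.
rewrite dotvBl -!GE E.
set z := row_mx x p + _.
have -> : dotv (\sum_i d 0 i *: grad (pder F (rshift n i)) z) (row_mx 0 d) = Hpp_form z d.
  rewrite /dotv big_split_ord/= big1 ?add0r => [|i _]; last by rewrite row_mxEl mxE mulr0.
  rewrite /Hpp_form exchange_big/=; apply: eq_bigr => j _.
  rewrite row_mxEr summxE mulr_suml; apply: eq_bigr => i _; rewrite !mxE; ring.
apply: kP; rewrite /z scale_row_mx scaler0 add_row_mx addr0 row_mxKr.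
have -> : p + t *: d = t *: q + (1 - t) *: p.
  by rewrite /d scalerBr scalerBl scale1r addrCA addrA.
apply: le_trans (ler_normD _ _) _.
rewrite !normrZ (ger0_norm t0) ger0_norm ?subr_ge0//.
have h1 := ler_wpM2l t0 qr; have h2 : (1 - t) * `|p| <= (1 - t) * r by rewrite ler_wpM2l// subr_ge0.
by apply: le_trans (lerD h1 h2) _; rewrite -mulrDl addrC subrK mul1r.
Qed.

Lemma H_convex x p q : H x p + dotv (Hp H x p) (q - p) <= H x q.
Proof.
have [t /andP[t0 t1] E] := H_mvt_p x p q.
rewrite -lerBrDl E -subr_ge0 -dotvBl.
have [->|tn0] := eqVneq t 0; first by rewrite scale0r addr0 subrr dotv0l.
have {}t0 : 0 < t by rewrite lt_neqAle eq_sym tn0.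
have [k k0 kP] := Hp_monotone (Num.max `|p| `|p + t *: (q - p)|).
have := kP x p (p + t *: (q - p)); rewrite !le_max !lexx orbT => /(_ isT isT).
rewrite addrAC subrr add0r dotvZr => h.
rewrite -(pmulr_rge0 _ t0); apply: le_trans h.
by rewrite mulr_ge0 ?sqr_ge0// ltW.
Qed.

End hamiltonian.

(** * The Legendre transform and the regularity of the Lagrangian *)

Section legendre.
Context {R : realType} {n : nat}.
Variable H : 'rV[R]_n -> 'rV[R]_n -> R.
Hypothesis HT : Tonelli_Hamiltonian H.
Implicit Types (x y p q xi eta d : 'rV[R]_n).

Lemma norm_le_eps p C : 0 <= C -> (forall e, 0 < e -> `|p| <= C * e) -> p = 0.
Proof.
move=> C0 P; apply/eqP; rewrite -normr_le0; apply/ler_addgt0Pr => e e0; rewrite add0r.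
have C1 : 0 < C + 1 by rewrite ltr_wpDl.
apply: le_trans (P _ (divr_gt0 e0 C1)) _; rewrite mulrCA ger_pMr// ler_pdivrMr//.
by rewrite mul1r lerDl.
Qed.

Lemma frechet_max (f : 'rV[R]_n -> R) x p : frechet f x p ->
  (forall y, f y <= f x) -> p = 0.
Proof.
move=> fp fm; apply: (@norm_le_eps _ 1) => // e e0; rewrite mul1r.
have [d d0 P] := fp e e0; apply: (rV_norm_le_dotv d0) => z zd.
have := P z zd; rewrite ler_norml => /andP[h _].
have h1 := fm (x + z); have h2 := ler_wpM2l (ltW e0) zd; lra.
Qed.

Lemma frechet_dotv xi x : frechet (dotv xi) x xi.
Proof.
move=> e e0; exists 1 => // z _.
have -> : dotv xi (x + z) - dotv xi x - dotv xi z = 0 by rewrite dotvDr; ring.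
by rewrite normr0 mulr_ge0// ltW.
Qed.

Lemma superlinear_lower M : 0 <= M ->
  exists2 K, 0 <= K & forall x p, K < `|p| -> M * `|p| <= H x p.
Proof.
move=> M0; have [_ _ _ sl] := HT; have [K KP] := sl M.
exists (Num.max 0 K); first by rewrite le_max lexx.
move=> x p; rewrite gt_max => /andP[p0 /(KP x)].
by rewrite ler_pdivlMr.
Qed.

(** By superlinearity [dotv xi p - H x p] attains its maximum, where its gradient vanishes. The
    slope [n * |xi| + 1] is dictated by the bound of [dotv] in terms of sup norms. *)
Lemma Hp_surjective x xi : exists p, Hp H x p = xi.
Proof.
have [K K0 KP] := @superlinear_lower (n%:R * `|xi| + 1) (addr_ge0 (mulr_ge0 (ler0n _ _) (normr_ge0 _)) ler01).
pose f p := dotv xi p + -1 * H x p.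
have ff p : frechet f p (xi + -1 *: Hp H x p).
  apply: frechetD; first exact: frechet_dotv.
  by apply: frechetZ; rewrite HpE//; exact: frechet_H_p.
have cf : continuous f.
  by move=> p; apply: differentiable_continuous; have [] := frechet_diff (ff p).
pose r := K + `|H x 0| + 1.
have r0 : 0 <= r by rewrite !addr_ge0.
have A0 : [set p : 'rV[R]_n | `|p| <= r] !=set0 by exists 0; rewrite /= normr0.
have [q qr qP] := EVT_max_rV A0 (@rV_compact_ball R n r) (continuous_subspaceT cf).
have qmax p : f p <= f q.
  have [pr|pr] := leP `|p| r; first by apply: qP; rewrite inE.
  apply: (@le_trans _ _ (f 0)); last by apply: qP; rewrite inE/= normr0.
  have Kp : K < `|p| by apply: le_lt_trans pr; rewrite /r -addrA lerDl addr_ge0.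
  have h1 := KP x p Kp; have h2 := dotv_le xi p; have h3 := ler_norm (H x 0).
  rewrite /f dotv0r; move: pr; rewrite /r; lra.
exists q; have /eqP := frechet_max (ff q) qmax.
by rewrite scaleN1r subr_eq0 => /eqP.
Qed.

(** By convexity [H x p] exceeds [H x 0] by at most [dotv (Hp H x p) p], hence by at most
    [n * r * |p|]; superlinearity with slope [n * r + 1] then leaves [|p| <= H x 0] beyond the
    threshold [K]. *)
Lemma Hp_proper r : exists2 r', 0 <= r' & forall x p, `|Hp H x p| <= r -> `|p| <= r'.
Proof.
have [r0|r0] := ltP r 0.
  by exists 0 => // x p pr; have := le_lt_trans pr r0; rewrite ltNge normr_ge0.
have [K K0 KP] := @superlinear_lower (n%:R * r + 1) (addr_ge0 (mulr_ge0 (ler0n _ _) r0) ler01).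
have [C C0 CP] := H_bounds HT 0.
exists (Num.max K C); first by rewrite le_max K0.
move=> x p pr; rewrite le_max; have [//|Kp] := leP `|p| K; rewrite /=.
have := CP x x 0 0; rewrite normr0 lexx => /(_ isT isT)[_ _ _ [h0 _ _]].
have h1 := KP x p Kp; have := H_convex HT x p 0; rewrite sub0r dotvNr => h2.
have h3 := dotv_le (Hp H x p) p; have h4 := ler_norm (H x 0).
have h5 : n%:R * `|Hp H x p| * `|p| <= n%:R * r * `|p|.
  by rewrite ler_wpM2r// ler_wpM2l.
lra.
Qed.

(* The inverse of [Hp H x]; it is the gradient of the Lagrangian, see [LxiE]. *)
Definition leg x xi : 'rV[R]_n := xget 0 [set p | Hp H x p = xi].

Lemma Hp_leg x xi : Hp H x (leg x xi) = xi.
Proof. by have [p pE] := Hp_surjective x xi; exact: (@xgetPex _ 0 [set p | Hp H x p = xi] (ex_intro _ p pE)). Qed.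

Lemma Lag_max x p q : dotv (Hp H x p) q - H x q <= dotv (Hp H x p) p - H x p.
Proof. have := H_convex HT x p q; rewrite dotvBr; lra. Qed.

Lemma LagE x p : Lag H x (Hp H x p) = dotv (Hp H x p) p - H x p.
Proof.
apply/eqP; rewrite eq_le; apply/andP; split.
  apply: ge_sup; first by exists (dotv (Hp H x p) 0 - H x 0); exists 0.
  by move=> _ [q _ <-]; exact: Lag_max.
apply: ub_le_sup; last by exists p.
by exists (dotv (Hp H x p) p - H x p) => _ [q _ <-]; exact: Lag_max.
Qed.

Lemma Lag_leg x xi : Lag H x xi = dotv xi (leg x xi) - H x (leg x xi).
Proof. by rewrite -{1}(Hp_leg x xi) LagE Hp_leg. Qed.

Lemma Lag_ge x xi p : dotv xi p - H x p <= Lag H x xi.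
Proof. by rewrite Lag_leg; have := Lag_max x (leg x xi) p; rewrite Hp_leg. Qed.

Lemma leg_bounded r : exists2 r', 0 <= r' & forall x xi, `|xi| <= r -> `|leg x xi| <= r'.
Proof.
have [r' r'0 P] := Hp_proper r; exists r' => // x xi xir.
by apply: (P x); rewrite Hp_leg.
Qed.

(** Strong monotonicity controls [p - q] by the variation of [Hp] at a fixed base point, and the
    Lipschitz bound in [x] pays for moving that point. It amounts to Lipschitz continuity of the
    inverse [leg]. *)
Lemma Hp_coercive r : exists2 C, 0 <= C & forall x y p q, `|p| <= r -> `|q| <= r ->
  `|p - q| <= C * (`|x - y| + `|Hp H x p - Hp H y q|).
Proof.
have [k k0 kP] := Hp_monotone HT r; have [D D0 DP] := H_bounds HT r.
exists (n%:R * (D + 1) / k); first by rewrite divr_ge0 ?mulr_ge0 ?addr_ge0// ltW.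
move=> x y p q pr qr.
have [->|pq] := eqVneq p q; first by rewrite subrr normr0 mulr_ge0 ?addr_ge0// divr_ge0 ?mulr_ge0 ?addr_ge0// ltW.
have pq0 : 0 < `|p - q| by rewrite normr_gt0 subr_eq0.
have h1 := kP x q p qr pr; have h2 := dotv_le (Hp H x p - Hp H x q) (p - q).
have [_ h3 _ _] := DP x y q q qr qr; rewrite subrr normr0 addr0 in h3.
have h4 : `|Hp H x p - Hp H x q| <= `|Hp H x p - Hp H y q| + D * `|x - y|.
  rewrite -(subrKA (Hp H y q)); apply: le_trans (ler_normD _ _) _; rewrite lerD2l.
  by rewrite distrC.
have h5 : k * `|p - q| <= n%:R * `|Hp H x p - Hp H x q|.
  by rewrite -(ler_pM2r pq0) -mulrA -expr2; exact: le_trans h1 h2.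
rewrite mulrAC ler_pdivlMr// mulrC; apply: le_trans h5 _.
rewrite -mulrA ler_wpM2l//; apply: le_trans h4 _.
rewrite mulrDr addrC; apply: lerD; first by rewrite ler_wpM2r// lerDl.
by rewrite ler_peMl// lerDr.
Qed.

Lemma leg_Hp x p : leg x (Hp H x p) = p.
Proof.
have [C _ P] := Hp_coercive (Num.max `|p| `|leg x (Hp H x p)|).
have := P x x (leg x (Hp H x p)) p; rewrite !le_max !lexx orbT => /(_ isT isT).
by rewrite Hp_leg !subrr !normr0 addr0 mulr0 normr_le0 subr_eq0 => /eqP.
Qed.

Lemma leg_lipschitz r : exists2 C, 0 <= C & forall x y xi eta, `|xi| <= r -> `|eta| <= r ->
  `|leg x xi - leg y eta| <= C * (`|x - y| + `|xi - eta|).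
Proof.
have [r' _ rP] := leg_bounded r; have [C C0 P] := Hp_coercive r'.
exists C => // x y xi eta xr er; have := P x y _ _ (rP x xi xr) (rP y eta er).
by rewrite !Hp_leg.
Qed.

Lemma Lag_xi_lower x xi eta : dotv (leg x xi) (eta - xi) <= Lag H x eta - Lag H x xi.
Proof.
have := Lag_ge x eta (leg x xi); rewrite (Lag_leg x xi) dotvBr !(dotvC (leg _ _)); lra.
Qed.

(** The subgradient inequality at [eta] bounds the increment by the pairing with [leg x eta];
    replacing this vector by [leg x xi] costs a square because [leg] is Lipschitz. *)
Lemma Lag_xi_upper r : exists2 C, 0 <= C & forall x xi eta, `|xi| <= r -> `|eta| <= r ->
  Lag H x eta - Lag H x xi <= dotv (leg x xi) (eta - xi) + C * `|eta - xi| ^+ 2.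
Proof.
have [C C0 P] := leg_lipschitz r; exists (n%:R * C); first by rewrite mulr_ge0.
move=> x xi eta xr er; have h1 := Lag_xi_lower x eta xi.
have := P x x eta xi er xr; rewrite subrr normr0 add0r => h2.
have h3 := dotv_le (leg x eta - leg x xi) (eta - xi).
have h4 : n%:R * `|leg x eta - leg x xi| * `|eta - xi| <= n%:R * C * `|eta - xi| ^+ 2.
  by rewrite expr2 [leRHS]mulrA ler_wpM2r// -mulrA ler_wpM2l.
move: h1 h3; rewrite dotvBl !dotvBr; lra.
Qed.

(** Envelope argument: the maximizing momentum at either base point is a competitor at the other, so
    the increment of [Lag] lies between two increments of [- H] at fixed momenta, and these momenta
    differ by a multiple of [|y - x|]. *)
Lemma Lag_x_expansion r : exists2 C, 0 <= C & forall x y xi, `|xi| <= r ->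
  `|Lag H y xi - Lag H x xi + dotv (Hx H x (leg x xi)) (y - x)| <= C * `|y - x| ^+ 2.
Proof.
have [r' _ rP] := leg_bounded r; have [C C0 CP] := leg_lipschitz r.
have [D D0 DP] := H_bounds HT r'.
exists (n%:R * (D * (1 + C))); first by rewrite !mulr_ge0// addr_ge0.
move=> x y xi xr; set d := y - x.
have bnd p : `|p| <= r' -> `|p - leg x xi| <= C * `|d| ->
    `|H x p - H y p + dotv (Hx H x (leg x xi)) d| <= n%:R * (D * (1 + C)) * `|d| ^+ 2.
  move=> pr pd; have [t /andP[t0 t1] E] := H_mvt_x HT x y p.
  rewrite -opprB E addrC -dotvBl; apply: le_trans (normr_dotv _ _) _.
  rewrite expr2 [leRHS]mulrA ler_wpM2r// -!mulrA ler_wpM2l//.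
  have [_ _ + _] := DP x (x + t *: (y - x)) (leg x xi) p (rP _ _ xr) pr.
  move=> /le_trans; apply; rewrite ler_wpM2l// mulrDl mul1r; apply: lerD.
    by rewrite opprD addrA subrr add0r normrN normrZ (ger0_norm t0) ler_piMl.
  by rewrite distrC.
have h1 := Lag_ge y xi (leg x xi); have h2 := Lag_ge x xi (leg y xi).
have := CP x x xi xi xr xr => _.
have := bnd (leg x xi) (rP _ _ xr); rewrite subrr normr0 mulr_ge0// => /(_ isT).
rewrite !ler_norml => /andP[b1 _].
have := bnd (leg y xi) (rP _ _ xr).
have := CP y x xi xi xr xr; rewrite subrr normr0 addr0 => -> /(_ isT).
rewrite ler_norml => /andP[_ b2].
move: h1 h2 b1 b2 (Lag_leg x xi) (Lag_leg y xi).
move: (Lag H y xi) (Lag H x xi) (H x (leg x xi)) (H y (leg x xi)) (H x (leg y xi)) (H y (leg y xi))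
  (dotv xi (leg x xi)) (dotv xi (leg y xi)) (dotv _ d) (_ * `|d| ^+ 2).
by clear=> *; apply/andP; split; lra.
Qed.

Lemma Lag_x_lipschitz r : exists2 C, 0 <= C & forall x y xi, `|xi| <= r ->
  `|Lag H y xi - Lag H x xi| <= C * `|y - x|.
Proof.
have [r' _ rP] := leg_bounded r; have [D D0 DP] := H_bounds HT r'.
exists D => // x y xi xr.
have h1 := Lag_ge y xi (leg x xi); have h2 := Lag_ge x xi (leg y xi).
have [b1 _ _ _] := DP x y (leg x xi) _ (rP x xi xr) (rP x xi xr).
have [b2 _ _ _] := DP x y (leg y xi) _ (rP y xi xr) (rP y xi xr).
move: b1 b2; rewrite !subrr !normr0 !addr0 !ler_norml !(distrC x y) => /andP[b1 b2] /andP[b3 b4].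
move: h1 h2 b1 b2 b3 b4 (Lag_leg x xi) (Lag_leg y xi).
move: (Lag H y xi) (Lag H x xi) (H x (leg x xi)) (H y (leg x xi)) (H x (leg y xi)) (H y (leg y xi))
  (dotv xi (leg x xi)) (dotv xi (leg y xi)) (D * _).
by clear=> *; apply/andP; split; lra.
Qed.

Lemma frechet_of_quadratic (f : 'rV[R]_n -> R) x p (C d : R) : 0 <= C -> 0 < d ->
  (forall z, `|z| <= d -> `|f (x + z) - f x - dotv p z| <= C * `|z| ^+ 2) -> frechet f x p.
Proof.
move=> C0 d0 P e e0; have C1 : 0 < C + 1 by rewrite ltr_wpDl.
exists (Num.min d (e / (C + 1))); first by rewrite lt_min d0 divr_gt0.
move=> z; rewrite le_min ler_pdivlMr// => /andP[/P h ze]; apply: le_trans h _.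
rewrite expr2 mulrA ler_wpM2r//; apply: le_trans ze; rewrite mulrC ler_wpM2l//.
by rewrite lerDl.
Qed.

Lemma LxiE x xi : Lxi H x xi = leg x xi.
Proof.
apply: frechet_grad; have [C C0 P] := Lag_xi_upper (`|xi| + 1).
apply: (frechet_of_quadratic C0 ltr01) => z z1.
have h1 := Lag_xi_lower x xi (xi + z); have := P x xi (xi + z).
rewrite lerDl ler01 (le_trans (ler_normD _ _) (lerD (lexx _) z1)) => /(_ isT isT).
have -> : xi + z - xi = z by rewrite addrAC subrr add0r.
move: h1; have -> : xi + z - xi = z by rewrite addrAC subrr add0r.
move=> h1 h2; rewrite ler_norml; apply/andP; split; last by lra.
by have := mulr_ge0 C0 (sqr_ge0 `|z|); lra.
Qed.

Lemma LxE x xi : Lx H x xi = - Hx H x (leg x xi).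
Proof.
apply: frechet_grad; have [C C0 P] := Lag_x_expansion `|xi|.
apply: (frechet_of_quadratic C0 ltr01) => z _.
have := P x (x + z) xi (lexx _).
have -> : x + z - x = z by rewrite addrAC subrr add0r.
by rewrite dotvNl opprK.
Qed.

End legendre.

(** * Calibrated curves *)

Section curves.
Context {R : realType} {n : nat}.
Local Notation mu := (@lebesgue_measure R).
Implicit Types (x p q xi d : 'rV[R]_n) (g : R -> 'rV[R]_n).

Lemma lipschitz_abs_cont_on g (C lo hi : R) : 0 <= C ->
  (forall a b, lo <= a -> a <= b -> b <= hi -> `|g b - g a| <= C * (b - a)) ->
  abs_cont_on g lo hi.
Proof.
move=> C0 gC e e0; have C1 : 0 < C + 1 by rewrite ltr_wpDl.
exists (e / (C + 1)); split; first by rewrite divr_gt0.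
move=> k a b ab _; rewrite ltr_pdivlMr// => h.
apply: (@le_lt_trans _ _ (C * \sum_(i < k) (b i - a i))).
  rewrite mulr_sumr; apply: ler_sum => i _; have [? [? ?]] := ab i; exact: gC.
apply: le_lt_trans h; rewrite mulrC ler_wpM2l ?lerDl//.
by apply: sumr_ge0 => i _; have [_ [? _]] := ab i; rewrite subr_ge0.
Qed.

Lemma abs_cont_onS g a b a' b' : a <= a' -> b' <= b -> abs_cont_on g a b -> abs_cont_on g a' b'.
Proof.
move=> aa bb acg e e0; have [d [d0 P]] := acg e e0; exists d; split => // k s t H.
apply: P => i; have [h1 [h2 h3]] := H i; split; first exact: le_trans h1.
by split => //; exact: le_trans bb.
Qed.

Lemma derive1_affine x xi s : derivable (fun t : R => x + t *: xi) s 1 /\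
  derive1 (fun t : R => x + t *: xi) s = xi.
Proof.
have E : is_derive s 1 (fun t : R => x + t *: xi) xi.
  have H : (fun t : R => t^-1 *: (((fun t : R => x + t *: xi) \o shift s) (t *: 1) - (x + s *: xi))) @ 0^' --> xi.
    apply: (@cvg_trans _ ((fun=> xi) @ (0 : R)^')); last exact: cvg_cst.
    apply: near_eq_cvg; near=> t; rewrite /=.
    have t0 : t != 0 by near: t; exact: nbhs_dnbhs_neq.
    have -> : x + (t *: 1 + s) *: xi - (x + s *: xi) = t *: xi.
      by rewrite [t *: 1]mulr1 scalerDl opprD addrACA subrr add0r addrK.
    by rewrite scalerA mulVf// scale1r.
  apply: DeriveDef; first by apply/cvg_ex; exists xi.
  exact: cvg_lim H.
by split; [exact: ex_derive|rewrite derive1E; exact: derive_val].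
Unshelve. all: by end_near. Qed.

Lemma integral_itv_split (F : R -> R) (C a b e : R) : a <= b -> b <= e ->
  (forall s, a <= s <= e -> - C <= F s) ->
  (\int[mu]_(s in `[a, e]) (F s)%:E =
   \int[mu]_(s in `[a, b]) (F s)%:E + \int[mu]_(s in `[b, e]) (F s)%:E)%E.
Proof.
move=> ab be FC.
have fin (x y : R) (l r : bool) : (mu [set` Interval (BSide l x) (BSide r y)] < +oo)%E.
  by rewrite lebesgue_measure_itv/=; case: ifP => _; rewrite ?ltry// -EFinB ltry.
have mI (I : interval R) : measurable ([set` I] : set R) by exact: measurable_itv.
have E1 : (\int[mu]_(s in `[a, e]) (F s)%:E =
    \int[mu]_(s in `[a, b]) (F s)%:E + \int[mu]_(s in `]b, e]) (F s)%:E)%E.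
  rewrite -(@integral_setU_nomeas _ _ _ mu _ _ F C)//; last 4 first.
  - exact: fin.
  - exact: fin.
  - by apply/disj_setPS => s []; rewrite /= !in_itv/= => /andP[_ h1] /andP[h2 _]; have := lt_le_trans h2 h1; rewrite ltxx.
  - move=> s [] /=; rewrite in_itv/= => /andP[h1 h2]; apply: FC.
      by rewrite h1 (le_trans h2 be).
    by rewrite h2 andbT (le_trans ab (ltW h1)).
  congr integral; apply/seteqP; split => s; rewrite /= !in_itv/=.
    by move=> /andP[h1 h2]; have [h|h] := leP s b; [left|right]; rewrite ?h1 ?h2.
  by move=> [/andP[-> h]|/andP[h ->]]; rewrite ?(le_trans h be)// (le_trans ab (ltW h)).
have E2 : (\int[mu]_(s in `[b, e]) (F s)%:E =
    \int[mu]_(s in [set b]) (F s)%:E + \int[mu]_(s in `]b, e]) (F s)%:E)%E.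
  rewrite -(@integral_setU_nomeas _ _ _ mu _ _ F C)//.
  - by congr integral; rewrite setU1itv// bnd_simp.
  - by rewrite [X in (X < _)%E](lebesgue_measure_set1 b) ltry.
  - exact: fin.
  - by apply/disj_setPS => s [] /= ->; rewrite in_itv/= ltxx.
  - move=> s [->|]; first by apply: FC; rewrite ab be.
    by rewrite /= in_itv/= => /andP[h1 h2]; apply: FC; rewrite h2 andbT (le_trans ab (ltW h1)).
by rewrite E1 E2 integral_set1 add0e.
Qed.

(** A coordinate at which the sup norm of [d] is attained decides: [p] is a signed multiple of one
    basis vector. *)
Lemma dual_vector d r : 0 <= r -> exists2 p, `|p| <= r & dotv p d = r * `|d|.
Proof.
move=> r0; have [->|d0] := eqVneq d 0.
  by exists 0; rewrite ?normr0// dotv0r mulr0.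
have /mx_norm_neq0[[j i] E] : mx_norm d != 0 by rewrite -[mx_norm d]/(`|d|) normr_eq0.
have {}E : `|d| = `|d 0 i| by rewrite -[`|d|]/(mx_norm d) E ord1.
exists ((r * Num.sg (d 0 i)) *: evec i).
  by rewrite normrZ norm_evec mulr1 normrM (ger0_norm r0) ler_piMr// normr_sg; case: (_ != 0).
by rewrite dotvZl dotvC dotv_evec E -mulrA -normrEsg.
Qed.

End curves.

(** * Lower bounds of the action by Fenchel's inequality *)

Section action.
Context {R : realType} {n : nat}.
Local Notation mu := (@lebesgue_measure R).
Variables (H : 'rV[R]_n -> 'rV[R]_n -> R) (c : 'rV[R]_n) (h : R).
Hypothesis HT : Tonelli_Hamiltonian H.
Implicit Types (x y p q xi d : 'rV[R]_n) (g : R -> 'rV[R]_n).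

Definition integrand g s : R := Lag H (g s) (derive1 g s) - dotv c (derive1 g s) + h.

Lemma integrand_ge g s p M : H (g s) p <= M ->
  dotv (p - c) (derive1 g s) - (M - h) <= integrand g s.
Proof.
move=> HM; have := Lag_ge HT (g s) (derive1 g s) p.
by rewrite /integrand dotvBl (dotvC _ p); lra.
Qed.

Lemma integrand_lower : exists C, forall g s, - C <= integrand g s.
Proof.
have [D D0 DP] := H_bounds HT `|c|; exists (D - h) => g s.
have [_ _ _ [h0 _ _]] := DP (g s) (g s) c c (lexx _) (lexx _).
have := @integrand_ge g s c D (le_trans (ler_norm _) h0).
by rewrite subrr dotv0l; lra.
Qed.

Lemma action_ge g a b p M : a < b -> abs_cont_on g a b ->
  (forall s, a <= s <= b -> H (g s) p <= M) ->
  ((dotv (p - c) (g b - g a) - (M - h) * (b - a))%:E <=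
    \int[mu]_(s in `[a, b]) (integrand g s)%:E)%E.
Proof.
move=> ab acg HM; have [C CP] := integrand_lower.
apply: (@action_lower_bound R n g a b _ (p - c) C (M - h)) => // s sab.
exact: integrand_ge (HM s sab).
Qed.

End action.

(** * Domination and calibration for one solution *)

Section weak_kam.
Context {R : realType} {n : nat}.
Local Notation mu := (@lebesgue_measure R).
Variables (H : 'rV[R]_n -> 'rV[R]_n -> R) (c : 'rV[R]_n) (h : R).
Hypothesis HT : Tonelli_Hamiltonian H.
Implicit Types (x y p q xi : 'rV[R]_n) (g : R -> 'rV[R]_n) (v : 'rV[R]_n -> R).

(* [tilt v] has gradient [c + v_x], so that [H(x, Du) = h] for [u = tilt v]. *)
Definition tilt v x : R := v x + dotv c x.

Lemma actionE T g : action H c h T g =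
  (\int[mu]_(s in `[(- T)%R, 0%R]) (integrand H c h g s)%:E)%E.
Proof. by []. Qed.

Section one_solution.
Variables (v : 'rV[R]_n -> R) (K : R).
Hypothesis K0 : 0 <= K.
Hypothesis vK : forall x y, `|v x - v y| <= K * `|x - y|.
Hypothesis rep : representation_formula H c h v.
Local Notation u := (tilt v).

Definition Ku : R := K + n%:R * `|c|.

Lemma Ku_ge0 : 0 <= Ku. Proof. by rewrite addr_ge0// mulr_ge0. Qed.

Lemma tilt_lipschitz x y : `|u x - u y| <= Ku * `|x - y|.
Proof.
have -> : u x - u y = (v x - v y) + dotv c (x - y) by rewrite dotvBr /tilt; ring.
by rewrite mulrDl (le_trans (ler_normD _ _))// lerD// normr_dotv.
Qed.

Lemma domination r : exists2 C, 0 <= C & forall y xi (d : R), `|xi| <= r -> 0 <= d ->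
  u (y + d *: xi) - u y <= d * (Lag H y xi + h) + C * d ^+ 2.
Proof.
have [C C0 CP] := Lag_x_lipschitz HT r.
exists (C * `|r|); first by rewrite mulr_ge0.
move=> y xi d xr; rewrite le_eqVlt => /predU1P[<-|d0].
  by rewrite scale0r addr0 subrr mul0r expr2 !mulr0 addr0.
(* The segment runs at velocity [xi] from [y] at time [- d] to [x] at time 0. On it the base point
   stays within [d * |xi|] of [y], so freezing it at [y] gives the quadratic error. *)
pose x := y + d *: xi; pose g (s : R) := x + s *: xi.
have gd : g (- d) = y by rewrite /g /x scaleNr addrK.
have adm : admissible d x g.
  split; last by rewrite /g scale0r addr0.
  apply: (@lipschitz_abs_cont_on _ _ _ `|xi|) => // a b _ ab _.
  by rewrite /g opprD addrACA subrr add0r -scalerBl normrZ mulrC ger0_norm ?subr_ge0.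
pose M := Lag H y xi + C * `|r| * d - dotv c xi + h.
have act : (action H c h d g <= (M * d)%:E)%E.
  have -> : (M * d)%:E = (\int[mu]_(s in `[(- d)%R, 0%R]) M%:E)%E.
    rewrite integral_cst//= lebesgue_measure_itv/= lte_fin oppr_lt0 d0.
    by rewrite -EFinB opprK add0r -EFinM.
  rewrite actionE; apply: le_integral_nomeas => s; rewrite /= in_itv/= => /andP[s1 s2].
  rewrite lee_fin /integrand /M; have [_ ->] := derive1_affine x xi s.
  rewrite !lerD2r -lerBlDl; apply: le_trans (ler_norm _) _; apply: le_trans (CP _ _ _ xr) _.
  have -> : g s - y = (d + s) *: xi.
    by rewrite /g /x scalerDl addrAC [y + _ - y]addrAC subrr add0r.
  rewrite -mulrA ler_wpM2l// normrZ mulrC.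
  apply: ler_pM => //; first exact: le_trans xr (ler_norm r).
  by rewrite ger0_norm; lra.
have : ((v x)%:E <= action H c h d g + (v (g (- d)))%:E)%E.
  by rewrite (rep x d0); apply: ereal_inf_lbound; exists g.
move=> /le_trans/(_ (leeD2r _ act)); rewrite -EFinD lee_fin gd /M => vx.
have -> : u x - u y = v x - v y + d * dotv c xi by rewrite /tilt /x dotvDr dotvZr; ring.
by rewrite expr2; nra.
Qed.

Lemma H_sup_bound r : exists2 M, 0 <= M - h & forall x p, `|p| <= r -> H x p <= M.
Proof.
have [D D0 DP] := H_bounds HT r; exists (Num.max D h).
  by rewrite subr_ge0 le_max lexx orbT.
move=> x p pr; have [_ _ _ [h0 _ _]] := DP x x p p pr pr.
by rewrite le_max (le_trans (ler_norm _) h0).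
Qed.

(** A multiplier of size [Ku + 1], dual to the displacement, beats the Lipschitz growth of [u] by
    one full displacement, which the remaining terms must therefore bound. For an intermediate time
    both halves are estimated and the surplus of the second is dropped. *)
Lemma near_minimizer_bound : exists2 Lam, 0 <= Lam & forall g a b e, a < b -> 0 <= e ->
  abs_cont_on g a b ->
  (\int[mu]_(s in `[a, b]) (integrand H c h g s)%:E <= (v (g b) - v (g a) + e)%:E)%E ->
  forall s, a <= s <= b -> `|g s - g a| <= Lam * (b - a) + e.
Proof.
have [M M0 MP] := H_sup_bound (Ku + 1); exists (M - h) => // g a b e ab e0 acg near.
have K1 : 0 <= Ku + 1 by rewrite addr_ge0 ?Ku_ge0.
have [C CP] := integrand_lower c h HT.
move=> s /andP[]; rewrite le_eqVlt => /predU1P[<- _|as_].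
  by rewrite subrr normr0 addr_ge0// mulr_ge0// subr_ge0 ltW.
rewrite le_eqVlt => /predU1P[->|sb].
  have [p pK pE] := dual_vector (g b - g a) K1.
  have := action_ge c h HT ab acg (fun s _ => MP (g s) p pK).
  move=> /le_trans/(_ near); rewrite lee_fin dotvBl pE => E.
  have := tilt_lipschitz (g b) (g a); rewrite ler_norml /tilt => /andP[_].
  move: E; rewrite !dotvBr; lra.
have [p1 p1K p1E] := dual_vector (g s - g a) K1.
have [p2 p2K p2E] := dual_vector (g b - g s) K1.
have ac1 := abs_cont_onS (lexx a) (ltW sb) acg.
have ac2 := abs_cont_onS (ltW as_) (lexx b) acg.
have A1 := action_ge c h HT as_ ac1 (fun s _ => MP (g s) p1 p1K).
have A2 := action_ge c h HT sb ac2 (fun s _ => MP (g s) p2 p2K).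
move: near; rewrite (@integral_itv_split _ _ C _ s)//; [|exact: ltW|exact: ltW].
move=> /(le_trans (leeD A1 A2)); rewrite -EFinD lee_fin !dotvBl p1E p2E => E.
have := tilt_lipschitz (g b) (g s); have := tilt_lipschitz (g s) (g a).
rewrite !ler_norml /tilt => /andP[_ h1] /andP[_ h2].
move: E h1 h2; rewrite !dotvBr; have := normr_ge0 (g b - g s); lra.
Qed.

(** The defect [e] is 0 for exact minimizers and the square of the time step for the steps from
    which minimizers are built. [Lam] precedes [r] because [r] is chosen later in terms of the speed
    bound. *)
Lemma near_minimizer_calibrated : exists2 Lam, 0 <= Lam & forall r, exists2 C, 0 <= C &
  forall g a b e, a < b -> 0 <= e -> abs_cont_on g a b ->
  (\int[mu]_(s in `[a, b]) (integrand H c h g s)%:E <= (v (g b) - v (g a) + e)%:E)%E ->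
  `|g b - g a| <= Lam * (b - a) + e /\
  forall p, `|p| <= r ->
   dotv p (g b - g a) - (b - a) * (H (g a) p - h) - C * (b - a) * (Lam * (b - a) + e)
    <= u (g b) - u (g a) + e.
Proof.
have [Lam Lam0 LP] := near_minimizer_bound; exists Lam => // r.
have [D D0 DP] := H_bounds HT r; exists D => // g a b e ab e0 acg near.
have near' := LP g a b e ab e0 acg near.
split=> [|p pr]; first by apply: near'; rewrite (ltW ab) lexx.
have HM s : a <= s <= b -> H (g s) p <= H (g a) p + D * (Lam * (b - a) + e).
  move=> sab; have [+ _ _ _] := DP (g s) (g a) p p pr pr.
  rewrite subrr normr0 addr0 ler_norml => /andP[_].
  by have := ler_wpM2l D0 (near' s sab); lra.
have := action_ge c h HT ab acg HM; move=> /le_trans/(_ near); rewrite lee_fin.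
by rewrite dotvBl !dotvBr /tilt; lra.
Qed.

(* What survives of minimality in a form stable under pointwise limits, with an
   error quadratic in [b - a]. *)
Definition calibrated (Lam r C : R) g := forall a b, a <= b -> b <= 0 ->
  `|g b - g a| <= Lam * (b - a) /\
  forall p, `|p| <= r ->
    dotv p (g b - g a) - (b - a) * (H (g a) p - h) - C * (b - a) ^+ 2 <= u (g b) - u (g a).

(** Minimality up to time 0 from [a] and from [b] gives the exact action on [[a, b]] by subtraction,
    all values being finite. *)
Lemma minimizing_calibrated : exists2 Lam, 0 <= Lam & forall r, exists2 C, 0 <= C &
  forall g, minimizing_curve H c h v g -> calibrated Lam r C g.
Proof.
have [Lam Lam0 LP] := near_minimizer_calibrated; exists Lam => // r.
have [C C0 CP] := LP r; exists (C * Lam); first exact: mulr_ge0.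
have [C' C'P] := integrand_lower c h HT.
move=> g [x [gx gmin]] a b; rewrite le_eqVlt => /predU1P[<- _|ab b0].
  rewrite !subrr normr0 mulr0; split=> // p _.
  by rewrite dotv0r expr0n mul0r mulr0 !subr0.
have a0 : a < 0 := lt_le_trans ab b0.
have Na0 : 0 < - a by rewrite oppr_gt0.
have [[acg _] Ea] := gmin (- a) Na0; rewrite actionE opprK in acg Ea.
have {}Ea : (\int[mu]_(s in `[a, 0%R]) (integrand H c h g s)%:E = (v x - v (g a))%:E)%E.
  by rewrite EFinB Ea addeK.
have near : (\int[mu]_(s in `[a, b]) (integrand H c h g s)%:E <= (v (g b) - v (g a) + 0)%:E)%E.
  move: b0; rewrite le_eqVlt => /predU1P[b0|b0].
    by rewrite b0 Ea gx addr0.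
  have Nb0 : 0 < - b by rewrite oppr_gt0.
  have [_ Eb] := gmin (- b) Nb0; rewrite actionE opprK in Eb.
  have {}Eb : (\int[mu]_(s in `[b, 0%R]) (integrand H c h g s)%:E = (v x - v (g b))%:E)%E.
    by rewrite EFinB Eb addeK.
  move: Ea; rewrite (@integral_itv_split _ _ C' _ b)//; [|exact: ltW|exact: ltW].
  rewrite Eb => /eqP; rewrite eq_sym -sube_eq//; last by rewrite fin_num_adde_defl.
  by rewrite -EFinB => /eqP <-; rewrite lee_fin; lra.
have [P1 P2] := CP g a b 0 ab (lexx 0) (abs_cont_onS (lexx a) b0 acg) near.
split=> [|p pr]; first by rewrite -[leRHS]addr0.
have := P2 p pr; rewrite !addr0; apply: le_trans.
by rewrite lerB// expr2; lra.
Qed.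

(** The infimum in the representation formula is only approached, and a defect [t ^+ 2] has the same
    order as the calibration error over a time [t]. *)
Lemma near_minimizing_step : exists2 Lam, 0 <= Lam & forall r, exists2 C, 0 <= C &
  forall x t, 0 < t -> exists y, `|x - y| <= Lam * t + t ^+ 2 /\
   forall p, `|p| <= r ->
   dotv p (x - y) - t * (H y p - h) - C * t * (Lam * t + t ^+ 2) <= u x - u y + t ^+ 2.
Proof.
have [Lam Lam0 LP] := near_minimizer_calibrated; exists Lam => // r.
have [C C0 CP] := LP r; exists C => // x t t0.
have t20 : 0 < t ^+ 2 by rewrite exprn_gt0.
have fin : ereal_inf [set (action H c h t g + (v (g (- t)))%:E)%E | g in admissible t x] \is a fin_num.
  by rewrite -(rep x t0).
have [_ [g [acg gx] <-]] := lb_ereal_inf_adherent t20 fin.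
rewrite -(rep x t0) => lt; exists (g (- t)).
have Nt : - t < 0 by rewrite oppr_lt0.
have near : (\int[mu]_(s in `[(- t)%R, 0%R]) (integrand H c h g s)%:E <= (v (g 0) - v (g (- t)) + t ^+ 2)%:E)%E.
  rewrite -actionE; move/ltW: lt; rewrite -EFinD -leeBrDr// -EFinB gx => /le_trans; apply.
  by rewrite lee_fin; lra.
have := CP g (- t) 0 _ Nt (ltW t20) acg near.
by rewrite gx opprK add0r.
Qed.

End one_solution.
End weak_kam.

(** * Regularity along calibrated curves *)

Section cluster_limits.
Context {R : realType} {n : nat}.

Lemma bounded_cluster (a : nat -> 'rV[R]_n) M : (forall k, `|a k| <= M) ->
  exists P, `|P| <= M /\ forall e N, 0 < e -> exists2 k, (N <= k)%N & `|a k - P| < e.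
Proof.
move=> aM; have [|P [PM Pc]] := @rV_compact_ball R n M (a @ \oo) _.
  by exists 0%N => // k _; exact: aM.
exists P; split => // e N e0.
have [] := Pc [set z | exists2 k, (N <= k)%N & z = a k] [set z | `|P - z| < e].
- by exists N => // k Nk; exists k.
- exact: near_norm.
- by move=> _ [[k Nk ->] /= d]; exists k => //; rewrite distrC.
Qed.

(** The hypothesis compares only scales within a factor 2 of each other; repeated halving sums a
    geometric series, whence the factor 2 in front of [B]. *)
Lemma cauchy_at0 (A : R -> 'rV[R]_n) (B t : R) : 0 <= B -> 0 < t ->
  (forall s s', 0 < s' -> s' <= s -> s <= t -> s <= 2 * s' -> `|A s - A s'| <= B * s) ->
  exists P, forall s, 0 < s -> s <= t -> `|A s - P| <= 2 * B * s.
Proof.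
move=> B0 t0 H.
have K k : forall s s', 0 < s' -> s' <= s -> s <= t -> s <= 2 ^+ k * s' -> `|A s - A s'| <= 2 * B * s.
  elim: k => [|k IH] s s' s'0 ss st.
    rewrite mul1r => s's; have -> : s = s' by apply/eqP; rewrite eq_le ss s's.
    by rewrite subrr normr0 !mulr_ge0// ltW.
  rewrite exprS => sk; have [s2|s2] := leP s (2 * s').
    apply: le_trans (H s s' s'0 ss st s2) _; rewrite -mulrA ler_peMl ?ler1n//.
    by rewrite mulr_ge0//; lra.
  have h1 : `|A s - A (s / 2)| <= B * s by apply: H; lra.
  have h2 : `|A (s / 2) - A s'| <= 2 * B * (s / 2).
    by apply: IH; [lra|lra|lra|rewrite ler_pdivrMr// mulrC mulrA].
  rewrite -(subrKA (A (s / 2))); apply: le_trans (ler_normD _ _) _.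
  by apply: le_trans (lerD h1 h2) _; rewrite le_eqVlt; apply/orP; left; apply/eqP; field.
have KK s s' : 0 < s' -> s' <= s -> s <= t -> `|A s - A s'| <= 2 * B * s.
  move=> s'0 ss st; apply: (K (Num.bound (s / s'))) => //.
  rewrite -ler_pdivrMr//; apply/ltW; apply: lt_le_trans (archi_boundP _) _.
    by rewrite divr_ge0// ltW// (lt_le_trans s'0).
  by rewrite -natrX ler_nat ltnW// ltn_expl.
(* A cluster point along one sequence of scales is enough, since [KK] already compares any two
   scales. *)
pose a k := A (t / k.+1%:R).
have tk k : 0 < t / k.+1%:R <= t.
  by rewrite divr_gt0//= ler_pdivrMr// ler_peMr ?ler1n// ltW.
have [|P [_ Pc]] := @bounded_cluster a (`|A t| + 2 * B * t).
  move=> k; have /andP[k0 kt] := tk k; have := KK t _ k0 kt (lexx t).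
  rewrite -[a k](subrK (A t)) distrC => h.
  by apply: le_trans (ler_normD _ _) _; rewrite addrC lerD2l.
exists P => s s0 st; apply/ler_addgt0Pr => e e0.
have [k Nk kP] := Pc e (Num.bound (t / s)) e0.
have ks : t / k.+1%:R <= s.
  rewrite ler_pdivrMr// mulrC -ler_pdivrMr//; apply/ltW.
  apply: lt_le_trans (archi_boundP _) _; first by rewrite divr_ge0// ltW.
  by rewrite ler_nat ltnW// ltnS.
have /andP[k0 kt] := tk k.
rewrite -(subrKA (a k)); apply: le_trans (ler_normD _ _) _.
by apply: lerD (KK _ _ k0 ks st) (ltW kP).
Qed.

End cluster_limits.

(** * Points with a quantitative gradient *)

Section regular_points.
Context {R : realType} {n : nat}.
Variable u : 'rV[R]_n -> R.
Implicit Types (x y z P Q : 'rV[R]_n).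

(* Sampling at the scale [|z| <= s ^+ 3] with error [s ^+ 4] makes the gradient
   1/3-Hoelder ([regular_holder]). *)
Definition regular_at (t C : R) x P := `|P| <= C /\
  forall s z, 0 < s -> s <= t -> `|z| <= s ^+ 3 ->
    `|u (x + z) - u x - dotv P z| <= C * s ^+ 4.

Lemma cube_root (r : R) : 0 <= r -> exists2 s, 0 <= s & s ^+ 3 = r.
Proof.
move=> r0; exists (r `^ (3%:R^-1)); first exact: powR_ge0.
by rewrite -powR_mulrn ?powR_ge0// -powRrM mulVf ?pnatr_eq0// powRr1.
Qed.

Lemma regular_frechet t C x P : 0 < t -> regular_at t C x P -> frechet u x P.
Proof.
move=> t0 [PC HP] e e0; have C0 : 0 <= C := le_trans (normr_ge0 P) PC.
have C1 : 0 < C + 1 by rewrite ltr_wpDl.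
pose m := Num.min t (e / (C + 1)).
have m0 : 0 < m by rewrite lt_min t0 divr_gt0.
exists (m ^+ 3); first by rewrite exprn_gt0.
move=> z zm; have [->|z0] := eqVneq z 0.
  by rewrite addr0 subrr dotv0r subrr !normr0 mulr0.
have [s s0 sz] := cube_root (normr_ge0 z).
have {}s0 : 0 < s.
  by rewrite lt_neqAle s0 andbT; apply/eqP => s00; move: sz; rewrite -s00 expr0n/= => /esym/eqP; rewrite normr_eq0 (negbTE z0).
have sm : s <= m by move: zm; rewrite -sz ler_pXn2r// ?nnegrE ltW.
have [st se] : s <= t /\ s <= e / (C + 1) by apply/andP; rewrite -le_min.
apply: le_trans (HP s z s0 st _) _; first by rewrite sz.
rewrite exprS sz mulrA ler_wpM2r//.
move: se; rewrite ler_pdivlMr// mulrC; apply: le_trans.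
by rewrite ler_wpM2r ?(ltW s0)// lerDl.
Qed.

(** The expansion is used from [x] to [x + z], from [y] to [x] and from [y] to [x + z]. The values
    of [u] cancel and leave [dotv (P - Q) z <= 3 * C * s ^+ 4] for [|z| <= s ^+ 3 / 2]; the halves
    keep [x - y + z] within [s ^+ 3], and dividing by [s ^+ 3 / 2] gives the 6. *)
Lemma regular_holder t C x y P Q s : regular_at t C x P -> regular_at t C y Q ->
  0 < s -> s <= t -> `|x - y| <= s ^+ 3 / 2 -> `|P - Q| <= 6 * C * s.
Proof.
move=> [PC HP] [_ HQ] s0 st xy; have s3 : 0 < s ^+ 3 by rewrite exprn_gt0.
have s32 : 0 < s ^+ 3 / 2 by rewrite divr_gt0.
apply: (rV_norm_le_dotv s32) => z zs; rewrite dotvBl.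
have h1 := HP s z s0 st (le_trans zs _).
have h2 := HQ s (x - y) s0 st (le_trans xy _).
have h3 := HQ s (x - y + z) s0 st (le_trans (ler_normD _ _) _).
have E : y + (x - y) = x by rewrite addrC subrK.
have {}h1 : `|u (x + z) - u x - dotv P z| <= C * s ^+ 4 by apply: h1; lra.
have {}h2 : `|u x - u y - dotv Q (x - y)| <= C * s ^+ 4.
  by move: h2; rewrite E; apply; lra.
have {}h3 : `|u (x + z) - u y - (dotv Q (x - y) + dotv Q z)| <= C * s ^+ 4.
  by move: h3; rewrite [y + (x - y + z)]addrA E dotvDr; apply; lra.
move: h1 h2 h3; rewrite !ler_norml => /andP[h11 h12] /andP[h21 h22] /andP[h31 h32].
have -> : 6 * C * s * (s ^+ 3 / 2) = 3 * (C * s ^+ 4) by field.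
lra.
Qed.

(** The gradients at the approximating points are bounded, so they cluster. For fixed [s] and [z]
    the inequality is continuous in the point and in the gradient, so it passes to the limit with
    the same constant. *)
Lemma regular_closed t C (K : R) x : 0 <= K ->
  (forall x y, `|u x - u y| <= K * `|x - y|) ->
  (forall e, 0 < e -> exists y P, `|x - y| < e /\ regular_at t C y P) ->
  exists P, regular_at t C x P.
Proof.
move=> K0 uK near.
have inv k : 0 < (k.+1%:R^-1 : R) by rewrite invr_gt0.
have /choice[y yP] k : exists y, exists P, `|x - y| < k.+1%:R^-1 /\ regular_at t C y P.
  by have [y [P ?]] := near _ (inv k); exists y, P.
have /choice[P PP] := yP.
have [k|P0 [P0C cl]] := @bounded_cluster R n P C; first by case: (PP k) => _ [].
exists P0; split => // s z s0 st zs; apply/ler_addgt0Pr => e e0.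
pose D := 2 * K + n%:R * `|z| + 1.
have D0 : 0 < D by rewrite ltr_wpDl// addr_ge0// mulr_ge0.
have eD : 0 < e / D by rewrite divr_gt0.
have [k Nk kP] := cl (e / D) (Num.bound (D / e)) eD.
have ke : k.+1%:R^-1 < e / D.
  rewrite -[e / D]invf_div ltf_pV2 ?posrE// ?divr_gt0//.
  apply: lt_le_trans (archi_boundP _) _; first by rewrite divr_ge0// ltW.
  by rewrite ler_nat ltnW// ltnS.
have [xy [_ /(_ s z s0 st zs) h]] := PP k.
have {}xy : `|x - y k| <= e / D by rewrite ltW// (lt_trans xy).
have h1 := uK (x + z) (y k + z); have h2 := uK x (y k).
have h3 := normr_dotv (P k - P0) z.
have E : x + z - (y k + z) = x - y k by rewrite opprD addrACA subrr addr0.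
rewrite E in h1.
have b1 : K * `|x - y k| <= K * (e / D) by rewrite ler_wpM2l.
have b2 : n%:R * `|P k - P0| * `|z| <= n%:R * `|z| * (e / D).
  by rewrite mulrAC ler_wpM2l ?mulr_ge0// ltW.
have b3 : (2 * K + n%:R * `|z|) * (e / D) <= e.
  by rewrite mulrCA ger_pMr// ler_pdivrMr// mul1r lerDl.
move: h1 h2 h3 h; rewrite dotvBl !ler_norml => /andP[? ?] /andP[? ?] /andP[? ?] /andP[? ?].
apply/andP; split; lra.
Qed.

End regular_points.

(** * Differentiability along calibrated curves *)

Section calibrated_regular.
Context {R : realType} {n : nat}.
Variables (H : 'rV[R]_n -> 'rV[R]_n -> R) (c : 'rV[R]_n) (h : R) (v : 'rV[R]_n -> R).
Hypothesis HT : Tonelli_Hamiltonian H.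
Local Notation u := (tilt c v).
Hypothesis dom : forall r, exists2 C, 0 <= C & forall y xi (d : R), `|xi| <= r -> 0 <= d ->
  u (y + d *: xi) - u y <= d * (Lag H y xi + h) + C * d ^+ 2.
Implicit Types (x y z p q xi : 'rV[R]_n) (g : R -> 'rV[R]_n).

Definition back_slope g (s t : R) := (t ^+ 2)^-1 *: (g s - g (s - t ^+ 2)).
Definition fwd_slope g (s t : R) := (t ^+ 2)^-1 *: (g (s + t ^+ 2) - g s).
(** In both momenta the base point is the earlier end of the time interval, as in [calibrated] and
    in [dom]. *)
Definition back_momentum g s t := leg H (g (s - t ^+ 2)) (back_slope g s t).
Definition fwd_momentum g s t := leg H (g s) (fwd_slope g s t).

Variables (Lam r C1 : R).
Hypothesis Lam0 : 0 <= Lam.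
Hypothesis legr : forall x xi, `|xi| <= Lam + 1 -> `|leg H x xi| <= r.

Let cal := calibrated H c h v Lam r C1.

(** The choice [p = leg H (g a) xi] turns Fenchel's inequality into an equality: up to a quadratic
    error, [u] grows at least by the cost of the chord. *)
Lemma cal_lower g a b xi : cal g -> a <= b -> b <= 0 -> `|xi| <= Lam + 1 ->
  g b - g a = (b - a) *: xi ->
  (b - a) * (Lag H (g a) xi + h) - `|C1| * (b - a) ^+ 2 <= u (g b) - u (g a).
Proof.
move=> cg ab b0 xr E; have [_ /(_ _ (legr (g a) xr))] := cg a b ab b0.
rewrite E dotvZr (dotvC (leg _ _ _)) => le1; apply: le_trans le1; rewrite (Lag_leg HT).
have := ler_wpM2r (sqr_ge0 (b - a)) (ler_norm C1); lra.
Qed.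

Lemma slope_bound g a b : cal g -> a < b -> b <= 0 -> `|(b - a)^-1 *: (g b - g a)| <= Lam.
Proof.
move=> cg ab b0; have [L _] := cg a b (ltW ab) b0; have ba : 0 < b - a by rewrite subr_gt0.
by rewrite normrZ normfV (gtr0_norm ba) ler_pdivrMl// mulrC.
Qed.

(** Upper bound: a segment reaches [g s + z] from [g (s - t ^+ 2)] at the chord velocity plus
    [z / t ^+ 2], and [cal_lower] for the chord is subtracted. Lower bound: a segment leads from
    [g s + z] to [g (s + t ^+ 2)] at the chord velocity minus [z / t ^+ 2]; here the initial point
    moves too, which costs the term with [C4]. As [t <= 1], velocities stay below [Lam + 1]. *)
Lemma one_sided_expansions : exists2 C, 0 <= C & forall g, cal g -> forall s t, 0 < t -> t <= 1 ->
  (s <= 0 -> forall z, `|z| <= t ^+ 3 ->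
     u (g s + z) - u (g s) <= dotv (back_momentum g s t) z + C * t ^+ 4) /\
  (s + t ^+ 2 <= 0 -> forall z, `|z| <= t ^+ 3 ->
     dotv (fwd_momentum g s t) z - C * t ^+ 4 <= u (g s + z) - u (g s)).
Proof.
have [C2 C20 dP] := dom (Lam + 1).
have [C3 C30 LP] := Lag_xi_upper HT (Lam + 1).
have [C4 C40 XP] := Lag_x_lipschitz HT (Lam + 1).
exists (`|C1| + C2 + C3 + C4); first by rewrite !addr_ge0.
move=> g cg s t t0 t1.
have d0 : 0 < t ^+ 2 by rewrite exprn_gt0.
have t4 : (t ^+ 2) ^+ 2 = t ^+ 4 by rewrite -exprM.
have zd z : `|z| <= t ^+ 3 -> `|(t ^+ 2)^-1 *: z| <= t.
  move=> zt; rewrite normrZ normfV gtr0_norm// ler_pdivrMl//.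
  by apply: le_trans zt _; rewrite -exprSr.
have zq z : `|z| <= t ^+ 3 -> t ^+ 2 * `|(t ^+ 2)^-1 *: z| ^+ 2 <= t ^+ 4.
  move=> zt; rewrite (_ : t ^+ 4 = t ^+ 2 * t ^+ 2); last by rewrite -exprD.
  by rewrite ler_wpM2l ?(ltW d0)// lerXn2r ?nnegrE ?(ltW t0)//; exact: zd.
split=> s0 z zt.
- set y := g (s - t ^+ 2); set q := back_slope g s t; set w := (t ^+ 2)^-1 *: z.
  have sd : s - t ^+ 2 < s by rewrite ltrBlDr ltrDl.
  have sE : s - (s - t ^+ 2) = t ^+ 2 by rewrite opprB addrC subrK.
  have qL : `|q| <= Lam by have := slope_bound cg sd s0; rewrite sE.
  have q1 : `|q| <= Lam + 1 by apply: le_trans qL _; rewrite lerDl.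
  have gE : g s - y = t ^+ 2 *: q by rewrite /q /back_slope scalerA divff ?scale1r ?gt_eqF.
  have qw : `|q + w| <= Lam + 1.
    by apply: le_trans (ler_normD _ _) _; apply: lerD => //; exact: le_trans (zd z zt) t1.
  have := dP y (q + w) _ qw (ltW d0); rewrite scalerDr -gE addrA [y + _]addrC subrK.
  rewrite /w scalerA divff ?gt_eqF// scale1r -/w t4 => b1.
  have := cal_lower cg (ltW sd) s0 q1; rewrite sE -/y => /(_ gE); rewrite t4 => b2.
  have := LP y q (q + w) q1 qw; rewrite addrAC subrr add0r => b3.
  have b4 : t ^+ 2 * dotv (leg H y q) w = dotv (leg H y q) z.
    by rewrite /w dotvZr mulrA divff ?mul1r ?gt_eqF.
  have b5 := ler_wpM2l C30 (zq z zt).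
  have b6 := ler_wpM2l (ltW d0) b3.
  have t40 : 0 <= t ^+ 4 by rewrite exprn_ge0// ltW.
  have b7 := mulr_ge0 C40 t40.
  rewrite /back_momentum -/y -/q -b4; move: b5 b6; rewrite -/w; nra.
- set y := g (s + t ^+ 2); set q := fwd_slope g s t; set w := (t ^+ 2)^-1 *: z.
  have sd : s < s + t ^+ 2 by rewrite ltrDl.
  have sE : s + t ^+ 2 - s = t ^+ 2 by rewrite addrAC subrr add0r.
  have qL : `|q| <= Lam by have := slope_bound cg sd s0; rewrite sE.
  have q1 : `|q| <= Lam + 1 by apply: le_trans qL _; rewrite lerDl.
  have gE : y - g s = t ^+ 2 *: q by rewrite /q /fwd_slope scalerA divff ?scale1r ?gt_eqF.
  have qw : `|q - w| <= Lam + 1.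
    by apply: le_trans (ler_normB _ _) _; apply: lerD => //; exact: le_trans (zd z zt) t1.
  have := dP (g s + z) (q - w) _ qw (ltW d0); rewrite scalerBr -gE.
  rewrite {1}/w scalerA divff ?gt_eqF// scale1r t4.
  rewrite (_ : g s + z + (y - g s - z) = y); last first.
    by rewrite addrACA subrr addr0 addrC subrK.
  move=> b1.
  have := cal_lower cg (ltW sd) s0 q1; rewrite sE -/y => /(_ gE); rewrite t4 => b2.
  have b3 := Lag_xi_lower HT (g s) q (q - w).
  have := LP (g s) q (q - w) q1 qw; rewrite addrAC subrr add0r normrN dotvNr => b3'.
  have b4 : t ^+ 2 * dotv (leg H (g s) q) w = dotv (leg H (g s) q) z.
    by rewrite /w dotvZr mulrA divff ?mul1r ?gt_eqF.
  have b5 := ler_wpM2l C30 (zq z zt).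
  have b6 := ler_wpM2l (ltW d0) b3'.
  have := XP (g s) (g s + z) (q - w) qw; rewrite addrAC subrr add0r => b7.
  have b8 : t ^+ 2 * (C4 * `|z|) <= C4 * t ^+ 4.
    rewrite mulrCA ler_wpM2l// (_ : t ^+ 4 = t ^+ 2 * t ^+ 2); last by rewrite -exprD.
    rewrite ler_wpM2l ?(ltW d0)//; apply: le_trans zt _.
    by rewrite exprS ler_piMl// ltW.
  have b9 := ler_wpM2l (ltW d0) (le_trans (ler_norm _) b7).
  rewrite /fwd_momentum -/q -b4; move: b5 b6; rewrite -/w; nra.
Qed.

Lemma calibrated_regular : exists2 C, 0 <= C & forall g, cal g ->
  forall s t, 0 < t -> t <= 1 -> s + t ^+ 2 <= 0 -> exists P,
    regular_at u t C (g s) P /\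
    forall t', 0 < t' -> t' <= t ->
      `|back_slope g s t' - Hp H (g s) P| <= C * t' /\
      `|fwd_slope g s t' - Hp H (g s) P| <= C * t'.
Proof.
have [C C0 CP] := one_sided_expansions.
have [r' r'0 r'P] := leg_bounded HT Lam.
pose B := 32 * C; have B0 : 0 <= B by rewrite mulr_ge0.
pose N : R := n%:R.
pose E := 2 * B + 16 * C; have E0 : 0 <= E by rewrite addr_ge0 ?mulr_ge0.
have [D D0 DP] := H_bounds HT (r' + 2 * B).
have NE0 : 0 <= N * E by rewrite mulr_ge0// /N.
have DE0 : 0 <= D * (Lam + E) by rewrite mulr_ge0// addr_ge0.
exists (r' + 2 * B + C + N * E + D * (Lam + E)).
  by have h2B := mulr_ge0 (ler0n R 2) B0; do 4 (apply: addr_ge0 => //).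
move=> g cg s t t0 t1 st.
have s0 : s <= 0 by apply: le_trans st; rewrite lerDl sqr_ge0.
(* The lower expansion at scale [a] and the upper one at scale [b] both hold for [|z| <= b ^+ 3].
   Their errors add up to at most [2 * C * a ^+ 4], which is at most [16 * C * a * b ^+ 3] because
   [a ^+ 3 <= 8 * b ^+ 3]. *)
have cmp a b : 0 < b -> b <= a -> a <= t -> a <= 2 * b ->
    `|fwd_momentum g s a - back_momentum g s b| <= 16 * C * a.
  move=> b0 ba at_ ab; have a0 : 0 < a := lt_le_trans b0 ba.
  have a1 : a <= 1 := le_trans at_ t1.
  have b3 : 0 < b ^+ 3 by rewrite exprn_gt0.
  apply: (rV_norm_le_dotv b3) => z zb; rewrite dotvBl.
  have ba3 : b ^+ 3 <= a ^+ 3 by rewrite lerXn2r ?nnegrE ?(ltW a0) ?(ltW b0).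
  have sa : s + a ^+ 2 <= 0.
    by apply: le_trans st; rewrite lerD2l lerXn2r ?nnegrE ?(ltW a0) ?(ltW t0).
  have [_ /(_ sa z (le_trans zb ba3)) h1] := CP g cg s a a0 a1.
  have [/(_ s0 z zb) h2 _] := CP g cg s b b0 (le_trans ba a1).
  have ba4 : b ^+ 4 <= a ^+ 4 by rewrite lerXn2r ?nnegrE ?(ltW a0) ?(ltW b0).
  have h3 := ler_wpM2l C0 ba4.
  have ab3 : a ^+ 3 <= 8 * b ^+ 3.
    have -> : 8 * b ^+ 3 = (2 * b) ^+ 3 by ring.
    by rewrite lerXn2r ?nnegrE ?mulr_ge0 ?(ltW a0) ?(ltW b0).
  have h4 : C * a ^+ 4 <= 8 * C * a * b ^+ 3.
    have := ler_wpM2l (mulr_ge0 C0 (ltW a0)) ab3; rewrite !exprS; nra.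
  lra.
(* Two backward momenta are compared through the forward one at the larger scale; this explains
   [B = 32 * C]. *)
have cauchy a b : 0 < b -> b <= a -> a <= t -> a <= 2 * b ->
    `|back_momentum g s a - back_momentum g s b| <= B * a.
  move=> b0 ba at_ ab; have a0 : 0 < a := lt_le_trans b0 ba.
  have h1 := cmp a b b0 ba at_ ab.
  have h2 : `|fwd_momentum g s a - back_momentum g s a| <= 16 * C * a by apply: cmp => //; lra.
  rewrite -(subrKA (fwd_momentum g s a)); apply: le_trans (ler_normD _ _) _.
  by rewrite distrC /B; lra.
have [P PP] := cauchy_at0 B0 t0 cauchy.
have bs a : 0 < a -> a <= t -> `|back_slope g s a| <= Lam.
  move=> a0 at_; have sd : s - a ^+ 2 < s by rewrite ltrBlDr ltrDl exprn_gt0.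
  by have := slope_bound cg sd s0; rewrite subKr.
have fs a : 0 < a -> a <= t -> `|fwd_slope g s a| <= Lam.
  move=> a0 at_; have sd : s < s + a ^+ 2 by rewrite ltrDl exprn_gt0.
  have := slope_bound cg sd; rewrite [s + _ - s]addrAC subrr add0r; apply.
  by apply: le_trans st; rewrite lerD2l lerXn2r ?nnegrE ?(ltW a0) ?(ltW t0).
have bm a : 0 < a -> a <= t -> `|back_momentum g s a| <= r' by move=> ? ?; apply: r'P; exact: bs.
have fm a : 0 < a -> a <= t -> `|fwd_momentum g s a| <= r' by move=> ? ?; apply: r'P; exact: fs.
have FP a : 0 < a -> a <= t -> `|fwd_momentum g s a - P| <= E * a.
  move=> a0 at_; rewrite -(subrKA (back_momentum g s a)); apply: le_trans (ler_normD _ _) _.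
  by have := PP a a0 at_; have := cmp a a a0 (lexx a) at_; rewrite /E; lra.
have Pr : `|P| <= r' + 2 * B.
  rewrite -[P](subKr (back_momentum g s t)); apply: le_trans (ler_normB _ _) _.
  apply: lerD; first exact: bm.
  apply: le_trans (PP t t0 (lexx t)) _; rewrite ler_piMr ?mulr_ge0//.
have r'B : r' <= r' + 2 * B by rewrite lerDl mulr_ge0.
have BE : 2 * B <= E by rewrite lerDl mulr_ge0.
exists P; split; [split|].
- by apply: le_trans Pr _; lra.
- move=> a z a0 at_ za.
  have a1 : a <= 1 := le_trans at_ t1.
  have sa : s + a ^+ 2 <= 0.
    by apply: le_trans st; rewrite lerD2l lerXn2r ?nnegrE ?(ltW a0) ?(ltW t0).
  have [/(_ s0 z za) h2 /(_ sa z za) h1] := CP g cg s a a0 a1.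
  have a4 : 0 <= a ^+ 4 by rewrite exprn_ge0// ltW.
  have K Q X : `|Q - P| <= X * a -> X <= E -> `|dotv (Q - P) z| <= N * E * a ^+ 4.
    move=> QP XE; apply: le_trans (normr_dotv _ _) _; rewrite -/N -!mulrA ler_wpM2l ?/N//.
    have := ler_pM (normr_ge0 _) (normr_ge0 _) QP za.
    rewrite -[X * a * _]mulrA -exprS => /le_trans; apply.
    by rewrite ler_wpM2r.
  have := K _ _ (PP a a0 at_) BE; have := K _ _ (FP a a0 at_) (lexx E).
  rewrite !dotvBl !ler_norml => /andP[k1 _] /andP[_ k2].
  have z1 := mulr_ge0 DE0 a4; have z2 := mulr_ge0 r'0 a4; have z3 := mulr_ge0 B0 a4.
  by apply/andP; split; lra.
- move=> a a0 at_; have a1 : a <= 1 := le_trans at_ t1.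
  have a0' := ltW a0.
  have z1 := mulr_ge0 C0 a0'; have z2 := mulr_ge0 r'0 a0'; have z3 := mulr_ge0 B0 a0'.
  have z4 := mulr_ge0 NE0 a0'.
  have fin X : X <= D * (Lam + E) * a -> X <= (r' + 2 * B + C + N * E + D * (Lam + E)) * a.
    by move=> h1; lra.
  have a2 : a ^+ 2 <= a by rewrite expr2 ler_piMl.
  split; apply: fin.
  + have [_ + _ _] := DP (g (s - a ^+ 2)) (g s) (back_momentum g s a) P (le_trans (bm a a0 at_) r'B) Pr.
    rewrite /back_momentum Hp_leg// => /le_trans; apply; rewrite -mulrA ler_wpM2l//.
    have sd : s - a ^+ 2 <= s by rewrite gerBl sqr_ge0.
    have [L _] := cg _ _ sd s0; rewrite subKr distrC in L.
    rewrite mulrDl; apply: lerD; first by apply: le_trans L _; rewrite ler_wpM2l.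
    by apply: le_trans (PP a a0 at_) _; rewrite ler_wpM2r.
  + have [_ + _ _] := DP (g s) (g s) (fwd_momentum g s a) P (le_trans (fm a a0 at_) r'B) Pr.
    rewrite /fwd_momentum Hp_leg// => /le_trans; apply; rewrite -mulrA ler_wpM2l//.
    rewrite subrr normr0 add0r; apply: le_trans (FP a a0 at_) _.
    by rewrite ler_wpM2r// lerDr.
Qed.

End calibrated_regular.

(** * Derivatives of vector-valued curves *)

Section derivative_of_curves.
Context {R : realType} {n : nat}.
Implicit Types (f : R -> 'rV[R]_n) (xi : 'rV[R]_n).

Lemma derive1_rVP f s xi :
  (derivable f s 1 /\ derive1 f s = xi) <->
  (forall e, 0 < e -> exists2 d, 0 < d & forall k, `|k| <= d ->
     `|f (s + k) - f s - k *: xi| <= e * `|k|).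
Proof.
split=> [[df <-] e e0|H].
  have : h^-1 *: ((f \o shift s) (h *: 1) - f s) @[h --> 0^'] --> derive1 f s.
    by rewrite derive1E; exact: df.
  move=> /cvgrPdist_le/(_ e e0); rewrite near_withinE => /nbhs_ballP[d /= d0 P].
  exists (d / 2); first by rewrite divr_gt0.
  move=> k kd; have [->|k0] := eqVneq k 0.
    by rewrite addr0 subrr scale0r subrr !normr0 mulr0.
  have := P k; rewrite /ball/= sub0r normrN => /(_ _ k0) h.
  have {}h : `|derive1 f s - k^-1 *: (f (k *: 1 + s) - f s)| <= e by apply: h; lra.
  rewrite -[X in X - _](scalerKV k0) -scalerBr normrZ mulrC ler_wpM2r//.
  by move: h; rewrite distrC [k *: 1]mulr1 [k + s]addrC.
have cv : h^-1 *: ((f \o shift s) (h *: 1) - f s) @[h --> 0^'] --> xi.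
  apply/cvgrPdist_le => e e0; have [d d0 P] := H e e0.
  near=> k => /=.
  have k0 : k != 0 by near: k; exact: nbhs_dnbhs_neq.
  have kd : `|k| < d by near: k; exact: dnbhs0_lt.
  rewrite [k *: 1]mulr1 distrC -[X in _ - X](scalerK k0) -scalerBr normrZ normfV.
  by rewrite ler_pdivrMl ?normr_gt0// mulrC [k + s]addrC; apply: P; exact: ltW.
split; first by apply/cvg_ex; exists xi.
by rewrite derive1E; exact: cvg_lim cv.
Unshelve. all: by end_near. Qed.

Lemma le_of_small (X Y K t : R) : 0 < t -> 0 <= K ->
  (forall s, 0 < s -> s <= t -> X <= Y + K * s) -> X <= Y.
Proof.
move=> t0 K0 P; apply/ler_addgt0Pr => e e0; have K1 : 0 < K + 1 by rewrite ltr_wpDl.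
pose s := Num.min t (e / (K + 1)).
have s0 : 0 < s by rewrite lt_min t0 divr_gt0.
have [st se] : s <= t /\ s <= e / (K + 1) by apply/andP; rewrite -le_min.
apply: le_trans (P s s0 st) _; rewrite lerD2l.
move: se; rewrite ler_pdivlMr// mulrC; apply: le_trans; rewrite ler_wpM2r ?ltW//.
by rewrite ltrDl.
Qed.

End derivative_of_curves.

(** * Hamilton's equations along calibrated curves *)

Section hamilton_flow.
Context {R : realType} {n : nat}.
Variables (H : 'rV[R]_n -> 'rV[R]_n -> R) (c : 'rV[R]_n) (h : R) (v : 'rV[R]_n -> R).
Hypothesis HT : Tonelli_Hamiltonian H.
Local Notation u := (tilt c v).
Hypothesis dom : forall r, exists2 C, 0 <= C & forall y xi (d : R), `|xi| <= r -> 0 <= d ->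
  u (y + d *: xi) - u y <= d * (Lag H y xi + h) + C * d ^+ 2.
Implicit Types (x y z p q xi : 'rV[R]_n) (g : R -> 'rV[R]_n).
Variables (Lam r C1 : R).
Hypothesis Lam0 : 0 <= Lam.
Hypothesis legr : forall x xi, `|xi| <= Lam + 1 -> `|leg H x xi| <= r.
Let cal := calibrated H c h v Lam r C1.

Variable C : R.
Hypothesis C0 : 0 <= C.
Hypothesis CP : forall g, cal g -> forall s t, 0 < t -> t <= 1 -> s + t ^+ 2 <= 0 -> exists P,
    regular_at u t C (g s) P /\
    forall t', 0 < t' -> t' <= t ->
      `|back_slope g s t' - Hp H (g s) P| <= C * t' /\
      `|fwd_slope g s t' - Hp H (g s) P| <= C * t'.

Definition momentum g s := grad u (g s).

Lemma regular_momentum g s t : cal g -> 0 < t -> t <= 1 -> s + t ^+ 2 <= 0 ->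
  regular_at u t C (g s) (momentum g s) /\
    forall t', 0 < t' -> t' <= t ->
      `|back_slope g s t' - Hp H (g s) (momentum g s)| <= C * t' /\
      `|fwd_slope g s t' - Hp H (g s) (momentum g s)| <= C * t'.
Proof.
move=> cg t0 t1 st; have [P [PR PS]] := CP cg t0 t1 st.
by rewrite /momentum (frechet_grad (regular_frechet t0 PR)).
Qed.

Lemma room (s : R) : s < 0 -> exists t, [/\ 0 < t, t <= 1 & s + t ^+ 2 <= 0].
Proof.
(* This scale fits because [t ^+ 2 <= t] for [t <= 1]. *)
move=> s0; exists (Num.min 1 (- s)); have ns0 : 0 < - s by rewrite oppr_gt0.
have t0 : 0 < Num.min 1 (- s) by rewrite lt_min ltr01.
have t1 : Num.min 1 (- s) <= 1 by rewrite ge_min lexx.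
split=> //; rewrite addrC -lerBrDr sub0r expr2.
apply: (@le_trans _ _ (Num.min 1 (- s))); first by rewrite ler_piMl// ltW.
by rewrite ge_min lexx orbT.
Qed.

Lemma cal_lipschitz g a b : cal g -> a <= 0 -> b <= 0 -> `|g a - g b| <= Lam * `|a - b|.
Proof.
move=> cg; wlog ab : a b / a <= b.
  move=> W a0 b0; have [ab|/ltW ba] := leP a b; first exact: W.
  by rewrite distrC [`|a - b|]distrC; exact: W.
move=> a0 b0; have [L _] := cg a b ab b0.
by rewrite distrC [`|a - b|]distrC ger0_norm// subr_ge0.
Qed.

(** A time increment [k] belongs to the scale [sqrt |k|]; the forward slope serves [k > 0] and the
    backward slope [k < 0], and both approach the same [Hp] at a rate linear in the scale. *)
Lemma cal_derivable g s : cal g -> s < 0 ->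
  derivable g s 1 /\ derive1 g s = Hp H (g s) (momentum g s).
Proof.
move=> cg s0; have [t [t0 t1 st]] := room s0.
have [_ sl] := regular_momentum cg t0 t1 st.
apply/derive1_rVP => e e0; have C10 : 0 < C + 1 by rewrite ltr_wpDl.
pose m := Num.min t (e / (C + 1)).
have m0 : 0 < m by rewrite lt_min t0 divr_gt0.
have [mt me] : m <= t /\ m <= e / (C + 1) by apply/andP; rewrite -le_min.
exists (m ^+ 2); first by rewrite exprn_gt0.
move=> k km; have [->|k0] := eqVneq k 0.
  by rewrite addr0 subrr scale0r subrr !normr0 mulr0.
pose a := Num.sqrt `|k|; have a0 : 0 < a by rewrite sqrtr_gt0 normr_gt0.
have a2 : a ^+ 2 = `|k| by rewrite sqr_sqrtr.
have am : a <= m by rewrite -(ler_pXn2r (n := 2))// ?nnegrE ?(ltW a0) ?(ltW m0)// a2.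
have [sb sf] := sl a a0 (le_trans am mt).
have Ce : C * a <= e.
  apply: (@le_trans _ _ ((C + 1) * m)); last by rewrite mulrC -ler_pdivlMr.
  by apply: ler_pM => //; [exact: ltW|rewrite lerDl].
set xi := Hp H (g s) _; rewrite mulrC -ler_pdivrMl ?normr_gt0// -normfV -normrZ.
apply: le_trans Ce; have [kp|kn] := ltP 0 k.
  move: sf; rewrite /fwd_slope a2 (gtr0_norm kp) -/xi => sf.
  by rewrite scalerBr scalerA mulVf// scale1r.
have {}kn : k < 0 by rewrite lt_neqAle k0.
move: sb; rewrite /back_slope a2 (ltr0_norm kn) -/xi opprK invrN scaleNr -scalerN opprB => sb.
by rewrite scalerBr scalerA mulVf// scale1r.
Qed.

Lemma momentum_continuous g s : cal g -> s < 0 -> forall e, 0 < e ->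
  exists2 d, 0 < d & forall s', `|s' - s| <= d -> s' < 0 /\ `|momentum g s' - momentum g s| <= e.
Proof.
move=> cg s0 e e0; have s20 : s / 2 < 0 by lra.
(* A scale that fits at [s / 2] fits at every earlier time, so one [t] serves both [s] and [s']. *)
have [t [t0 t1 st]] := room s20.
have C10 : 0 < 6 * C + 1 by rewrite ltr_wpDl// mulr_ge0.
pose m := Num.min t (e / (6 * C + 1)).
have m0 : 0 < m by rewrite lt_min t0 divr_gt0.
have [mt me] : m <= t /\ m <= e / (6 * C + 1) by apply/andP; rewrite -le_min.
have L10 : 0 < 2 * (Lam + 1) by rewrite mulr_gt0// ltr_wpDl.
exists (Num.min (- s / 2) (m ^+ 3 / (2 * (Lam + 1)))).
  by rewrite lt_min !divr_gt0 ?exprn_gt0// oppr_gt0.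
move=> s'; rewrite le_min => /andP[d1 d2].
have s's : s' <= s / 2 by move: d1; rewrite ler_norml => /andP[_]; lra.
split; first by lra.
have [R1 _] : regular_at u t C (g s') (momentum g s') /\ _ := regular_momentum cg t0 t1 (le_trans (lerD s's (lexx _)) st).
have ss : s <= s / 2 by lra.
have [R2 _] : regular_at u t C (g s) (momentum g s) /\ _ := regular_momentum cg t0 t1 (le_trans (lerD ss (lexx _)) st).
apply: (@le_trans _ _ (6 * C * m)); last first.
  apply: (@le_trans _ _ ((6 * C + 1) * m)); first by rewrite ler_wpM2r ?(ltW m0)// lerDl.
  by rewrite mulrC -ler_pdivlMr.
apply: (regular_holder R1 R2 m0 mt).
have s'0 : s' <= 0 by lra.
apply: le_trans (cal_lipschitz cg s'0 (ltW s0)) _.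
move: d2; rewrite ler_pdivlMr// => d2; rewrite ler_pdivlMr//; apply: le_trans d2.
by have := normr_ge0 (s' - s); lra.
Qed.

(** The chord of [g] over a time [t ^+ 2], translated by [z], is a competitor from [g s + z] to
    [g (s + t ^+ 2) + z]. Against the calibrated lower bound for the chord itself only the change of
    [Lag] with its base point remains, and this is [- Hx] to first order: the momentum equation in
    one-sided, integrated form. *)
Lemma translated_step : exists2 E, 0 <= E & forall g, cal g ->
  forall s t z, 0 < t -> t <= 1 -> s + t ^+ 2 <= 0 -> `|z| <= 1 ->
  (u (g (s + t ^+ 2) + z) - u (g (s + t ^+ 2))) - (u (g s + z) - u (g s)) <=
  t ^+ 2 * (- dotv (Hx H (g s) (momentum g s)) z + E * (t + `|z| ^+ 2)).
Proof.
have ar1 (a1 a2 a3 a4 a5 a6 : R) : a1 - a2 + a3 <= a6 -> - a5 <= a3 - a4 ->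
  a1 - a2 <= - a4 + a5 + a6 by lra.
have ar2 (a1 a2 a3 a4 a5 a6 b1 b2 b3 d k : R) : a1 - a2 <= d * (b1 + k) + b2 ->
    d * (b3 + k) - a6 * a5 <= a3 - a4 -> b2 = b2 ->
    a1 - a3 - (a2 - a4) <= d * (b1 - b3) + (b2 + a6 * a5) by lra.
have ar3 (a1 a2 a3 a4 a5 a6 t : R) : 0 <= a4 * a2 -> 0 <= a5 * a2 -> 0 <= a3 * a2 -> 0 <= a6 * t ->
    - a1 + a4 * t + a6 * a2 + (a5 + a3) * t <= - a1 + (a4 + a5 + a6 + a3) * (t + a2) by lra.
have [C2 C20 dP] := dom Lam.
have [C3 C30 XP] := Lag_x_expansion HT Lam.
have [C4 C40 LP] := leg_lipschitz HT (Lam + C).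
have [C5 C50 rP] := leg_bounded HT (Lam + C).
have [D D0 DP] := H_bounds HT C5.
pose N : R := n%:R; have N0 : 0 <= N by rewrite /N.
exists (N * D * C4 * C + C2 + C3 + `|C1|).
  by rewrite !addr_ge0// !mulr_ge0.
move=> g cg s t z t0 t1 st z1.
have d0 : 0 < t ^+ 2 by rewrite exprn_gt0.
have sd : s < s + t ^+ 2 by rewrite ltrDl.
have sE : s + t ^+ 2 - s = t ^+ 2 by rewrite addrAC subrr add0r.
pose q := fwd_slope g s t; pose y := g (s + t ^+ 2).
have qL : `|q| <= Lam by have := slope_bound cg sd st; rewrite sE.
have q1 : `|q| <= Lam + 1 by apply: le_trans qL _; rewrite lerDl.
have qC : `|q| <= Lam + C by apply: le_trans qL _; rewrite lerDl.
have gE : y - g s = t ^+ 2 *: q by rewrite /q /fwd_slope scalerA divff ?scale1r ?gt_eqF.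
have [_ /(_ t t0 (lexx t))[_]] := regular_momentum cg t0 t1 st.
rewrite -/q; set P := momentum g s => qP.
have HpC : `|Hp H (g s) P| <= Lam + C.
  rewrite -[Hp _ _ _](subKr q); apply: le_trans (ler_normB _ _) _.
  by apply: lerD qL _; apply: le_trans qP _; rewrite ler_piMr.
have b1 := dP (g s + z) q _ qL (ltW d0).
have e1 : g s + z + t ^+ 2 *: q = y + z by rewrite -gE addrAC [g s + (y - g s)]addrC subrK.
rewrite e1 in b1.
have := cal_lower HT legr cg (ltW sd) st q1; rewrite sE -/y => /(_ gE) b2.
have b3 := XP (g s) (g s + z) q qL; rewrite [g s + z - _]addrAC subrr add0r in b3.
have b4 : `|leg H (g s) q - P| <= C4 * (C * t).
  have := LP (g s) (g s) q (Hp H (g s) P) qC HpC.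
  rewrite leg_Hp// subrr normr0 add0r => /le_trans; apply.
  by rewrite ler_wpM2l.
have PC5 : `|P| <= C5 by rewrite -(leg_Hp HT (g s) P); exact: rP.
have [_ _ b5 _] := DP (g s) (g s) _ P (rP (g s) q qC) PC5.
rewrite subrr normr0 add0r in b5.
have b6 := normr_dotv (Hx H (g s) (leg H (g s) q) - Hx H (g s) P) z; rewrite -/N in b6.
have b7 : N * `|Hx H (g s) (leg H (g s) q) - Hx H (g s) P| * `|z| <= N * D * C4 * C * t.
  have b51 := le_trans b5 (ler_wpM2l D0 b4).
  apply: (@le_trans _ _ (N * `|Hx H (g s) (leg H (g s) q) - Hx H (g s) P|)).
    exact: ler_piMr (mulr_ge0 N0 (normr_ge0 _)) z1.
  by apply: le_trans (ler_wpM2l N0 b51) _; rewrite !mulrA.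
have t2 : t ^+ 2 <= t by rewrite expr2 ler_piMl// ltW.
have z2 := sqr_ge0 `|z|.
have {b6 b7} : - (N * D * C4 * C * t) <= dotv (Hx H (g s) (leg H (g s) q)) z - dotv (Hx H (g s) P) z.
  by rewrite -dotvBl; have := le_trans b6 b7; rewrite ler_norml => /andP[].
move: b3; rewrite ler_norml => /andP[_ b3] b6.
have b8 : Lag H (g s + z) q - Lag H (g s) q <=
    - dotv (Hx H (g s) P) z + N * D * C4 * C * t + C3 * `|z| ^+ 2.
  exact: (ar1 _ _ _ _ _ _ b3 b6).
have b9 := ler_wpM2l (ltW d0) b8.
apply: (@le_trans _ _ (t ^+ 2 * (Lag H (g s + z) q - Lag H (g s) q) + (C2 + `|C1|) * (t ^+ 2) ^+ 2)).
  rewrite [(C2 + _) * _]mulrDl; exact: (ar2 _ _ _ _ _ _ _ _ _ _ _ b1 b2 erefl).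
have c1 : 0 <= N * D * C4 * C by rewrite !mulr_ge0.
have c2 : (C2 + `|C1|) * (t ^+ 2) ^+ 2 <= t ^+ 2 * ((C2 + `|C1|) * t).
  by rewrite expr2 mulrCA ler_wpM2l ?(ltW d0)// ler_wpM2l// addr_ge0.
apply: le_trans (lerD b9 c2) _; rewrite -mulrDr ler_wpM2l ?(ltW d0)//.
have c3 := mulr_ge0 c1 z2; have c4 := mulr_ge0 C20 z2.
have c5 := mulr_ge0 (normr_ge0 C1) z2; have c6 := mulr_ge0 C30 (ltW t0).
exact: (ar3 _ _ _ _ _ _ _ c3 c4 c5 c6).
Qed.

(** The one-sided estimate suffices because [z] ranges over a symmetric ball. The time [l] is cut
    into [M ^ 2] steps of duration [a ^+ 2], where [a = sqrt l / M]; [M] tends to infinity at fixed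
    [z], and only then does [z] shrink. *)
Lemma momentum_increment g s1 s2 w e : cal g -> s1 < s2 -> s2 < 0 -> 0 <= e ->
  (forall s, s1 <= s -> s <= s2 -> `|Hx H (g s) (momentum g s) - w| <= e) ->
  `|momentum g s2 - momentum g s1 + (s2 - s1) *: w| <= n%:R * e * (s2 - s1).
Proof.
move=> cg s12 s20 e0 Hw; have [E E0 EP] := translated_step.
have [t [t0 t1 st]] := room s20.
pose l := s2 - s1; have l0 : 0 < l by rewrite subr_gt0.
pose D s z := u (g s + z) - u (g s).
pose N : R := n%:R; have N0 : 0 <= N by rewrite /N.
have main z : `|z| <= 1 -> D s2 z - D s1 z <= l * (- dotv w z + N * e * `|z| + E * `|z| ^+ 2).
  move=> z1.
  have S M : (0 < M)%N -> Num.sqrt l / M%:R <= 1 -> Num.sqrt l / M%:R <= t ->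
     D s2 z - D s1 z <= l * (- dotv w z + N * e * `|z| + E * `|z| ^+ 2) + l * E * (Num.sqrt l / M%:R).
    move=> M0 a1 at_; have MR0 : 0 < M%:R :> R by rewrite ltr0n.
    set a := _ / _ in a1 at_ *; have a0 : 0 < a by rewrite divr_gt0// sqrtr_gt0.
    have aM : (M ^ 2)%:R * a ^+ 2 = l.
      rewrite /a expr_div_n sqr_sqrtr ?(ltW l0)// natrX mulrCA divff ?mulr1//.
      by rewrite expf_neq0// gt_eqF.
    pose B := - dotv w z + N * e * `|z| + E * (a + `|z| ^+ 2).
    have step j : (j <= M ^ 2)%N -> D (s1 + j%:R * a ^+ 2) z - D s1 z <= j%:R * a ^+ 2 * B.
      elim: j => [_|j IH jM]; first by rewrite !mul0r addr0 subrr.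
      have jR : j%:R * a ^+ 2 + a ^+ 2 <= l.
        by rewrite -aM -{2}[a ^+ 2]mul1r -mulrDl natr1 ler_wpM2r ?sqr_ge0// ler_nat.
      have j0 : 0 <= j%:R * a ^+ 2 by rewrite mulr_ge0// sqr_ge0.
      have a20 := sqr_ge0 a.
      set sj := s1 + j%:R * a ^+ 2.
      have sj1 : s1 + j.+1%:R * a ^+ 2 = sj + a ^+ 2 by rewrite -natr1 mulrDl mul1r addrA.
      have sl : sj + a ^+ 2 <= s2 by rewrite /sj -addrA -lerBrDl.
      have h1 := EP g cg sj a z a0 a1 (le_trans sl (ltW s20)) z1.
      have hw : `|Hx H (g sj) (momentum g sj) - w| <= e.
        by apply: Hw; [rewrite /sj lerDl|apply: le_trans sl; rewrite lerDl].
      have h2 := normr_dotv (Hx H (g sj) (momentum g sj) - w) z; rewrite -/N in h2.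
      have h3 : N * `|Hx H (g sj) (momentum g sj) - w| * `|z| <= N * e * `|z|.
        by rewrite ler_wpM2r// ler_wpM2l.
      have h4 : - dotv (Hx H (g sj) (momentum g sj)) z <= - dotv w z + N * e * `|z|.
        by move: h2; rewrite dotvBl ler_norml => /andP[]; lra.
      have h5 : a ^+ 2 * (- dotv (Hx H (g sj) (momentum g sj)) z + E * (a + `|z| ^+ 2)) <= a ^+ 2 * B.
        by rewrite ler_wpM2l// /B lerD2r.
      have := IH (ltnW jM); rewrite sj1 -natr1 mulrDl mul1r mulrDl -/sj.
      by move: h1 h5; rewrite /D; lra.
    have sl : s1 + l = s2 by rewrite /l addrC subrK.
    have := step _ (leqnn _); rewrite aM sl /B; lra.
  apply/ler_addgt0Pr => b b0; have lE : 0 <= l * E by rewrite mulr_ge0// ltW.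
  have lE1 : 0 < l * E + 1 by rewrite ltr_wpDl.
  pose m := Num.min (Num.min 1 t) (b / (l * E + 1)).
  have m0 : 0 < m by rewrite !lt_min ltr01 t0 divr_gt0.
  have [m1 mt mb] : [/\ m <= 1, m <= t & m <= b / (l * E + 1)].
    by apply/and3P; rewrite /m !ge_min !lexx !orbT.
  pose M := (Num.bound (Num.sqrt l / m)).+1.
  have Mm : Num.sqrt l / M%:R <= m.
    rewrite ler_pdivrMr ?ltr0n// mulrC -ler_pdivrMr//; apply/ltW.
    apply: lt_le_trans (archi_boundP _) _; first by rewrite divr_ge0 ?sqrtr_ge0// ltW.
    by rewrite ler_nat /M ltnW.
  apply: le_trans (S M isT (le_trans Mm m1) (le_trans Mm mt)) _; rewrite lerD2l.
  apply: (@le_trans _ _ (l * E * m)); first by rewrite ler_wpM2l.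
  move: mb; rewrite ler_pdivlMr// mulrC; apply: le_trans.
  by rewrite ler_wpM2r ?(ltW m0)// lerDl.
(* For [|z| <= a ^+ 3] the increments of [u] are linear up to [C * a ^+ 4], and [E * |z| ^+ 2] is no
   larger in order; dividing by [a ^+ 3] and letting [a] tend to 0 leaves the linear part. *)
apply: (@le_of_small R _ _ (l * E + 2 * C) t t0).
  by rewrite addr_ge0 ?mulr_ge0// ltW.
move=> a a0 at_; have a3 : 0 < a ^+ 3 by rewrite exprn_gt0.
have a1 := le_trans at_ t1.
apply: (rV_norm_le_dotv a3) => z za.
have a31 : a ^+ 3 <= a by rewrite exprS ler_piMr ?(ltW a0)// exprn_ile1// ltW.
have [[_ R2] _] := regular_momentum cg t0 t1 st.
have st1 : s1 + t ^+ 2 <= 0 by apply: le_trans st; rewrite lerD2r ltW.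
have [[_ R1] _] := regular_momentum cg t0 t1 st1.
have := R2 a z a0 at_ za; have := R1 a z a0 at_ za.
have := main z (le_trans za (le_trans a31 a1)); rewrite /D.
have h1 : N * e * `|z| <= N * e * a ^+ 3 by rewrite ler_wpM2l// mulr_ge0.
have h2 : E * `|z| ^+ 2 <= E * (a * a ^+ 3).
  by rewrite ler_wpM2l// expr2 ler_pM//; exact: le_trans a31.
have h3 : l * (N * e * `|z| + E * `|z| ^+ 2) <= l * (N * e * a ^+ 3 + E * (a * a ^+ 3)).
  by rewrite ler_wpM2l ?(ltW l0)// lerD.
rewrite !ler_norml dotvDl dotvBl dotvZl -/N -/l (_ : a ^+ 4 = a * a ^+ 3) ?exprS//.
by move=> b1 /andP[b2 b3] /andP[b4 b5]; lra.
Qed.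

Lemma momentum_derivable g s : cal g -> s < 0 ->
  derivable (momentum g) s 1 /\ derive1 (momentum g) s = - Hx H (g s) (momentum g s).
Proof.
move=> cg s0; apply/derive1_rVP => e e0.
pose N : R := n%:R; have N1 : 0 < N + 1 by rewrite ltr_wpDl// /N.
have eN : 0 < e / (N + 1) by rewrite divr_gt0.
have cont : exists2 d, 0 < d & forall s', `|s' - s| <= d -> s' < 0 /\
    `|Hx H (g s') (momentum g s') - Hx H (g s) (momentum g s)| <= e / (N + 1).
  have [D D0 DP] := H_bounds HT (`|momentum g s| + 1).
  have D1 : 0 < D * (Lam + 1) + 1 by rewrite ltr_wpDl// mulr_ge0// addr_ge0.
  pose b := Num.min 1 (e / (N + 1) / (D * (Lam + 1) + 1)).
  have b0 : 0 < b by rewrite lt_min ltr01 divr_gt0.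
  have [b1 be] : b <= 1 /\ b <= e / (N + 1) / (D * (Lam + 1) + 1) by apply/andP; rewrite -le_min.
  have [d d0 dP] := momentum_continuous cg s0 b0.
  exists (Num.min d b); first by rewrite lt_min d0.
  move=> s'; rewrite le_min => /andP[sd sb]; have [s'0 pp] := dP s' sd; split => //.
  have [||_ _ h1 _] := DP (g s') (g s) (momentum g s') (momentum g s).
  - rewrite -[momentum g s'](subrK (momentum g s)); apply: le_trans (ler_normD _ _) _.
    by rewrite addrC lerD2l; exact: le_trans b1.
  - by rewrite lerDl.
  apply: le_trans h1 _; have := cal_lipschitz cg (ltW s'0) (ltW s0) => h2.
  have h3 : Lam * `|s' - s| <= Lam * b by rewrite ler_wpM2l.
  apply: (@le_trans _ _ ((D * (Lam + 1) + 1) * b)); last by rewrite mulrC -ler_pdivlMr.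
  apply: (@le_trans _ _ (D * ((Lam + 1) * b))).
    by rewrite ler_wpM2l// mulrDl mul1r; apply: lerD => //; exact: le_trans h3.
  by rewrite mulrA ler_wpM2r ?(ltW b0)// lerDl.
have [d d0 dP] := cont; exists d => // k kd.
have Ne : N * (e / (N + 1)) <= e.
  by rewrite mulrCA ger_pMr// ler_pdivrMr// mul1r lerDl.
have [k0|k0|<-] := ltgtP 0 k; last by rewrite addr0 subrr scale0r subrr !normr0 mulr0.
- have sk : s + k < 0.
    have skd : `|s + k - s| <= d by rewrite [s + k - s]addrAC subrr add0r.
    exact: (proj1 (dP _ skd)).
  have := @momentum_increment g s (s + k) (Hx H (g s) (momentum g s)) _ cg _ sk (ltW eN) _.
  rewrite ltrDl k0 [s + k - s]addrAC subrr add0r -/N scalerN opprK (gtr0_norm k0) => /(_ isT) h1.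
  apply: le_trans (h1 _) _; last by rewrite ler_wpM2r// ltW.
  move=> s' ss' s'k; have [] := dP s' => //; rewrite ger0_norm ?subr_ge0//.
  by have := ler_norm k; lra.
- have := @momentum_increment g (s + k) s (Hx H (g s) (momentum g s)) _ cg _ s0 (ltW eN) _.
  rewrite gtrDl k0 opprD addrA subrr add0r -/N scalerN opprK scaleNr (ltr0_norm k0) => /(_ isT) h1.
  rewrite -normrN opprD opprB; apply: le_trans (h1 _) _; last by rewrite ler_wpM2r// oppr_ge0 ltW.
  move=> s' s'k ss'; have [] := dP s' => //; rewrite ler0_norm ?subr_le0// opprB.
  by have := ler_norm (- k); rewrite normrN; lra.
Qed.

End hamilton_flow.

(** * Existence of minimizing curves *)

Section ultrafilter_limits.
Context {R : realType} {n : nat}.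

Lemma nat_ultrafilter : exists U : set_system nat, UltraFilter U /\ \oo `<=` U.
Proof. exact: ultraFilterLemma. Qed.

Lemma ultra_limit (U : set_system nat) (a : nat -> 'rV[R]_n) M : UltraFilter U ->
  (forall k, `|a k| <= M) -> exists P, forall e, 0 < e -> U [set k | `|a k - P| < e].
Proof.
move=> UU aM; have [|P [PM Pc]] := @rV_compact_ball R n M (a @ U) _.
  by change (U [set k | `|a k| <= M]); apply: filterS filterT => k _; exact: aM.
exists P => e e0; have [//|UC] := in_ultra_setVsetC [set k | `|a k - P| < e] UU.
have [||z [[k Uk <-] /= ke]] := Pc (a @` ~` [set k | `|a k - P| < e]) [set z | `|P - z| < e].
- change (U [set k | (a @` ~` [set k | `|a k - P| < e]) (a k)]).
  by apply: filterS UC => k Uk; exists k.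
- exact: near_norm.
- by case: Uk => /=; rewrite distrC.
Qed.

End ultrafilter_limits.

(** * Limits of chains of nearly minimizing steps *)

Section calibrated_existence.
Context {R : realType} {n : nat}.
Variables (H : 'rV[R]_n -> 'rV[R]_n -> R) (c : 'rV[R]_n) (h : R) (v : 'rV[R]_n -> R).
Hypothesis HT : Tonelli_Hamiltonian H.
Local Notation u := (tilt c v).
Implicit Types (x y z p q xi : 'rV[R]_n) (g : R -> 'rV[R]_n).

Section chain.
Variables (X : nat -> 'rV[R]_n) (t L E r : R).
Hypothesis t0 : 0 <= t.
Hypothesis L0 : 0 <= L.
Hypothesis XL : forall j, `|X j - X j.+1| <= L * t.
Hypothesis XE : forall j p, `|p| <= r ->
  dotv p (X j - X j.+1) - t * (H (X j.+1) p - h) - E * t ^+ 2 <= u (X j) - u (X j.+1).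

Lemma chain_lipschitz i m : `|X i - X (i + m)%N| <= L * t * m%:R.
Proof.
elim: m => [|m IH]; first by rewrite addn0 subrr normr0 mulr0.
rewrite addnS -(subrKA (X (i + m)%N)); apply: le_trans (ler_normD _ _) _.
by rewrite -natr1 mulrDr mulr1 lerD.
Qed.

(** Indices run backwards in time, so [X (i + m)] is the initial point. The step inequalities are
    summed with [H] moved to that point, at distance at most [L * t * m]; hence the term
    [D * L * (t * m) ^+ 2]. *)
Lemma chain_calibrated D i m p : 0 <= D -> `|p| <= r ->
  (forall y z, `|H y p - H z p| <= D * `|y - z|) ->
  dotv p (X i - X (i + m)%N) - t * m%:R * (H (X (i + m)%N) p - h)
    - D * L * (t * m%:R) ^+ 2 - E * t * (t * m%:R) <= u (X i) - u (X (i + m)%N).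
Proof.
move=> D0 pr HD; set y := X (i + m)%N.
suff W k : (k <= m)%N ->
    dotv p (X i - X (i + k)%N) - t * k%:R * (H y p - h + D * (L * t * m%:R)) - E * t * (t * k%:R)
      <= u (X i) - u (X (i + k)%N).
  by apply: le_trans (W m (leqnn m)); rewrite -/y le_eqVlt; apply/orP; left; apply/eqP; ring.
elim: k => [|k IH] km.
  by rewrite addn0 !subrr dotv0r !(mulr0, mul0r, subr0).
have := IH (ltnW km); have := XE (i + k) pr; rewrite addnS.
have := HD (X (i + k).+1) y => Hk.
have : `|X (i + k).+1 - y| <= L * t * m%:R.
  have -> : y = X ((i + k).+1 + (m - k.+1))%N by rewrite -addnS -addnA subnKC.
  apply: le_trans (chain_lipschitz _ _) _; rewrite ler_wpM2l ?mulr_ge0// ler_nat.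
  by rewrite leq_subr.
move=> /(ler_wpM2l D0)/(le_trans Hk); rewrite ler_norml => /andP[_].
move=> /(ler_wpM2l t0); rewrite !dotvBr -natr1; set m' := m%:R; set k' := k%:R.
by nra.
Qed.

End chain.

(** [Ak], [Hk], [thk] and [Uk] belong to an approximating curve with time step [tk], their
    counterparts to the limit, and [e] controls every difference. What counts is that the
    coefficient of [e] in the conclusion does not depend on the approximating curve. *)
Lemma polygon_limit_arith (A Ak H0 Hk th thk tk U Uk D L E M Ku N e : R) :
  0 < e -> e <= 1 -> 0 <= D -> 0 <= L -> 0 <= E -> 0 <= M -> 0 <= th -> 0 <= thk ->
  0 <= tk -> tk <= e -> `|th - thk| <= e -> `|A - Ak| <= N * e -> `|H0 - Hk| <= D * e ->
  `|Hk| <= M -> `|U - Uk| <= Ku * e ->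
  Ak - thk * Hk - D * L * thk ^+ 2 - E * tk * thk <= Uk ->
  A - th * H0 - D * L * th ^+ 2
    <= U + (N + M + th * D + D * L * (2 * th + 1) + E * (th + 1) + Ku) * e.
Proof.
move=> e0 e1 D0 L0 E0 M0 th0 thk0 tk0 tke.
rewrite ler_norml => /andP[a1 a2]; rewrite ler_norml => /andP[_ b2].
rewrite ler_norml => /andP[c1 _]; rewrite ler_norml => /andP[d1 d2].
rewrite ler_norml => /andP[f1 _] I.
have h1 : (thk - th) * Hk <= M * e.
  apply: le_trans (ler_norm _) _; rewrite normrM mulrC.
  by apply: ler_pM => //; rewrite ?normr_ge0// ler_norml; lra.
have h2 : th * (Hk - H0) <= th * D * e by rewrite -mulrA ler_wpM2l//; lra.
have DL : 0 <= D * L by exact: mulr_ge0.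
have h3 : D * L * (thk ^+ 2 - th ^+ 2) <= D * L * (2 * th + 1) * e.
  rewrite -[leRHS]mulrA ler_wpM2l// subr_sqr; apply: (@le_trans _ _ (e * (thk + th))).
    by rewrite ler_wpM2r ?addr_ge0//; lra.
  by rewrite mulrC ler_wpM2r ?(ltW e0)//; lra.
have h4 : E * tk * thk <= E * (th + 1) * e.
  by rewrite -!mulrA ler_wpM2l// [tk * _]mulrC; apply: ler_pM => //; lra.
by lra.
Qed.

Section polygons.
Variables (Lam C r Ku : R).
Hypothesis Lam0 : 0 <= Lam.
Hypothesis C0 : 0 <= C.
Hypothesis Ku0 : 0 <= Ku.
Hypothesis uK : forall x y, `|u x - u y| <= Ku * `|x - y|.
Hypothesis near_step : forall x (t : R), 0 < t -> exists y, `|x - y| <= Lam * t + t ^+ 2 /\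
   forall p, `|p| <= r ->
   dotv p (x - y) - t * (H y p - h) - C * t * (Lam * t + t ^+ 2) <= u x - u y + t ^+ 2.
Local Notation L := (Lam + 1).
Local Notation E := (C * L + 1).

(** For [t <= 1] the displacement [Lam * t + t ^+ 2] is at most [L * t], and the defect [t ^+ 2]
    accounts for the [+ 1] in [E]. *)
Lemma near_chain x (t : R) : 0 < t -> t <= 1 -> exists X : nat -> 'rV[R]_n,
  [/\ X 0%N = x, forall j, `|X j - X j.+1| <= L * t &
   forall j p, `|p| <= r ->
  dotv p (X j - X j.+1) - t * (H (X j.+1) p - h) - E * t ^+ 2 <= u (X j) - u (X j.+1)].
Proof.
move=> t0 t1; have [f fP] := choice (fun x => near_step x t0).
have tt : t ^+ 2 <= t by rewrite expr2 ler_piMl// ltW.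
exists (fun j => iter j f x); split=> // j /=; have [f1 f2] := fP (iter j f x).
  by apply: le_trans f1 _; rewrite mulrDl mul1r lerD2l.
move=> p pr; apply: (@le_trans _ _ (dotv p (iter j f x - f (iter j f x)) -
   t * (H (f (iter j f x)) p - h) - C * t * (Lam * t + t ^+ 2) - t ^+ 2)).
  have : C * t * (Lam * t + t ^+ 2) <= C * t * (L * t).
    by rewrite ler_wpM2l ?mulr_ge0 ?(ltW t0)//; lra.
  by rewrite expr2; lra.
by rewrite lerBlDr; exact: f2.
Qed.

(** Interpolation is constant between nodes: only endpoints of time intervals matter, with [b - a]
    rounded to a multiple [m] of [t]. As [t] tends to 0 the term [E * t * m] disappears and
    [D * L * m ^+ 2] becomes the calibration error of the limit. *)
Lemma near_polygon x (t : R) : 0 < t -> t <= 1 -> exists G : R -> 'rV[R]_n,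
  [/\ G 0 = x, forall s, `|G s - x| <= L * `|s| &
   forall a b, a <= b -> b <= 0 -> exists m, [/\ 0 <= m, `|b - a - m| <= t,
     `|G b - G a| <= L * m &
     forall D p, 0 <= D -> `|p| <= r -> (forall y z, `|H y p - H z p| <= D * `|y - z|) ->
      dotv p (G b - G a) - m * (H (G a) p - h) - D * L * m ^+ 2 - E * t * m
        <= u (G b) - u (G a)]].
Proof.
move=> t0 t1; have [X [X0 XL XE]] := near_chain x t0 t1.
have L0 : 0 <= L by rewrite addr_ge0.
pose k s := Num.truncn (- s / t).
have kle s : s <= 0 -> t * (k s)%:R <= - s /\ - s < t * (k s)%:R + t.
  move=> s0; have : 0 <= - s / t by rewrite divr_ge0 ?oppr_ge0// ltW.
  move=> /truncn_itv/andP[]; rewrite ler_pdivlMr// ltr_pdivrMr// -natr1 -/(k s).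
  by rewrite mulrDl mul1r mulrC; split.
exists (X \o k); split=> /=.
- by rewrite /k oppr0 mul0r truncn0.
- move=> s; rewrite -X0 distrC; have := chain_lipschitz XL 0 (k s).
  rewrite add0n => /le_trans; apply; rewrite -mulrA ler_wpM2l//.
  have [s0|s0] := leP s 0.
    by rewrite ler0_norm//; have [] := kle s s0.
  rewrite /k; suff -> : Num.truncn (- s / t) = 0%N by rewrite mulr0.
  apply/eqP; rewrite -leqn0 truncn_le_nat; apply: (@lt_trans _ _ 0) => //.
  by rewrite mulNr oppr_lt0 divr_gt0.
move=> a b ab b0; have [ka1 ka2] := kle a (le_trans ab b0); have [kb1 kb2] := kle b b0.
have kk : (k b <= k a)%N.
  by apply: le_truncn; rewrite ler_pM2r ?invr_gt0// lerN2.
have mE : t * (k a - k b)%:R = t * (k a)%:R - t * (k b)%:R.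
  by rewrite natrB// mulrBr.
exists (t * (k a - k b)%:R); split.
- by rewrite mulr_ge0// ltW.
- by rewrite mE ler_norml; lra.
- have := chain_lipschitz XL (k b) (k a - k b); rewrite subnKC//.
  by rewrite mulrA.
move=> D p D0 pr HD.
by have := chain_calibrated (ltW t0) L0 XL XE (k b) (k a - k b) D0 pr HD; rewrite subnKC.
Qed.

(* The time steps are [1 / (k + 1)]; the limit along one ultrafilter exists for all
   times at once, so that no diagonal extraction is needed. *)
Lemma calibrated_exists : exists2 C2, 0 <= C2 & forall x, exists g,
  g 0 = x /\ calibrated H c h v L r C2 g.
Proof.
have [D D0 DP] := H_bounds HT r.
have L0 : 0 <= L by rewrite addr_ge0.
exists (D * L); first exact: mulr_ge0.
move=> x; pose t k : R := k.+1%:R^-1.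
have t0 k : 0 < t k by rewrite invr_gt0.
have t1 k : t k <= 1 by rewrite invf_le1// ler1n.
have [G GP] := choice (fun k => near_polygon x (t0 k) (t1 k)).
have [U [UU Uoo]] := nat_ultrafilter.
have bG s k : `|G k s| <= `|x| + L * `|s|.
  have [_ Gs _] := GP k; rewrite -[G k s](subrK x) addrC.
  by apply: le_trans (ler_normD _ _) _; rewrite lerD2l.
have [g gP] := choice (fun s => ultra_limit UU (bG s)).
have near e a b : 0 < e -> exists k, [/\ `|G k a - g a| < e, `|G k b - g b| < e & t k <= e].
  move=> e0; have Ut : U [set k | t k <= e].
    apply: Uoo; exists (Num.bound e^-1) => // k /= Nk.
    rewrite -[e]invrK lef_pV2 ?posrE ?invr_gt0//; apply: ltW.
    apply: lt_le_trans (archi_boundP _) _; first by rewrite invr_ge0 ltW.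
    by rewrite ler_nat ltnW.
  have [k [[k1 k2] k3]] := filter_ex (filterI (filterI (gP a e e0) (gP b e e0)) Ut).
  by exists k.
have g0 : g 0 = x.
  apply/eqP; rewrite -subr_eq0 -normr_le0; apply/ler_addgt0Pr => e e0.
  have [k [k1 _ _]] := near e 0 0 e0; have [Gk _ _] := GP k.
  by rewrite add0r distrC -Gk ltW.
exists g; split=> // a b ab b0; have ba0 : 0 <= b - a by rewrite subr_ge0.
have diff k e : `|G k a - g a| < e -> `|G k b - g b| < e ->
    `|(g b - g a) - (G k b - G k a)| <= 2 * e.
  move=> k1 k2; have -> : (g b - g a) - (G k b - G k a) = (G k a - g a) - (G k b - g b).
    by apply/rowP => i; rewrite !mxE; ring.
  by apply: le_trans (ler_normB _ _) _; lra.
split.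
  apply: (@le_of_small _ _ _ (2 + L) 1) => // [|e e0 e1]; first by rewrite addr_ge0.
  have [k [k1 k2 k3]] := near e a b e0; have [_ _ /(_ a b ab b0)[m [m0 mt Gm _]]] := GP k.
  have := diff k e k1 k2; rewrite -[g b - g a](subrK (G k b - G k a)) => d.
  apply: le_trans (ler_normD _ _) _; rewrite subrK in d *.
  have : L * m <= L * (b - a + e).
    by rewrite ler_wpM2l//; move: mt; rewrite ler_norml; lra.
  by lra.
move=> p pr; pose M := D + `|h|; pose N := n%:R * `|p| * 2.
have HD y z : `|H y p - H z p| <= D * `|y - z|.
  by have [+ _ _ _] := DP y z p p pr pr; rewrite subrr normr0 addr0.
apply: (@le_of_small _ _ _ (N + M + (b - a) * D + D * L * (2 * (b - a) + 1) +
   E * (b - a + 1) + Ku * 2) 1) => //.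
  by rewrite !addr_ge0// !mulr_ge0// addr_ge0// ?mulr_ge0.
move=> e e0 e1; have [k [k1 k2 k3]] := near e a b e0.
have [_ _ /(_ a b ab b0)[m [m0 mt Gm GE]]] := GP k.
have {}GE := GE D p D0 pr HD.
apply: (polygon_limit_arith (Ak := dotv p (G k b - G k a)) (Hk := H (G k a) p - h)
  (thk := m) (tk := t k) (Uk := u (G k b) - u (G k a))) => //.
- by rewrite addr_ge0// mulr_ge0.
- by rewrite addr_ge0.
- exact: ltW.
- exact: le_trans mt k3.
- rewrite -dotvBr; apply: le_trans (normr_dotv _ _) _; rewrite /N -[leRHS]mulrA ler_wpM2l ?mulr_ge0//.
  exact: diff.
- rewrite opprB addrA subrK; apply: le_trans (HD _ _) _.
  by rewrite ler_wpM2l// distrC ltW.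
- by have [_ _ _ [H1 _ _]] := DP (G k a) (G k a) p p pr pr; exact: le_trans (ler_normB _ _) (lerD H1 (lexx _)).
have -> : u (g b) - u (g a) - (u (G k b) - u (G k a)) = (u (g b) - u (G k b)) - (u (g a) - u (G k a)) by ring.
apply: le_trans (ler_normB _ _) _; rewrite -mulrA.
have := uK (g b) (G k b); have := uK (g a) (G k a).
rewrite [`|g b - _|]distrC [`|g a - _|]distrC.
have := ler_wpM2l Ku0 (ltW k1); have := ler_wpM2l Ku0 (ltW k2); lra.
Qed.

End polygons.

End calibrated_existence.

Lemma frechet_tilt (R : realType) (n : nat) (c : 'rV[R]_n) v x p :
  frechet (tilt c v) x p -> frechet v x (p - c).
Proof.
move=> fp e e0; have [d d0 P] := fp e e0; exists d => // z zd.
apply: le_trans (P z zd); rewrite le_eqVlt; apply/orP; left; apply/eqP; congr `|_|.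
by rewrite /tilt dotvBl dotvDr; ring.
Qed.

Lemma dotvB_split (R : realType) (m : nat) (a b x y : 'rV[R]_m) :
  dotv a x - dotv b y = - (dotv (b - a) y + dotv a (y - x)).
Proof. by rewrite dotvBl dotvBr; ring. Qed.

(** * From calibrated to minimizing curves *)

Section minimality.
Context {R : realType} {n : nat}.
Local Notation mu := (@lebesgue_measure R).
Variables (H : 'rV[R]_n -> 'rV[R]_n -> R) (c : 'rV[R]_n) (h : R) (v : 'rV[R]_n -> R).
Hypothesis HT : Tonelli_Hamiltonian H.
Local Notation u := (tilt c v).
Implicit Types (x y z p q xi : 'rV[R]_n) (g : R -> 'rV[R]_n).
Variables (Lam r C1 : R).
Hypothesis Lam0 : 0 <= Lam.
Hypothesis C10 : 0 <= C1.
Hypothesis legr : forall x xi, `|xi| <= Lam + 1 -> `|leg H x xi| <= r.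
Let cal := calibrated H c h v Lam r C1.
Variable C : R.
Hypothesis C0 : 0 <= C.
Hypothesis CP : forall g, cal g -> forall s t, 0 < t -> t <= 1 -> s + t ^+ 2 <= 0 -> exists P,
    regular_at u t C (g s) P /\
    forall t', 0 < t' -> t' <= t ->
      `|back_slope g s t' - Hp H (g s) P| <= C * t' /\
      `|fwd_slope g s t' - Hp H (g s) P| <= C * t'.
Local Notation mom := (momentum c v).

Lemma frechet_momentum g s : cal g -> s < 0 -> frechet u (g s) (mom g s).
Proof.
move=> cg s0; have [t [t0 t1 st]] := room s0.
by have [+ _] := regular_momentum CP cg t0 t1 st; exact: regular_frechet.
Qed.

Lemma cal_speed g s : cal g -> s < 0 -> `|derive1 g s| <= Lam.
Proof.
move=> cg s0; have [dg _] := cal_derivable C0 CP cg s0.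
have /derive1_rVP H1 : derivable g s 1 /\ derive1 g s = derive1 g s by split.
apply/ler_addgt0Pr => e e0; have [d d0 dP] := H1 e e0.
pose k := Num.min d (- s); have k0 : 0 < k by rewrite lt_min d0 oppr_gt0.
have kd : k <= d by rewrite ge_min lexx.
have ks : s + k <= 0.
  have : k <= - s by rewrite ge_min lexx orbT.
  by lra.
have := dP k; rewrite gtr0_norm// => /(_ kd) A.
have := cal_lipschitz cg ks (ltW s0); rewrite [s + k - s]addrAC subrr add0r gtr0_norm// => B.
rewrite -(ler_pM2l k0) mulrDr -[X in X * `|_|](gtr0_norm k0) -normrZ.
rewrite -[X in `|X|](subKr (g (s + k) - g s)).
apply: le_trans (ler_normB _ _) _; rewrite mulrC mulrC in A *.
by rewrite [k * Lam]mulrC; apply: lerD.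
Qed.

Lemma momentum_leg g s : cal g -> s < 0 -> leg H (g s) (derive1 g s) = mom g s.
Proof. by move=> cg s0; have [_ ->] := cal_derivable C0 CP cg s0; exact: leg_Hp. Qed.

Lemma momentum_bounded g s : cal g -> s < 0 -> `|mom g s| <= r.
Proof.
move=> cg s0; rewrite -momentum_leg//; apply: legr.
by apply: le_trans (cal_speed cg s0) _; rewrite lerDl.
Qed.

(** Calibration is tested with the momentum itself, over a time [d] so short that the curve moves by
    at most [m ^+ 3]. The linear terms cancel against the expansion of [u], whose error [C * m ^+ 4]
    equals [d * (C * (Lam + 1) * m)]; it remains to divide by [d] and let [m] tend to 0. *)
Lemma energy_lower g s : cal g -> s < 0 -> h <= H (g s) (mom g s).
Proof.
move=> cg s0; have [t [t0 t1 st]] := room s0.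
have [[_ reg] _] := regular_momentum CP cg t0 t1 st.
have L1 : 0 < Lam + 1 by rewrite ltr_wpDl.
apply: (@le_of_small _ _ _ (C1 + C * (Lam + 1)) t) => // [|m m0 mt].
  by rewrite addr_ge0// mulr_ge0// ltW.
pose d := m ^+ 3 / (Lam + 1).
have d0 : 0 < d by rewrite divr_gt0// exprn_gt0.
have dm3 : (Lam + 1) * d = m ^+ 3 by rewrite mulrC divfK// gt_eqF.
have m1 : m <= 1 by exact: le_trans mt t1.
have m32 : m ^+ 3 <= m ^+ 2 by rewrite exprS ler_piMl// exprn_ge0// ltW.
have m21 : m ^+ 2 <= m by rewrite expr2 ler_piMl// ltW.
have d3 : d <= m ^+ 3 by rewrite -dm3 ler_peMl ?(ltW d0)// lerDr.
have mt2 : m ^+ 2 <= t ^+ 2 by rewrite lerXn2r ?nnegrE ?(ltW m0) ?(ltW t0).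
have sd : s + d <= 0 by lra.
have sd' : s <= s + d by lra.
have [lip cl] := cg s (s + d) sd' sd.
have sds : s + d - s = d by ring.
rewrite sds in lip cl; have := cl _ (momentum_bounded cg s0).
have zd : `|g (s + d) - g s| <= m ^+ 3.
  by apply: le_trans lip _; rewrite -dm3 ler_wpM2r ?(ltW d0)// lerDl.
have := reg m _ m0 mt zd; rewrite [g s + _]addrC subrK ler_norml => /andP[_ A] B.
have m4 : C * m ^+ 4 = d * (C * (Lam + 1) * m) by rewrite [m ^+ 4]exprSr -dm3; ring.
have : d * (h - H (g s) (mom g s) - C1 * d - C * (Lam + 1) * m) <= 0.
  by move: A B; rewrite m4 expr2; lra.
rewrite pmulr_rle0// => D; have : C1 * d <= C1 * m by rewrite ler_wpM2l//; lra.
by move: D; lra.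
Qed.

(** Fenchel's inequality is an equality at the momentum, and [energy_lower] has the right sign. The
    right side is the derivative of [v] along [g]. *)
Lemma integrand_upper g s : cal g -> s < 0 ->
  integrand H c h g s <= dotv (mom g s - c) (derive1 g s).
Proof.
move=> cg s0; rewrite /integrand Lag_leg// momentum_leg// dotvBl.
by rewrite [dotv (mom g s) _]dotvC; have := energy_lower cg s0; lra.
Qed.

Lemma solution_derive g (s : R) : cal g -> s < 0 ->
  is_derive s 1 (v \o g) (dotv (mom g s - c) (derive1 g s)).
Proof.
move=> cg s0; have [dg _] := cal_derivable C0 CP cg s0.
by apply: frechet_comp => //; apply: frechet_tilt; exact: frechet_momentum.
Qed.

Lemma solution_derive_continuous g (s : R) : cal g -> s < 0 ->
  {for s, continuous (fun s => dotv (mom g s - c) (derive1 g s))}.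
Proof.
move=> cg s0; have [D D0 DP] := H_bounds HT r.
have r0 : 0 <= r by apply: le_trans (momentum_bounded cg s0).
pose N : R := n%:R; have N0 : 0 <= N by rewrite /N.
pose K := N * Lam + N * (r + `|c|) * (D * (Lam + 1)).
have K0 : 0 <= K by rewrite addr_ge0// !mulr_ge0// ?addr_ge0.
have K1 : 0 < K + 1 by rewrite ltr_wpDl.
apply/cvgrPdist_le => e e0; have e1 : 0 < e / (K + 1) by rewrite divr_gt0.
have [d d0 dP] := momentum_continuous Lam0 C0 CP cg s0 e1.
apply/nbhs_ballP; exists (Num.min d (e / (K + 1))); first by rewrite /= lt_min d0 e1.
move=> s'; rewrite /ball/= distrC lt_min => /andP[/ltW s'd /ltW s'e].
have [s'0 mm] := dP s' s'd.
have [_ E] := cal_derivable C0 CP cg s0; have [_ E'] := cal_derivable C0 CP cg s'0.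
have ww : `|derive1 g s' - derive1 g s| <= D * (Lam + 1) * (e / (K + 1)).
  rewrite E E'; have [_ + _ _] := DP (g s') (g s) _ _ (momentum_bounded cg s'0) (momentum_bounded cg s0).
  move=> /le_trans; apply; rewrite -mulrA ler_wpM2l// mulrDl mul1r lerD//.
  apply: le_trans (cal_lipschitz cg (ltW s'0) (ltW s0)) _.
  by rewrite ler_wpM2l.
rewrite dotvB_split; have -> : mom g s' - c - (mom g s - c) = mom g s' - mom g s.
  by rewrite opprB addrA subrK.
rewrite normrN; apply: le_trans (ler_normD _ _) _.
have h1 : `|dotv (mom g s' - mom g s) (derive1 g s')| <= N * Lam * (e / (K + 1)).
  apply: le_trans (normr_dotv _ _) _; rewrite mulrAC; apply: ler_pM => //.
  by rewrite ler_wpM2l// cal_speed.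
have h2 : `|dotv (mom g s - c) (derive1 g s' - derive1 g s)| <=
    N * (r + `|c|) * (D * (Lam + 1)) * (e / (K + 1)).
  apply: le_trans (normr_dotv _ _) _; rewrite -[leRHS]mulrA; apply: ler_pM => //.
  rewrite ler_wpM2l//; apply: le_trans (ler_normB _ _) _.
  by rewrite lerD2r momentum_bounded.
apply: le_trans (lerD h1 h2) _; rewrite -mulrDl -/K mulrCA ler_piMr// ?(ltW e0)//.
by rewrite ler_pdivrMr// mul1r lerDl.
Qed.

Variable K : R.
Hypothesis K0 : 0 <= K.
Hypothesis vK : forall x y, `|v x - v y| <= K * `|x - y|.
Hypothesis rep : representation_formula H c h v.

Lemma action_before g a b : cal g -> a < b -> b < 0 ->
  (\int[mu]_(s in `[a, b]) (integrand H c h g s)%:E <= (v (g b) - v (g a))%:E)%E.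
Proof.
move=> cg ab b0.
have neg s : s <= b -> s < 0 by move=> sb; exact: le_lt_trans sb b0.
have cont (s : R) : s < 0 -> (v \o g) @ s --> (v \o g) s.
  move=> s0; have [dv _] := solution_derive cg s0.
  by apply: differentiable_continuous; apply/derivable1_diffP.
have -> : (v (g b) - v (g a))%:E =
    (\int[mu]_(s in `[a, b]) (dotv (mom g s - c) (derive1 g s))%:E)%E.
  rewrite (@continuous_FTC2 _ _ (v \o g)) ?EFinB//.
  - apply: continuous_in_subspaceT => s /[!inE]/=; rewrite in_itv/= => /andP[_ /neg s0].
    exact: solution_derive_continuous.
  - split.
    + by move=> s; rewrite in_itv/= => /andP[_ /ltW/neg s0]; have [] := solution_derive cg s0.
    + by apply: cvg_at_right_filter; apply: cont; exact: neg (ltW ab).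
    + by apply: cvg_at_left_filter; exact: cont.
  - move=> s; rewrite in_itv/= => /andP[_ /ltW/neg s0].
    by rewrite derive1E; have [_] := solution_derive cg s0.
apply: le_integral_nomeas => s; rewrite /= in_itv/= => /andP[_ /neg s0].
by rewrite lee_fin integrand_upper.
Qed.

(** Up to time [- e] the action is at most the increment of [v], by integrating [integrand_upper];
    the last piece costs a multiple of [e]. Stopping short of 0 is forced, since differentiability
    of [g] is known at negative times only. *)
Lemma calibrated_minimizing g : cal g -> minimizing_curve_for H c h v (g 0) g.
Proof.
move=> cg; split=> // T T0.
have acg : abs_cont_on g (- T) 0.
  by apply: (lipschitz_abs_cont_on Lam0) => a b _ ab b0; have [] := cg a b ab b0.
have adm : admissible T (g 0) g by split.
split=> //; apply/eqP; rewrite eq_le; apply/andP; split.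
  by rewrite (rep (g 0) T0); apply: ereal_inf_lbound; exists g.
have [B BP] := integrand_lower c h HT.
have r0 : 0 <= r by apply: le_trans (momentum_bounded cg (ltrN10 R)).
(* The maximum takes care of the time 0, where the value of [derive1 g] is unknown. *)
pose M := Num.max (integrand H c h g 0) (n%:R * (r + `|c|) * Lam).
have M0 : 0 <= M by rewrite le_max; apply/orP; right; rewrite !mulr_ge0// addr_ge0.
have IM s : s <= 0 -> integrand H c h g s <= M.
  rewrite le_eqVlt => /predU1P[->|s0]; first by rewrite le_max lexx.
  rewrite le_max; apply/orP; right; apply: le_trans (integrand_upper cg s0) _.
  apply: le_trans (dotv_le _ _) _; apply: ler_pM => //.
    rewrite ler_wpM2l//; apply: le_trans (ler_normB _ _) _.
    by rewrite lerD2r momentum_bounded.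
  exact: cal_speed.
have bound e : 0 < e -> e < T ->
    (action H c h T g <= (v (g 0) - v (g (- T)) + (K * Lam + M) * e)%:E)%E.
  move=> e0 eT; have eT' : - T < - e by rewrite ltrN2.
  have e0' : - e < 0 by rewrite oppr_lt0.
  rewrite actionE (@integral_itv_split _ _ B _ (- e) _ (ltW eT') (ltW e0'))//.
  apply: (@le_trans _ _ ((v (g (- e)) - v (g (- T)))%:E + (M * e)%:E)%E).
    apply: leeD; first exact: action_before.
    apply: (@le_trans _ _ (\int[mu]_(s in `[(- e)%R, 0%R]) M%:E)%E).
      by apply: le_integral_nomeas => s; rewrite /= in_itv/= lee_fin => /andP[_ /IM].
    rewrite integral_cst//= lebesgue_measure_itv/= lte_fin e0'.
    by rewrite -EFinB opprK add0r -EFinM.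
  rewrite -EFinD lee_fin.
  have := vK (g (- e)) (g 0); have := cal_lipschitz cg (ltW e0') (lexx 0).
  rewrite subr0 normrN (gtr0_norm e0) => /(ler_wpM2l K0) A.
  by move=> /le_trans/(_ A); rewrite ler_norml => /andP[_]; lra.
have T20 : 0 < T / 2 by rewrite divr_gt0.
have T2T : T / 2 < T by lra.
have afin : action H c h T g \is a fin_num.
  rewrite fin_numElt; apply/andP; split; last exact: le_lt_trans (bound _ T20 T2T) (ltry _).
  apply: (@lt_le_trans _ _ ((- B * T)%:E)); first exact: ltNyr.
  rewrite actionE (_ : (- B * T)%:E = \int[mu]_(s in `[(- T)%R, 0%R]) (- B)%:E)%E; last first.
    rewrite integral_cst//= lebesgue_measure_itv/= lte_fin oppr_lt0 T0.
    by rewrite -EFinB opprK add0r -EFinM.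
  by apply: le_integral_nomeas => s _; rewrite lee_fin.
move: bound; rewrite -(fineK afin) -EFinD => bound; rewrite lee_fin.
apply: (@le_of_small _ _ _ (K * Lam + M) (T / 2)) => // [|e e0 eT].
  by rewrite addr_ge0// mulr_ge0.
have := bound e e0 (le_lt_trans eT T2T); rewrite lee_fin; lra.
Qed.

End minimality.

(** * Limits of minimizing curves at minus infinity *)

Section gronwall.
Context {R : realType}.

(** [E] times [expR (- k * s)] is nonincreasing and [E] times [expR (k * s)] is nondecreasing. Both
    conclusions are used, as solutions are followed to positive and to negative times. *)
Lemma gronwall (E E' : R -> R) (k a b : R) : a <= b ->
  (forall s, a <= s <= b -> is_derive s 1 E (E' s) /\ `|E' s| <= k * E s) ->
  E b <= expR (k * (b - a)) * E a /\ E a <= expR (k * (b - a)) * E b.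
Proof.
move=> ab dE.
have dF (m s : R) : a <= s <= b -> is_derive s 1 (E * (fun t => expR (m * t))) ((E' s + m * E s) * expR (m * s)).
  move=> /dE[ds _].
  have dm : is_derive s 1 (fun t : R => m * t) m.
    by apply: is_derive_eq; rewrite [LHS]mulr1.
  have de : is_derive s 1 (expR \o (fun t => m * t)) (expR (m * s) * m) by exact: is_derive1_comp.
  apply: is_derive_eq; rewrite /= /GRing.scale/=; ring.
have cF (m : R) : {within `[a, b], continuous (E * (fun t => expR (m * t)))}.
  apply: continuous_in_subspaceT => s /[!inE]/=; rewrite in_itv/= => /(dF m)[ds _].
  by apply: differentiable_continuous; apply/derivable1_diffP.
have oc s : s \in `]a, b[ -> a <= s <= b by rewrite in_itv/= => /andP[/ltW-> /ltW->].
split.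
  have := @ler0_derive1_nincr R (E * (fun t => expR (- k * t))) a b.
  move=> /(_ (fun s sab => @ex_derive _ _ _ _ _ _ _ (dF (- k) s (oc s sab)))).
  have N x : x \in `]a, b[ -> derive1 (E * (fun t => expR (- k * t))) x <= 0.
    move=> /oc xab; rewrite derive1E (@derive_val _ _ _ _ _ _ _ (dF (- k) x xab)).
    rewrite mulr_le0_ge0 ?expR_ge0//; have [_] := dE x xab.
    by rewrite ler_norml => /andP[_]; lra.
  move=> /(_ N (cF (- k)) a b (lexx a) ab (lexx b)) => I.
  have {}I : E b * expR (- k * b) <= E a * expR (- k * a) by exact: I.
  by move: I; rewrite mulrBr expRD !mulNr !expRN ler_pdivrMr ?expR_gt0// => /le_trans; apply; rewrite mulrAC -mulrA mulrC.
have := @ger0_derive1_ndecr R (E * (fun t => expR (k * t))) a b.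
move=> /(_ (fun s sab => @ex_derive _ _ _ _ _ _ _ (dF k s (oc s sab)))).
have N x : x \in `]a, b[ -> 0 <= derive1 (E * (fun t => expR (k * t))) x.
  move=> /oc xab; rewrite derive1E (@derive_val _ _ _ _ _ _ _ (dF k x xab)).
  rewrite mulr_ge0 ?expR_ge0//; have [_] := dE x xab.
  by rewrite ler_norml => /andP[+ _]; lra.
move=> /(_ N (cF k) a b (lexx a) ab (lexx b)) => I.
have {}I : E a * expR (k * a) <= E b * expR (k * b) by exact: I.
by rewrite mulrBr expRD expRN mulrAC ler_pdivlMr ?expR_gt0// [expR _ * E b]mulrC.
Qed.

Lemma is_derive_dotvv (m : nat) (A : R -> 'rV[R]_m) (s : R) A' : derivable A s 1 ->
  derive1 A s = A' -> is_derive s 1 (fun t => dotv (A t) (A t)) (2 * dotv (A s) A').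
Proof.
move=> dA <-; have F : frechet (fun z : 'rV[R]_m => dotv z z) (A s) (2 *: A s).
  apply: (frechet_of_quadratic (C := m%:R) (d := 1)) => // z _.
  rewrite (_ : _ - _ - _ = dotv z z); last first.
    by rewrite dotvDl !dotvDr dotvZl [dotv z (A s)]dotvC; ring.
  by rewrite expr2 mulrA; exact: normr_dotv.
by rewrite -dotvZl; exact: (frechet_comp F dA).
Qed.

Lemma is_derive_dotvvB (m : nat) (f g : R -> 'rV[R]_m) (s : R) :
  derivable f s 1 -> derivable g s 1 ->
  is_derive s 1 (fun t => dotv (f t - g t) (f t - g t))
    (2 * dotv (f s - g s) (derive1 f s - derive1 g s)).
Proof.
move=> df dg; apply: (is_derive_dotvv (A := f - g)); first exact: derivableB.
by rewrite [LHS]derive1E (deriveB df dg) -(derive1E f) -(derive1E g).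
Qed.

End gronwall.

(** * Gronwall's estimate for Hamilton's equations *)

Section hamiltonian_system.
Context {R : realType} {n : nat}.
Variable H : 'rV[R]_n -> 'rV[R]_n -> R.
Hypothesis HT : Tonelli_Hamiltonian H.
Implicit Types (x y p q : R -> 'rV[R]_n).

Definition hamilton_at y q (s : R) := [/\ derivable y s 1, derive1 y s = Hp H (y s) (q s),
  derivable q s 1 & derive1 q s = - Hx H (y s) (q s)].

(** Squared Euclidean distance, since the sup norm is not differentiable. *)
Definition flow_distance y q x p (s : R) : R :=
  dotv (y s - x s) (y s - x s) + dotv (q s - p s) (q s - p s).

Lemma hamilton_gronwall (r : R) : exists k : R, forall y q x p a b, a <= b ->
  (forall s, a <= s <= b -> [/\ hamilton_at y q s, hamilton_at x p s, `|q s| <= r & `|p s| <= r]) ->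
  flow_distance y q x p b <= expR (k * (b - a)) * flow_distance y q x p a /\
  flow_distance y q x p a <= expR (k * (b - a)) * flow_distance y q x p b.
Proof.
have [D D0 DP] := H_bounds HT r; set N : R := n%:R; have N0 : 0 <= N by rewrite /N.
have B (z w : 'rV[R]_n) (e : R) : 0 <= e -> `|w| <= D * e -> `|2 * dotv z w| <= 2 * N * D * (`|z| * e).
  move=> e0 we; rewrite normrM ger0_norm//; have h1 := normr_dotv z w.
  have : n%:R * `|z| * `|w| <= n%:R * `|z| * (D * e) by rewrite ler_wpM2l// mulr_ge0.
  by rewrite -/N; move: h1; rewrite -/N; lra.
have sumsq (dy dq : 'rV[R]_n) : 2 * N * D * (`|dy| * (`|dy| + `|dq|)) + 2 * N * D * (`|dq| * (`|dy| + `|dq|))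
    <= 4 * N * D * (dotv dy dy + dotv dq dq).
  rewrite -mulrDr -mulrDl; have ND : 0 <= 2 * N * D by rewrite !mulr_ge0.
  have -> : 4 * N * D * (dotv dy dy + dotv dq dq) = 2 * N * D * (2 * (dotv dy dy + dotv dq dq)) by ring.
  rewrite ler_wpM2l//; have := norm_dotvv dy; have := norm_dotvv dq; rewrite !expr2.
  by have := sqr_ge0 (`|dy| - `|dq|); rewrite expr2; lra.
(* One factor 2 comes from differentiating squares, the other from bounding the square of a sum by
   twice the sum of the squares. *)
exists (4 * N * D) => y q x p a b ab hyp.
apply: (@gronwall _ (flow_distance y q x p) (fun s => 2 * dotv (y s - x s) (derive1 y s - derive1 x s) +
  2 * dotv (q s - p s) (derive1 q s - derive1 p s))); first exact: ab.
move=> s /hyp[[y1 y2 q1 q2] [x1 x2 p1 p2] qr pr]; split.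
  have d1 := is_derive_dotvvB y1 x1; have d2 := is_derive_dotvvB q1 p1.
  exact: (@is_deriveD _ _ _ _ _ _ _ _ _ d1 d2).
have [_ Hp_le Hx_le _] := DP (y s) (x s) (q s) (p s) qr pr.
rewrite y2 x2 q2 p2 -opprD; apply: le_trans (sumsq _ _).
apply: le_trans (ler_normD _ _) _; apply: lerD; apply: B.
- by rewrite addr_ge0.
- exact: Hp_le.
- by rewrite addr_ge0.
- by rewrite normrN; exact: Hx_le.
Qed.

End hamiltonian_system.

(** * Properties shared by all minimizing curves of a solution *)

Section characteristics.
Context {R : realType} {n : nat}.
Variables (H : 'rV[R]_n -> 'rV[R]_n -> R) (c : 'rV[R]_n) (h : R).
Hypothesis HT : Tonelli_Hamiltonian H.
Implicit Types (x y z p q xi : 'rV[R]_n) (g : R -> 'rV[R]_n) (v : 'rV[R]_n -> R).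

(** The constants [r] and [C] will be the same for all minimizing curves of [v]. Regularity at scale
    1 looks one unit of time ahead, whence [s <= -1]. *)
Definition characteristic v (r C : R) g := forall s : R, s < 0 ->
  [/\ hamilton_at H g (momentum c v g) s, `|momentum c v g s| <= r &
      s <= -1 -> regular_at (tilt c v) 1 C (g s) (momentum c v g s)].

Lemma calibratedW v (Lam Lam' r C C' : R) g : Lam <= Lam' -> C <= C' ->
  calibrated H c h v Lam r C g -> calibrated H c h v Lam' r C' g.
Proof.
move=> LL CC cg a b ab b0; have [h1 h2] := cg a b ab b0; split.
  by apply: le_trans h1 _; rewrite ler_wpM2r// subr_ge0.
move=> p pr; apply: le_trans (h2 p pr); rewrite lerD2l lerN2 ler_wpM2r//.
exact: sqr_ge0.
Qed.

Lemma minimizing_characteristic v : lipschitz_fun v -> representation_formula H c h v ->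
  exists r C, [/\ 0 <= C, forall g, minimizing_curve H c h v g -> characteristic v r C g &
    forall x, exists g, minimizing_curve_for H c h v x g].
Proof.
move=> [K' vK'] rep; pose K := Num.max 0 K'.
have K0 : 0 <= K by rewrite le_max lexx.
have vK x y : `|v x - v y| <= K * `|x - y|.
  by apply: le_trans (vK' x y) _; rewrite ler_wpM2r// le_max lexx orbT.
have dom := domination HT rep.
have [L1 L10 min] := minimizing_calibrated c h HT K0 vK.
have [L2 L20 step] := near_minimizing_step HT K0 vK rep.
(* [Lam] covers both the given minimizers, with [L1], and the curves built from chains, with
   [L2 + 1]. Speed bounds are fixed first, then [r], then the constants that depend on [r]. *)
pose Lam := Num.max L1 (L2 + 1).
have Lam0 : 0 <= Lam by rewrite le_max L10.
have [r r0 legr] := leg_bounded HT (Lam + 1).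
have [Ca Ca0 minC] := min r.
have [Cs Cs0 stepC] := step r.
have [Cb Cb0 exC] := calibrated_exists HT L20 Cs0 (Ku_ge0 c K0) (tilt_lipschitz c vK) stepC.
pose C1 := Num.max Ca Cb.
have C10 : 0 <= C1 by rewrite le_max Ca0.
have [C C0 CP] := calibrated_regular HT dom C1 Lam0 legr.
exists r, C; split=> //.
- move=> g /minC/(@calibratedW _ _ Lam _ _ C1) cg.
  have {}cg : calibrated H c h v Lam r C1 g by apply: cg; rewrite le_max lexx.
  move=> s s0; have [d1 d2] := cal_derivable C0 CP cg s0.
  have [d3 d4] := momentum_derivable HT dom Lam0 legr C0 CP cg s0.
  split; first by split.
    exact: (momentum_bounded HT legr C0 CP cg s0).
  move=> s1; have s1' : s + 1 ^+ 2 <= 0 by rewrite expr1n; lra.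
  by have [] := regular_momentum CP cg ltr01 (lexx 1) s1'.
move=> x; have [g [<- cg]] := exC x; exists g.
apply: (calibrated_minimizing HT Lam0 C10 legr C0 CP K0 vK rep).
by apply: calibratedW cg; rewrite le_max lexx orbT.
Qed.

End characteristics.

(** * Behaviour under integer translations *)

Section periodicity.
Context {R : realType} {n : nat}.
Implicit Types (x z : 'rV[R]_n).

Lemma intvN (k : 'rV[int]_n) : intv (- k) = - intv k :> 'rV[R]_n.
Proof. by apply/rowP => i; rewrite !mxE rmorphN. Qed.

Lemma periodicB (T : Type) (f : 'rV[R]_n -> T) x k : Zn_periodic f -> f (x - intv k) = f x.
Proof. by move=> fp; rewrite -intvN fp. Qed.

Lemma grad_periodic (f : 'rV[R]_n -> R) : Zn_periodic f -> Zn_periodic (grad f).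
Proof.
move=> fp x k; apply/rowP => i; rewrite !mxE /pder /derive.
suff -> : (fun t => t^-1 *: ((f \o shift (x + intv k)) (t *: evec i) - f (x + intv k))) =
  (fun t => t^-1 *: ((f \o shift x) (t *: evec i) - f x)) by [].
by apply/funext => t /=; rewrite addrA !fp.
Qed.

Lemma Hp_periodic (H : 'rV[R]_n -> 'rV[R]_n -> R) p :
  (forall q, Zn_periodic (fun x => H x q)) -> Zn_periodic (fun x => Hp H x p).
Proof.
by move=> per x k; rewrite /Hp; suff -> : H (x + intv k) = H x by []; apply/funext => q; exact: per.
Qed.

Lemma Hx_periodic (H : 'rV[R]_n -> 'rV[R]_n -> R) p :
  (forall q, Zn_periodic (fun x => H x q)) -> Zn_periodic (fun x => Hx H x p).
Proof. by move=> per; apply: grad_periodic; exact: per. Qed.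

(** The linear part of [tilt c v] spoils its periodicity but not that of its increments. *)
Lemma tilt_shift c (v : 'rV[R]_n -> R) x z k : Zn_periodic v ->
  tilt c v (x - intv k + z) - tilt c v (x - intv k) = tilt c v (x + z) - tilt c v x.
Proof.
by move=> vp; rewrite /tilt [x - _ + z]addrAC !(periodicB _ _ vp) !(dotvDr, dotvNr); ring.
Qed.

Lemma regular_shift c (v : 'rV[R]_n -> R) t C x P k : Zn_periodic v ->
  regular_at (tilt c v) t C x P -> regular_at (tilt c v) t C (x - intv k) P.
Proof. by move=> vp [PC HP]; split=> // s z s0 st zs; rewrite tilt_shift//; exact: HP. Qed.

End periodicity.

(** * Alpha-limit points modulo the lattice *)

Section alpha_limits.
Context {R : realType} {n : nat}.
Implicit Types (x y z : 'rV[R]_n) (g : R -> 'rV[R]_n).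

Lemma cvg_rV_near (a : nat -> 'rV[R]_n) y e : a @ \oo --> y -> 0 < e ->
  \forall j \near \oo, `|a j - y| < e.
Proof.
move=> ay e0; have ae : \forall j \near \oo, `|y - a j| < e.
  exact: (ay [set z | `|y - z| < e] (near_norm y e0)).
by apply: filterS ae => j; rewrite distrC.
Qed.

Lemma alpha_limit_near g y e B : alpha_limit g y -> 0 < e ->
  exists (tau : nat -> R) (k : nat -> 'rV[int]_n), [/\ tau @ \oo --> -oo &
    forall j, `|g (tau j) - intv (k j) - y| < e /\ tau j <= B].
Proof.
move=> [tau [k [tauN ky]]] e0.
have [N1 _ N1P] := cvg_rV_near ky e0.
have [N2 _ N2P] : \forall j \near \oo, tau j <= B by move/cvgrNyPle: tauN; exact.
exists (fun j => tau (j + (N1 + N2))%N), (fun j => k (j + (N1 + N2))%N); split.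
  apply/cvgrNyPle => A; have [N _ NP] : \forall j \near \oo, tau j <= A by move/cvgrNyPle: tauN; exact.
  by exists N => // j /= Nj; apply: NP; exact: leq_trans (leq_addr _ _).
move=> j; split; first by apply: N1P; rewrite /= addnCA leq_addr.
by apply: N2P; rewrite /= addnA leq_addl.
Qed.

Lemma alpha_limit_cluster g (tau : nat -> R) (k : nat -> 'rV[int]_n) P : tau @ \oo --> -oo ->
  (forall e N, 0 < e -> exists2 j, (N <= j)%N & `|g (tau j) - intv (k j) - P| < e) ->
  alpha_limit g P.
Proof.
move=> tauN cl.
have /choice[f fP] (N : nat) : exists j, (N <= j)%N /\ `|g (tau j) - intv (k j) - P| < N.+1%:R^-1.
  have [|j Nj jP] := cl N.+1%:R^-1 N; first by rewrite invr_gt0.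
  by exists j.
exists (tau \o f), (k \o f); split.
  apply/cvgrNyPle => A; have [N _ NP] : \forall j \near \oo, tau j <= A by move/cvgrNyPle: tauN; exact.
  by exists N => // j /= Nj; apply: NP; apply: leq_trans Nj _; have [] := fP j.
move=> A /nbhs_normP[d d0 dA].
exists (Num.bound d^-1) => // j /= Nj.
suff jd : `|P - (g (tau (f j)) - intv (k (f j)))| < d by exact: dA.
rewrite distrC; apply: lt_le_trans (proj2 (fP j)) _; rewrite -[d]invrK lef_pV2 ?posrE ?invr_gt0//.
apply: ltW; apply: lt_le_trans (archi_boundP _) _; first by rewrite invr_ge0 ltW.
by rewrite ler_nat ltnW.
Qed.

Lemma bounded_alpha_limit g (tau : nat -> R) (k : nat -> 'rV[int]_n) y M : tau @ \oo --> -oo ->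
  (forall j, `|g (tau j) - intv (k j) - y| <= M) ->
  exists w, [/\ alpha_limit g w, `|w - y| <= M &
    forall e, 0 < e -> exists j, `|g (tau j) - intv (k j) - w| < e].
Proof.
move=> tauN aM; have [P [PM cl]] := bounded_cluster aM.
have wP e N : 0 < e -> exists2 j, (N <= j)%N & `|g (tau j) - intv (k j) - (y + P)| < e.
  by move=> e0; have [j Nj jP] := cl e N e0; exists j; rewrite // opprD addrA.
exists (y + P); split.
- exact: alpha_limit_cluster wP.
- by rewrite addrAC subrr add0r.
- by move=> e e0; have [j _ jP] := wP e 0%N e0; exists j.
Qed.

End alpha_limits.

(** * Regularity on the alpha-limit set *)

Section one_solution.
Context {R : realType} {n : nat}.
Variables (H : 'rV[R]_n -> 'rV[R]_n -> R) (c : 'rV[R]_n) (h : R) (v : 'rV[R]_n -> R).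
Hypothesis HT : Tonelli_Hamiltonian H.
Local Notation u := (tilt c v).
Hypothesis vper : Zn_periodic v.
Variables (K r C : R).
Hypothesis K0 : 0 <= K.
Hypothesis vK : forall x y, `|v x - v y| <= K * `|x - y|.
Hypothesis C0 : 0 <= C.
Hypothesis chars : forall g, minimizing_curve H c h v g -> characteristic H c v r C g.
Implicit Types (x y z : 'rV[R]_n) (g : R -> 'rV[R]_n).

(** Resolves the closure: near a point of the set, a single minimizing curve passes at a whole
    sequence of remote times. One time would not do for [EL_Malpha], which has to find an
    alpha-limit point again. *)
Lemma Malpha_near y e B : Malpha_v H c h v y -> 0 < e ->
  exists g (tau : nat -> R) (k : nat -> 'rV[int]_n), [/\ minimizing_curve H c h v g,
    tau @ \oo --> -oo & forall j, `|g (tau j) - intv (k j) - y| <= e /\ tau j <= B].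
Proof.
move=> My e0; have e2 : 0 < e / 2 by rewrite divr_gt0.
have [z [[g [ming ag]] /= yz]] := My _ (near_norm y e2).
have [tau [k [tauN tk]]] := alpha_limit_near B ag e2.
exists g, tau, k; split=> // j; have [h1 h2] := tk j; split=> //.
rewrite -(subrKA z); apply: le_trans (ler_normD _ _) _; rewrite distrC in yz; lra.
Qed.

Lemma Malpha_regular y : Malpha_v H c h v y -> regular_at u 1 C y (grad u y).
Proof.
move=> My; have [e e0|P PR] := regular_closed (t := 1) (C := C) (x := y) (Ku_ge0 c K0) (tilt_lipschitz c vK).
  have e2 : 0 < e / 2 by rewrite divr_gt0.
  have [g [tau [k [ming _ /(_ 0%N)[gy t1]]]]] := Malpha_near (-1) My e2.
  have s0 : tau 0%N < 0 by lra.
  have [_ _ /(_ t1) reg] := chars ming s0.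
  exists (g (tau 0%N) - intv (k 0%N)), (momentum c v g (tau 0%N)); split.
    by rewrite distrC; lra.
  exact: regular_shift.
by rewrite (frechet_grad (regular_frechet ltr01 PR)).
Qed.

Lemma regular_solution y P : regular_at u 1 C y P ->
  [/\ grad u y = P, differentiable v y & grad v y = P - c].
Proof.
move=> /(regular_frechet ltr01) F; split; first exact: frechet_grad F.
  by have [] := frechet_diff (frechet_tilt F).
exact: frechet_grad (frechet_tilt F).
Qed.

Lemma characteristic_regular g s k : minimizing_curve H c h v g -> s <= -1 ->
  regular_at u 1 C (g s - intv k) (momentum c v g s).
Proof.
move=> ming s1; have s0 : s < 0 by lra.
by have [_ _ /(_ s1)] := chars ming s0; exact: regular_shift.
Qed.

(** On the curve the velocity is [Hp] at the momentum. Regular points within [s ^+ 3 / 2] of each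
    other have gradients within [6 * C * s], so convergence of the positions already forces
    convergence of the momenta. *)
Lemma alpha_limit_velocity g (tau : nat -> R) (k : nat -> 'rV[int]_n) (xs xis : 'rV[R]_n) :
  minimizing_curve H c h v g -> tau @ \oo --> -oo ->
  (fun j => g (tau j) - intv (k j)) @ \oo --> xs ->
  (fun j => (derive1 g) (tau j)) @ \oo --> xis ->
  Malpha_v H c h v xs /\ xis = Hp H xs (grad u xs).
Proof.
move=> ming tauN gxs gxis.
have Mxs : Malpha_v H c h v xs.
  by apply: subset_closure; exists g; split=> //; exists tau, k.
have HP := Malpha_regular Mxs; split=> //.
have [D D0 DP] := H_bounds HT C.
apply/eqP; rewrite -subr_eq0 -normr_le0.
apply: (@le_of_small _ _ _ (1 + D * (1 + 6 * C)) 1) => // [|s s0 s1].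
  by rewrite addr_ge0// mulr_ge0// addr_ge0// mulr_ge0.
have s30 : 0 < s ^+ 3 / 2 by rewrite divr_gt0// exprn_gt0.
have s3 : s ^+ 3 / 2 <= s.
  have s3s : s ^+ 3 <= s by rewrite exprS ler_piMr ?(ltW s0)// exprn_ile1// ltW.
  by apply: le_trans s3s; rewrite ler_piMr ?exprn_ge0 ?(ltW s0)// invf_le1// ler1n.
have N1 := cvg_rV_near gxs s30; have N2 := cvg_rV_near gxis s0.
have N3 : \forall j \near \oo, tau j <= -1 by move/cvgrNyPle: tauN; exact.
have [j [[j1 j2] j3]] := filter_ex (filterI (filterI N1 N2) N3).
have t0 : tau j < 0 by lra.
have [[_ dg _ _] _ _] := chars ming t0.
have GP := characteristic_regular (k j) ming j3.
have PP := regular_holder GP HP s0 s1 (ltW j1).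
have [_ B _ _] := DP (g (tau j) - intv (k j)) xs _ _ GP.1 HP.1.
rewrite (periodicB _ _ (Hp_periodic _ _)) in B; last by case: HT.
rewrite -dg in B; rewrite add0r -(subrKA (derive1 g (tau j))).
apply: le_trans (ler_normD _ _) _; rewrite distrC.
have : D * (`|g (tau j) - intv (k j) - xs| + `|momentum c v g (tau j) - grad u xs|)
    <= D * (s + 6 * C * s).
  by rewrite ler_wpM2l// lerD// (le_trans (ltW j1)).
move=> /(le_trans B) {}B; rewrite mulrDl mul1r; apply: lerD; first exact: ltW j2.
by apply: le_trans B _; rewrite -[leRHS]mulrA [(1 + _) * s]mulrDl mul1r.
Qed.

End one_solution.

(** * Stability of solutions of Hamilton's equations *)

Section shadowing.
Context {R : realType} {n : nat}.
Variable H : 'rV[R]_n -> 'rV[R]_n -> R.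
Hypothesis HT : Tonelli_Hamiltonian H.
Implicit Types (x p : R -> 'rV[R]_n).

Definition el_momentum x (s : R) := leg H (x s) (derive1 x s).

Lemma EL_hamilton x s : EL_solution H x -> hamilton_at H x (el_momentum x) s.
Proof.
move=> /(_ s)[d1 []]; have -> : (fun t => Lxi H (x t) (derive1 x t)) = el_momentum x.
  by apply/funext => t; exact: LxiE.
rewrite (LxE HT) => d2 d3; split=> //.
exact: (esym (Hp_leg HT (x s) (derive1 x s))).
Qed.

Lemma derive1_translate (f F : R -> 'rV[R]_n) (a s : R) :
  (forall t t', F t - F t' = f (a + t) - f (a + t')) -> derivable f (a + s) 1 ->
  derivable F s 1 /\ derive1 F s = derive1 f (a + s).
Proof.
move=> Ff df; have /derive1_rVP P : derivable f (a + s) 1 /\ derive1 f (a + s) = derive1 f (a + s) by split.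
apply/derive1_rVP => e /P[d d0 dP]; exists d => // k /dP.
by rewrite Ff addrA.
Qed.

Lemma hamilton_translate (y q Y Q : R -> 'rV[R]_n) (a s : R) k :
  (forall t, Y t = y (a + t) - intv k) -> (forall t, Q t = q (a + t)) ->
  hamilton_at H y q (a + s) -> hamilton_at H Y Q s.
Proof.
move=> Yy Qq [y1 y2 q1 q2].
have per : forall p : 'rV[R]_n, Zn_periodic (fun z : 'rV[R]_n => H z p) by case: HT.
have [d1 e1] : derivable Y s 1 /\ derive1 Y s = derive1 y (a + s).
  by apply: derive1_translate => // t t'; rewrite !Yy opprB addrA subrK.
have [d2 e2] : derivable Q s 1 /\ derive1 Q s = derive1 q (a + s).
  by apply: derive1_translate => // t t'; rewrite !Qq.
rewrite /hamilton_at e1 e2 Yy Qq (periodicB _ _ (Hp_periodic _ per)) (periodicB _ _ (Hx_periodic _ per)).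
by split.
Qed.

Lemma derivable_bounded p (S : R) : 0 <= S -> (forall s, derivable p s 1) ->
  exists B, forall s, - S <= s <= S -> `|p s| <= B.
Proof.
move=> S0 dp; have SS : - S <= S by lra.
have [|m _ mP] := @EVT_max R (fun s => `|p s|) (- S) S SS.
  apply: continuous_subspaceT => s; apply: continuous_comp; last exact: norm_continuous.
  by apply: differentiable_continuous; apply/derivable1_diffP.
by exists `|p m| => s sS; apply: mP; rewrite in_itv.
Qed.

(** Momenta of the comparison curve are bounded by hypothesis, those of the given solution by
    continuity on a compact time interval; this confines both to one strip, where Gronwall's
    estimate applies. *)
Lemma flow_stability x p (r s : R) : (forall t, hamilton_at H x p t) ->
  exists2 A, 0 <= A & forall y q, (forall t, - `|s| <= t <= `|s| -> hamilton_at H y q t /\ `|q t| <= r) ->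
    forall m, `|y 0 - x 0| <= m -> `|q 0 - p 0| <= m ->
    `|y s - x s| <= A * m /\ `|q s - p s| <= A * m.
Proof.
move=> Hxp; have [B BP] : exists B, forall t, - `|s| <= t <= `|s| -> `|p t| <= B.
  by apply: derivable_bounded => // t; have [] := Hxp t.
have [k kP] := hamilton_gronwall HT (Num.max B r).
pose N : R := n%:R; have N0 : 0 <= N by rewrite /N.
pose A := expR (k * `|s|) * (2 * N).
have A0 : 0 <= A by rewrite mulr_ge0 ?expR_ge0// mulr_ge0.
(* Gronwall bounds the squared distance by [A * m ^+ 2]; the larger [((A + 1) * m) ^+ 2] is a
   perfect square. *)
exists (A + 1) => [|y q yq m ym qm]; first by rewrite addr_ge0.
have m0 : 0 <= m := le_trans (normr_ge0 _) ym.
have grow : flow_distance y q x p s <= expR (k * `|s|) * flow_distance y q x p 0.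
  have hyp a b : - `|s| <= a -> b <= `|s| -> forall t, a <= t <= b ->
      [/\ hamilton_at H y q t, hamilton_at H x p t, `|q t| <= Num.max B r & `|p t| <= Num.max B r].
    move=> a1 b1 t /andP[t1 t2]; have tt : - `|s| <= t <= `|s|.
      by rewrite (le_trans a1 t1) (le_trans t2 b1).
    have [h1 h2] := yq t tt; split=> //.
      by rewrite le_max h2 orbT.
    by rewrite le_max BP.
  have [s0|/ltW s0] := leP 0 s.
    have h1 : - `|s| <= 0 by rewrite oppr_le0.
    have h2 : s <= `|s| by exact: ler_norm.
    have [+ _] := kP y q x p 0 s s0 (hyp 0 s h1 h2).
    by rewrite subr0 ger0_norm.
  have h1 : - `|s| <= s by rewrite ler0_norm// opprK.
  have [_] := kP y q x p s 0 s0 (hyp s 0 h1 (normr_ge0 s)).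
  by rewrite sub0r ler0_norm.
have E0 : flow_distance y q x p 0 <= 2 * N * m ^+ 2.
  have B2 (z : 'rV[R]_n) : `|z| <= m -> dotv z z <= N * m ^+ 2.
    move=> zm; apply: le_trans (dotv_le _ _) _; rewrite -mulrA expr2 ler_wpM2l//.
    exact: ler_pM.
  by have := B2 _ ym; have := B2 _ qm; rewrite /flow_distance; lra.
have Es : flow_distance y q x p s <= ((A + 1) * m) ^+ 2.
  apply: le_trans grow _; apply: (@le_trans _ _ (A * m ^+ 2)).
    by rewrite /A -!mulrA ler_wpM2l ?expR_ge0// mulrA.
  rewrite exprMn ler_wpM2r ?sqr_ge0// expr2; have := mulr_ge0 A0 A0; lra.
have fin (z : 'rV[R]_n) : dotv z z <= ((A + 1) * m) ^+ 2 -> `|z| <= (A + 1) * m.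
  move=> zz; rewrite -(ler_pXn2r (n := 2))// ?nnegrE ?mulr_ge0 ?addr_ge0//.
  exact: le_trans (norm_dotvv z) zz.
by split; apply: fin; apply: le_trans Es; rewrite /flow_distance ?lerDl ?lerDr dotvv_ge0.
Qed.

End shadowing.

(** * Invariance of the alpha-limit set under the Euler-Lagrange flow *)

Section invariance.
Context {R : realType} {n : nat}.
Variables (H : 'rV[R]_n -> 'rV[R]_n -> R) (c : 'rV[R]_n) (h : R) (v : 'rV[R]_n -> R).
Hypothesis HT : Tonelli_Hamiltonian H.
Local Notation u := (tilt c v).
Hypothesis vper : Zn_periodic v.
Variables (K r C : R).
Hypothesis K0 : 0 <= K.
Hypothesis vK : forall x y, `|v x - v y| <= K * `|x - y|.
Hypothesis C0 : 0 <= C.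
Hypothesis chars : forall g, minimizing_curve H c h v g -> characteristic H c v r C g.
Variables (xs : 'rV[R]_n) (x : R -> 'rV[R]_n).
Hypothesis Mxs : Malpha_v H c h v xs.
Hypothesis ELx : EL_solution H x.
Hypothesis x0 : x 0 = xs.
Hypothesis dx0 : derive1 x 0 = Hp H xs (grad u xs).
Implicit Types (g : R -> 'rV[R]_n).

(** The bound on [tau] keeps all times between [tau] and [tau + s] at most [-1]. Closeness
    [m ^+ 3 / 2] in position yields closeness [6 * C * m] in momentum by [regular_holder], and both
    propagate over the time [s]. *)
Lemma EL_shadow s : exists2 A, 0 <= A & forall (m : R) g tau k, 0 < m -> m <= 1 ->
  minimizing_curve H c h v g -> tau <= - (`|s| + 1) -> `|g tau - intv k - xs| <= m ^+ 3 / 2 ->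
  `|g (tau + s) - intv k - x s| <= A * m /\ `|momentum c v g (tau + s) - el_momentum H x s| <= A * m.
Proof.
have [A A0 AP] := flow_stability HT r s (fun t => EL_hamilton HT t ELx).
have HP := Malpha_regular vper K0 vK chars Mxs.
exists (A * (6 * C + 1)) => [|m g tau k m0 m1 ming tauB near].
  by rewrite mulr_ge0// addr_ge0// mulr_ge0.
have tau1 : tau <= -1 by have := normr_ge0 s; lra.
rewrite -mulrA; apply: (AP (fun t => g (tau + t) - intv k) (fun t => momentum c v g (tau + t))).
- move=> t /andP[_ ts]; have t0 : tau + t < 0 by lra.
  have [ham qr _] := chars ming t0; split; last exact: qr.
  exact: (hamilton_translate HT (k := k) _ _ ham).
- rewrite addr0 x0; apply: le_trans near _.
  have m3 : m ^+ 3 <= m by rewrite exprS ler_piMr ?(ltW m0)// exprn_ile1// ltW.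
  apply: (@le_trans _ _ m); last by rewrite ler_peMl ?(ltW m0)// lerDr mulr_ge0.
  by apply: le_trans m3; rewrite ler_piMr ?exprn_ge0 ?(ltW m0)// invf_le1// ler1n.
- rewrite addr0 /el_momentum dx0 x0 (leg_Hp HT).
  apply: le_trans (regular_holder (characteristic_regular vper chars k ming tau1) HP m0 m1 near) _.
  by rewrite ler_wpM2r ?(ltW m0)// lerDl.
Qed.

(** Along one curve the times [tau j + s] again tend to minus infinity, so the shadowing points
    cluster at an alpha-limit point within [A * m] of [x s]. *)
Lemma EL_Malpha s : Malpha_v H c h v (x s).
Proof.
have [A A0 AP] := EL_shadow s; have A1 : 0 < A + 1 by rewrite ltr_wpDl.
move=> B /nbhs_normP[d d0 dB].
pose m := Num.min 1 (d / 2 / (A + 1)).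
have m0 : 0 < m by rewrite lt_min ltr01/= !divr_gt0.
have m1 : m <= 1 by rewrite ge_min lexx.
have Am : A * m < d.
  have md : m <= d / 2 / (A + 1) by rewrite ge_min lexx orbT.
  apply: (@le_lt_trans _ _ (d / 2)); last by rewrite ltr_pdivrMr// ltr_pMr// ltr1n.
  rewrite -(divfK (lt0r_neq0 A1) (d / 2)) mulrC; apply: ler_pM => //; first exact: ltW.
  by rewrite lerDl.
have m3 : 0 < m ^+ 3 / 2 by rewrite divr_gt0// exprn_gt0.
have [g [tau [k [ming tauN near]]]] := Malpha_near (- (`|s| + 1)) Mxs m3.
have tausN : (fun j => tau j + s) @ \oo --> -oo.
  apply/cvgrNyPle => b.
  have [N _ NP] : \forall j \near \oo, tau j <= b - s by move/cvgrNyPle: tauN; exact.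
  by exists N => // j /= /NP /=; rewrite lerBrDr.
have sh j : `|g (tau j + s) - intv (k j) - x s| <= A * m.
  by have [h1 h2] := near j; have [] := AP m g (tau j) (k j) m0 m1 ming h2 h1.
have [w [aw wA _]] := bounded_alpha_limit tausN sh.
exists w; split; first by exists g.
suff wd : `|x s - w| < d by exact: dB.
by rewrite distrC; exact: le_lt_trans wA Am.
Qed.

(** The shadowing curve passes within [e ^+ 3 / 2] of [x s], a regular point by [EL_Malpha]. Its
    momentum there is close to the gradient at [x s] by [regular_holder], and close to the momentum
    of the Euler-Lagrange solution by shadowing. *)
Lemma EL_gradient s : grad u (x s) = el_momentum H x s.
Proof.
have [A A0 AP] := EL_shadow s; have A1 : 0 < 2 * (A + 1) by rewrite mulr_gt0// ltr_wpDl.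
have HQ := Malpha_regular vper K0 vK chars (@EL_Malpha s).
apply/eqP; rewrite -subr_eq0 -normr_le0.
apply: (@le_of_small _ _ _ (6 * C + 1) 1) => // [|e e0 e1]; first by rewrite addr_ge0// mulr_ge0.
pose m := e ^+ 3 / (2 * (A + 1)).
have e30 : 0 < e ^+ 3 by rewrite exprn_gt0.
have e3e : e ^+ 3 <= e by rewrite exprS ler_piMr ?(ltW e0)// exprn_ile1// ltW.
have m0 : 0 < m by rewrite divr_gt0.
have m1 : m <= 1.
  rewrite ler_pdivrMr// mul1r; apply: le_trans e3e _; apply: le_trans e1 _; lra.
have Am : A * m <= e ^+ 3 / 2.
  have -> : e ^+ 3 / 2 = (A + 1) * m by rewrite /m; field; rewrite gt_eqF// ltr_wpDl.
  by rewrite ler_wpM2r ?(ltW m0)// lerDl.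
have m3 : 0 < m ^+ 3 / 2 by rewrite divr_gt0// exprn_gt0.
have [g [tau [k [ming _ /(_ 0%N)[near tauB]]]]] := Malpha_near (- (`|s| + 1)) Mxs m3.
have [h1 h2] := AP m g _ _ m0 m1 ming tauB near.
have ts : tau 0%N + s <= -1 by have := ler_norm s; lra.
have := regular_holder (characteristic_regular vper chars (k 0%N) ming ts) HQ e0 e1 (le_trans h1 Am).
rewrite distrC add0r => h3.
rewrite -(subrKA (momentum c v g (tau 0%N + s))); apply: le_trans (ler_normD _ _) _.
rewrite mulrDl mul1r; apply: lerD h3 _; apply: le_trans h2 _; apply: le_trans Am _.
by apply: le_trans e3e; rewrite ler_piMr ?(ltW e30)// invf_le1// ler1n.
Qed.

End invariance.

(** * Comparison of two solutions *)

Section comparison.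
Context {R : realType} {n : nat}.
Variables (H : 'rV[R]_n -> 'rV[R]_n -> R) (c : 'rV[R]_n) (h : R).
Implicit Types (x y z : 'rV[R]_n) (v w : 'rV[R]_n -> R) (g : R -> 'rV[R]_n).

Lemma minimizing_comparison v w g x (T : R) : representation_formula H c h w ->
  minimizing_curve_for H c h v x g -> 0 < T -> w x - v x <= w (g (- T)) - v (g (- T)).
Proof.
move=> rep [_ ming] T0; have [adm] := ming T T0.
have : ((w x)%:E <= action H c h T g + (w (g (- T)))%:E)%E.
  by rewrite (rep x T T0); apply: ereal_inf_lbound; exists g.
(* The equation for the real number [v x] excludes infinite actions. *)
case: (action H c h T g) => [a| |] //=; rewrite -!EFinD lee_fin => W [V]; lra.
Qed.

(** Only a minimizing curve of [v] is followed, so agreement on the alpha-limit set of [v] yields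
    one of the two inequalities. *)
Lemma solution_le v w x : Zn_periodic v -> Zn_periodic w -> lipschitz_fun v -> lipschitz_fun w ->
  representation_formula H c h w -> (forall y, exists g, minimizing_curve_for H c h v y g) ->
  (forall y, Malpha_v H c h v y -> v y = w y) -> w x <= v x.
Proof.
move=> vper wper [Kv vK] [Kw wK] rep ex vw; have [g ming] := ex x.
have /choice[k kP] (j : nat) : exists k : 'rV[int]_n, `|g (- j.+1%:R) - intv k - 0| <= 1.
  by have [k kP] := rV_mod_Zn (g (- j.+1%:R)); exists (- k); rewrite intvN opprK subr0.
have tauN : (fun j : nat => - j.+1%:R : R) @ \oo --> -oo.
  apply/cvgrNyPle => A; exists (Num.bound (- A)) => // j /= Nj; rewrite lerNl ltW//.
  have [A0|A0] := leP 0 (- A).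
    by apply: lt_le_trans (archi_boundP A0) _; rewrite ler_nat ltnW.
  by apply: lt_le_trans A0 _.
have [y [ay _ near]] := bounded_alpha_limit tauN kP.
have vwy : v y = w y.
  by apply: vw; apply: subset_closure; exists g; split=> //; exists x.
rewrite -subr_le0; pose M := `|Kv| + `|Kw|.
apply: (@le_of_small _ _ _ M 1) => // [|e e0 _]; first by rewrite addr_ge0.
have [j jy] := near e e0.
have := minimizing_comparison rep ming (ltr0Sn R j) => I; rewrite add0r; apply: le_trans I _.
rewrite -(periodicB _ (k j) vper) -(periodicB _ (k j) wper).
set z := _ - intv _ in jy *.
have B (f : 'rV[R]_n -> R) (L : R) : (forall a b, `|f a - f b| <= L * `|a - b|) -> `|f z - f y| <= `|L| * e.
  move=> fL; apply: le_trans (fL z y) _; apply: le_trans (ler_norm _) _.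
  by rewrite normrM normr_id ler_wpM2l// ltW.
have := B v Kv vK; have := B w Kw wK; rewrite !ler_norml vwy /M => /andP[_ h1] /andP[h2 _].
by move: h1 h2; lra.
Qed.

End comparison.

Theorem theorem2p2 (R : realType) (n : nat)
  (H : 'rV[R]_n -> 'rV[R]_n -> R) (c : 'rV[R]_n) (h : R)
  (HT : Tonelli_Hamiltonian H)
  (weakKAM : forall w : 'rV[R]_n -> R, viscosity_solution H c h w ->
      lipschitz_fun w /\ representation_formula H c h w)
  (v : 'rV[R]_n -> R) (hv : viscosity_solution H c h v) :
  [/\
    (* (i) *)
    (forall x, Malpha_v H c h v x -> differentiable v x),
    (* (ii) *)
    (forall (g : R -> 'rV[R]_n) (xs xis : 'rV[R]_n),
       minimizing_curve H c h v g ->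
       (exists (tau : nat -> R) (k : nat -> 'rV[int]_n),
          [/\ tau @ \oo --> -oo,
              (fun j => g (tau j) - intv (k j)) @ \oo --> xs &
              (fun j => (derive1 g) (tau j)) @ \oo --> xis]) ->
       xis = Hp H xs (c + grad v xs)),
    (* (iii) *)
    (forall (xs : 'rV[R]_n) (x : R -> 'rV[R]_n),
       Malpha_v H c h v xs -> EL_solution H x ->
       x 0 = xs -> (derive1 x) 0 = Hp H xs (c + grad v xs) ->
       forall s : R,
         [/\ Malpha_v H c h v (x s), differentiable v (x s) &
             grad v (x s) = Lxi H (x s) ((derive1 x) s) - c]) &
    (* (iv) *)
    (forall vt : 'rV[R]_n -> R, viscosity_solution H c h vt ->
       (forall y, Malpha H c h y -> v y = vt y) ->
       forall y, v y = vt y)].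
Proof.
have [vlip rep] := weakKAM v hv; have [vper _ _ _] := hv.
have [r [C [C0 chars ex]]] := minimizing_characteristic HT vlip rep.
have [K' vK'] := vlip; pose K := Num.max 0 K'.
have K0 : 0 <= K by rewrite le_max lexx.
have vK x y : `|v x - v y| <= K * `|x - y|.
  by apply: le_trans (vK' x y) _; rewrite ler_wpM2r// le_max lexx orbT.
have reg y (My : Malpha_v H c h v y) := regular_solution (Malpha_regular vper K0 vK chars My).
have gradE y : Malpha_v H c h v y -> c + grad v y = grad (tilt c v) y.
  by move=> /reg[_ _ ->]; rewrite addrC subrK.
split.
- by move=> x /reg[].
- move=> g xs xis ming [tau [k [tauN gxs gxis]]].
  have [Mxs ->] := alpha_limit_velocity HT vper K0 vK C0 chars ming tauN gxs gxis.
  by rewrite gradE.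
- move=> xs x Mxs ELx x0; rewrite gradE// => dx0 s.
  have Ms : Malpha_v H c h v (x s) := EL_Malpha HT vper K0 vK C0 chars Mxs ELx x0 dx0 (s := s).
  have [_ dv ->] := reg _ Ms; split=> //; rewrite (LxiE HT).
  by rewrite (EL_gradient HT vper K0 vK C0 chars Mxs ELx x0 dx0 s).
move=> w hw vw y; have [wlip wrep] := weakKAM w hw; have [wper _ _ _] := hw.
have [_ [_ [_ _ wex]]] := minimizing_characteristic HT wlip wrep.
(* [Malpha] contains the alpha-limit sets of both solutions, so the comparison can be used twice
   with exchanged roles. *)
have sub f : viscosity_solution H c h f -> forall z, Malpha_v H c h f z -> v z = w z.
  by move=> hf z Mz; apply: vw; apply: subset_closure; exists f.
apply/eqP; rewrite eq_le; apply/andP; split.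
  by apply: (solution_le y wper vper wlip vlip rep wex) => z Mz; rewrite (sub w).
by apply: (solution_le y vper wper vlip wlip wrep ex) => z Mz; rewrite (sub v).
Qed.
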